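(* Consider the Maker-Breaker game $\mathfrak{MB}(K_{\omega,\omega_1},K_{\omega,\omega_1})$. Then: (i) (ZFC + GCH) Breaker has a winning strategy in $\mathfrak{MB}(K_{\omega,\omega_1},K_{\omega,\omega_1})$; (ii) (ZFC + $\omega_1<\mathfrak{p}$) Maker has a winning strategy in $\mathfrak{MB}(K_{\omega,\omega_1},K_{\omega,\omega_1})$. Consequently (both ZFC+GCH and ZFC+$\omega_1<\mathfrak{p}$ being consistent relative to ZFC), it is independent of ZFC whether Breaker has a winning strategy in this game.
   Context: A graph is a pair $(V,E)$ with $E\subseteq[V]^2$. $K_{\lambda,\kappa}$ is the complete bipartite graph with vertex set $(\lambda\times\{0\})\cup(\kappa\times\{1\})$ and edge set $\{\{(\alpha,0),(\beta,1)\}:\alpha<\lambda,\beta<\kappa\}$. For graphs $G,H$, the Maker-Breaker game $\mathfrak{MB}(G,H)$ is played on the edge set of $G$ in turns indexed by ordinals; in each turn Maker first claims a previously unclaimed edge of $G$, and then Breaker claims a previously unclaimed edge. The game ends when all edges have been claimed, and Maker wins iff the subgraph $G_M$ of $G$ formed by the edges claimed by Maker contains a subgraph isomorphic to $H$; otherwise Breaker wins. A winning strategy for a player is a strategy guaranteeing that player wins against every play of the opponent. A family $\mathcal F$ of sets has the strong finite intersection property if every intersection of finitely many members is infinite; $P$ is a pseudo-intersection of $\mathcal F$ if $P\setminus F$ is finite for all $F\in\mathcal F$. $\mathfrak{p}$ is the minimal cardinality of a family of subsets of $\omega$ with the strong finite intersection property that has no infinite pseudo-intersection. GCH is the generalised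 continuum hypothesis. *)

(* Defs.v *)
(* "ZFC proves" and "independent of ZFC" are claims
   about the first-order theory ZFC, so every set-theoretic notion below is
   interpreted in an arbitrary structure (M, mem) for the language of set theory,
   with all quantifiers ranging over M.  Such an M has no function symbols, so
   set-theoretic operations are given by their graphs: [is_foo r x y] says that
   r is the set foo(x, y). *)

From Stdlib Require Import Setoid.

Record structure := Structure {
  carrier :> Type;
  mem : carrier -> carrier -> Prop
}.

Arguments mem {s} _ _.
Notation "x ∈ y" := (mem x y) (at level 70, no associativity).

(* variables are de Bruijn indices *)

Inductive formula : Type :=
  | FMem (i j : nat)
  | FEq (i j : nat)
  | FFalse
  | FImp (f g : formula)
  | FAnd (f g : formula)
  | FOr (f g : formula)
  | FAll (f : formula)
  | FEx (f : formula).

Definition env_cons {M : structure} (x : M) (e : nat -> M) : nat -> M :=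
  fun n => match n with O => x | S n => e n end.

Fixpoint sat {M : structure} (e : nat -> M) (f : formula) : Prop :=
  match f with
  | FMem i j => e i ∈ e j
  | FEq i j => e i = e j
  | FFalse => False
  | FImp f g => sat e f -> sat e g
  | FAnd f g => sat e f /\ sat e g
  | FOr f g => sat e f \/ sat e g
  | FAll f => forall x : M, sat (env_cons x e) f
  | FEx f => exists x : M, sat (env_cons x e) f
  end.

Section SetTheory.

Context {M : structure}.
Implicit Types a b d e f k l m n o p r s u v w x y z : M.

Definition subset x y : Prop := forall z, z ∈ x -> z ∈ y.
Definition is_empty x : Prop := forall z, ~ z ∈ x.
Definition nonempty x : Prop := exists z, z ∈ x.
Definition is_upair p x y : Prop := forall z, z ∈ p <-> z = x \/ z = y.
Definition is_union u x : Prop := forall z, z ∈ u <-> exists y, y ∈ x /\ z ∈ y.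
Definition is_powerset p x : Prop := forall z, z ∈ p <-> subset z x.
Definition is_inter i x : Prop := forall z, z ∈ i <-> forall y, y ∈ x -> z ∈ y.
Definition is_diff d x y : Prop := forall z, z ∈ d <-> z ∈ x /\ ~ z ∈ y.
Definition is_succ s x : Prop := forall z, z ∈ s <-> z ∈ x \/ z = x.

(* Kuratowski pair {{x}, {x, y}} *)
Definition is_opair p x y : Prop :=
  exists a b, is_upair a x x /\ is_upair b x y /\ is_upair p a b.

Definition app f x y : Prop := exists p, is_opair p x y /\ p ∈ f.

Definition functional f : Prop :=
  forall x y y', app f x y -> app f x y' -> y = y'.

Definition is_function f a b : Prop :=
  (forall p, p ∈ f -> exists x y, x ∈ a /\ y ∈ b /\ is_opair p x y) /\
  (forall x, x ∈ a -> exists y, app f x y) /\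
  functional f.

Definition is_injection f a b : Prop :=
  is_function f a b /\ forall x x' y, app f x y -> app f x' y -> x = x'.

Definition is_bijection f a b : Prop :=
  is_injection f a b /\ forall y, y ∈ b -> exists x, app f x y.

Definition equinumerous x y : Prop := exists f, is_bijection f x y.

(* r = f restricted to arguments in a *)
Definition is_restriction r f a : Prop :=
  forall p, p ∈ r <-> p ∈ f /\ exists x y, x ∈ a /\ is_opair p x y.

Definition is_ordinal a : Prop :=
  (forall x y, x ∈ y -> y ∈ a -> x ∈ a) /\
  (forall x, x ∈ a -> ~ x ∈ x) /\
  (forall x y z, x ∈ a -> y ∈ a -> z ∈ a -> x ∈ y -> y ∈ z -> x ∈ z) /\
  (forall x y, x ∈ a -> y ∈ a -> x ∈ y \/ x = y \/ y ∈ x) /\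
  (forall s, subset s a -> nonempty s ->
     exists m, m ∈ s /\ forall x, x ∈ s -> m = x \/ m ∈ x).

Definition is_limit a : Prop :=
  is_ordinal a /\ nonempty a /\
  forall x, x ∈ a -> exists s, is_succ s x /\ s ∈ a.

Definition is_omega w : Prop := is_limit w /\ forall x, x ∈ w -> ~ is_limit x.

Definition finite x : Prop :=
  exists w n, is_omega w /\ n ∈ w /\ equinumerous x n.

Definition infinite x : Prop := ~ finite x.

(* initial ordinals, finite ones included *)
Definition is_cardinal k : Prop :=
  is_ordinal k /\ forall a, a ∈ k -> ~ equinumerous a k.

Definition has_cardinality x k : Prop := is_cardinal k /\ equinumerous x k.

Definition is_card_succ l k : Prop :=
  is_cardinal l /\ k ∈ l /\
  forall m, is_cardinal m -> k ∈ m -> l = m \/ l ∈ m.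

Definition is_omega1 o : Prop := exists w, is_omega w /\ is_card_succ o w.

Definition strong_fip F : Prop :=
  forall s i, subset s F -> finite s -> nonempty s -> is_inter i s -> infinite i.

Definition pseudo_intersection (P F : M) : Prop :=
  forall x d, x ∈ F -> is_diff d P x -> finite d.

Definition p_witness F : Prop :=
  (exists w, is_omega w /\ forall x, x ∈ F -> subset x w) /\
  strong_fip F /\
  ~ exists P, infinite P /\ pseudo_intersection P F.

Definition is_pseudo_intersection_number k : Prop :=
  (exists F, p_witness F /\ has_cardinality F k) /\
  (forall F l, p_witness F -> has_cardinality F l -> k = l \/ k ∈ l).

(* A graph is passed as its vertex set V and its edge set E. *)

Definition is_graph (V E : M) : Prop :=
  forall e, e ∈ E -> exists x y, x ∈ V /\ y ∈ V /\ x <> y /\ is_upair e x y.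

Definition is_subgraph (V' E' V E : M) : Prop :=
  is_graph V' E' /\ subset V' V /\ subset E' E.

Definition isomorphic (V E V' E' : M) : Prop :=
  exists f, is_bijection f V V' /\
    forall x y x' y' e e', app f x x' -> app f y y' ->
      is_upair e x y -> is_upair e' x' y' -> (e ∈ E <-> e' ∈ E').

Definition contains_copy (V E VH EH : M) : Prop :=
  exists V' E', is_subgraph V' E' V E /\ isomorphic V' E' VH EH.

Definition is_complete_bipartite (V E l k : M) : Prop :=
  exists zero one, is_empty zero /\ is_succ one zero /\
  (forall v, v ∈ V <-> (exists a, a ∈ l /\ is_opair v a zero) \/
                       (exists b, b ∈ k /\ is_opair v b one)) /\
  (forall e, e ∈ E <-> exists a b u v, a ∈ l /\ b ∈ k /\
                       is_opair u a zero /\ is_opair v b one /\ is_upair e u v).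

(* A position is given by the transfinite sequences mk and br of edges claimed so
    far by Maker and by Breaker; mk at t and br at t are the edges claimed in turn
    t.  Since Maker moves first in every turn, the length of mk is that of br, or
    its successor when Breaker is about to move. *)

Definition claimed (mk br e : M) : Prop :=
  (exists t, app mk t e) \/ (exists t, app br t e).

Definition position_of_lengths (E mk br t s : M) : Prop :=
  is_ordinal t /\ is_ordinal s /\
  is_injection mk t E /\ is_injection br s E /\
  forall e, (exists x, app mk x e) -> ~ (exists x, app br x e).

Definition unfinished (E mk br : M) : Prop :=
  exists e, e ∈ E /\ ~ claimed mk br e.

Definition maker_to_move (E mk br : M) : Prop :=
  (exists t, position_of_lengths E mk br t t) /\ unfinished E mk br.

Definition breaker_to_move (E mk br : M) : Prop :=
  (exists t s, is_succ t s /\ position_of_lengths E mk br t s) /\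
  unfinished E mk br.

(* If the last unclaimed edge is taken by Maker, Breaker makes no move in that
   turn, hence the second possibility for the lengths. *)
Definition complete_play (E mk br : M) : Prop :=
  (exists t s, (t = s \/ is_succ t s) /\ position_of_lengths E mk br t s) /\
  ~ unfinished E mk br.

Definition maker_strategy (E f : M) : Prop :=
  functional f /\
  forall mk br p, maker_to_move E mk br -> is_opair p mk br ->
    exists e, app f p e /\ e ∈ E /\ ~ claimed mk br e.

Definition breaker_strategy (E f : M) : Prop :=
  functional f /\
  forall mk br p, breaker_to_move E mk br -> is_opair p mk br ->
    exists e, app f p e /\ e ∈ E /\ ~ claimed mk br e.

Definition maker_follows (f mk br : M) : Prop :=
  forall t e mk' br' p, app mk t e ->
    is_restriction mk' mk t -> is_restriction br' br t -> is_opair p mk' br' ->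
    app f p e.

(* When Breaker moves in turn t, Maker's moves in the turns up to and including t
   have been made. *)
Definition breaker_follows (f mk br : M) : Prop :=
  forall t t' e mk' br' p, app br t e -> is_succ t' t ->
    is_restriction mk' mk t' -> is_restriction br' br t -> is_opair p mk' br' ->
    app f p e.

Definition maker_wins_play (V VH EH mk : M) : Prop :=
  exists EM, (forall e, e ∈ EM <-> exists t, app mk t e) /\
             contains_copy V EM VH EH.

Definition maker_has_winning_strategy (V E VH EH : M) : Prop :=
  exists f, maker_strategy E f /\
    forall mk br, complete_play E mk br -> maker_follows f mk br ->
      maker_wins_play V VH EH mk.

Definition breaker_has_winning_strategy (V E VH EH : M) : Prop :=
  exists f, breaker_strategy E f /\
    forall mk br, complete_play E mk br -> breaker_follows f mk br ->
      ~ maker_wins_play V VH EH mk.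

End SetTheory.

Definition extensionality (M : structure) : Prop :=
  forall x y : M, (forall z, z ∈ x <-> z ∈ y) -> x = y.

Definition foundation (M : structure) : Prop :=
  forall x : M, nonempty x -> exists y, y ∈ x /\ forall z, z ∈ x -> ~ z ∈ y.

Definition pairing (M : structure) : Prop :=
  forall x y : M, exists p, is_upair p x y.

Definition union (M : structure) : Prop := forall x : M, exists u, is_union u x.

Definition power_set (M : structure) : Prop :=
  forall x : M, exists p, is_powerset p x.

Definition infinity (M : structure) : Prop :=
  exists a : M, (exists z, is_empty z /\ z ∈ a) /\
    forall x, x ∈ a -> exists s, is_succ s x /\ s ∈ a.

(* In both schemas the parameters of phi are given by the environment e. *)
Definition separation (M : structure) : Prop :=
  forall (phi : formula) (e : nat -> M) (a : M),
    exists b, forall x, x ∈ b <-> x ∈ a /\ sat (env_cons x e) phi.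

Definition replacement (M : structure) : Prop :=
  forall (phi : formula) (e : nat -> M) (a : M),
    (forall x y y', x ∈ a ->
       sat (env_cons x (env_cons y e)) phi ->
       sat (env_cons x (env_cons y' e)) phi -> y = y') ->
    exists b, forall y, y ∈ b <->
      exists x, x ∈ a /\ sat (env_cons x (env_cons y e)) phi.

Definition choice (M : structure) : Prop :=
  forall a : M, (forall x, x ∈ a -> nonempty x) ->
    exists f u, is_union u a /\ is_function f a u /\
      forall x y, x ∈ a -> app f x y -> y ∈ x.

Definition ZFC (M : structure) : Prop :=
  extensionality M /\ foundation M /\ pairing M /\ union M /\ power_set M /\
  infinity M /\ separation M /\ replacement M /\ choice M.

Definition GCH (M : structure) : Prop :=
  forall w k l p : M,
    is_omega w -> is_cardinal k -> subset w k -> is_card_succ l k ->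
    is_powerset p k -> equinumerous p l.

Definition omega1_lt_p (M : structure) : Prop :=
  exists o k : M, is_omega1 o /\ is_pseudo_intersection_number k /\ o ∈ k.

Definition breaker_wins_MB_K_omega_omega1 (M : structure) : Prop :=
  exists w o V E : M, is_omega w /\ is_omega1 o /\
    is_complete_bipartite V E w o /\ breaker_has_winning_strategy V E V E.

Definition maker_wins_MB_K_omega_omega1 (M : structure) : Prop :=
  exists w o V E : M, is_omega w /\ is_omega1 o /\
    is_complete_bipartite V E w o /\ maker_has_winning_strategy V E V E.

(* Consistency and independence are read through models; for first-order theories
   and sentences this is the same as through formal proofs, by completeness.  That
   the sentences at issue are first-order is [first_order_sentences] below. *)

Definition consistent (T : structure -> Prop) : Prop := exists M, T M.

Definition independent (T phi : structure -> Prop) : Prop :=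
  (exists M, T M /\ phi M) /\ (exists M, T M /\ ~ phi M).

Definition first_order (phi : structure -> Prop) : Prop :=
  exists f : formula, forall (M : structure) (e : nat -> M), sat e f <-> phi M.

Definition expressible (P : forall M : structure, (nat -> M) -> Prop) : Prop :=
  exists f : formula, forall M e, sat e f <-> P M e.

Lemma expr_mem i j : expressible (fun M e => e i ∈ e j).
Proof. exists (FMem i j); intros; reflexivity. Qed.

Lemma expr_eq i j : expressible (fun M e => e i = e j).
Proof. exists (FEq i j); intros; reflexivity. Qed.

Lemma expr_False : expressible (fun M e => False).
Proof. exists FFalse; intros; reflexivity. Qed.

Lemma expr_imp P Q : expressible P -> expressible Q ->
  expressible (fun M e => P M e -> Q M e).
Proof.
intros [f Hf] [g Hg]; exists (FImp f g); intros M e; simpl.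
rewrite Hf, Hg; reflexivity.
Qed.

Lemma expr_and P Q : expressible P -> expressible Q ->
  expressible (fun M e => P M e /\ Q M e).
Proof.
intros [f Hf] [g Hg]; exists (FAnd f g); intros M e; simpl.
rewrite Hf, Hg; reflexivity.
Qed.

Lemma expr_or P Q : expressible P -> expressible Q ->
  expressible (fun M e => P M e \/ Q M e).
Proof.
intros [f Hf] [g Hg]; exists (FOr f g); intros M e; simpl.
rewrite Hf, Hg; reflexivity.
Qed.

Lemma expr_all (P : forall M : structure, M -> (nat -> M) -> Prop) :
  expressible (fun M e => P M (e 0) (fun n => e (S n))) ->
  expressible (fun M e => forall x, P M x e).
Proof.
intros [f Hf]; exists (FAll f); intros M e; simpl.
split; intros H x; apply (Hf M (env_cons x e)), H.
Qed.

Lemma expr_ex (P : forall M : structure, M -> (nat -> M) -> Prop) :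
  expressible (fun M e => P M (e 0) (fun n => e (S n))) ->
  expressible (fun M e => exists x, P M x e).
Proof.
intros [f Hf]; exists (FEx f); intros M e; simpl.
split; intros [x H]; exists x; apply (Hf M (env_cons x e)), H.
Qed.

Ltac expr_step :=
  cbv beta;
  lazymatch goal with
  | |- expressible (fun M e => mem _ _) => apply expr_mem
  | |- expressible (fun M e => _ = _) => apply expr_eq
  | |- expressible (fun M e => False) => apply expr_False
  | |- expressible (fun M e => ~ _) => unfold not
  | |- expressible (fun M e => _ <-> _) => unfold iff
  | |- expressible (fun M e => _ /\ _) => apply expr_and
  | |- expressible (fun M e => _ \/ _) => apply expr_or
  | |- expressible (fun M e => exists _, _) => apply expr_ex
  | |- expressible (fun M e => ?P -> ?Q) =>
      apply (expr_imp (fun M e => P) (fun M e => Q))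
  | |- expressible (fun M e => forall _, _) => apply expr_all
  end.

Ltac express :=
  cbv beta delta [
    subset is_empty nonempty is_upair is_union is_powerset is_inter is_diff
    is_succ is_opair app functional is_function is_injection is_bijection
    equinumerous is_restriction is_ordinal is_limit is_omega finite infinite
    is_cardinal has_cardinality is_card_succ is_omega1 strong_fip
    pseudo_intersection p_witness is_pseudo_intersection_number is_graph
    is_subgraph isomorphic contains_copy is_complete_bipartite claimed
    position_of_lengths unfinished maker_to_move breaker_to_move complete_play
    maker_strategy breaker_strategy maker_follows breaker_follows
    maker_wins_play maker_has_winning_strategy breaker_has_winning_strategy
    GCH omega1_lt_p breaker_wins_MB_K_omega_omega1
    maker_wins_MB_K_omega_omega1 iff not];
  repeat expr_step.

Lemma first_order_sentences :
  first_order GCH /\ first_order omega1_lt_p /\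
  first_order breaker_wins_MB_K_omega_omega1 /\
  first_order maker_wins_MB_K_omega_omega1.
Proof.
repeat split.
- change (expressible (fun M e => GCH M)); express.
- change (expressible (fun M e => omega1_lt_p M)); express.
- change (expressible (fun M e => breaker_wins_MB_K_omega_omega1 M)); express.
- change (expressible (fun M e => maker_wins_MB_K_omega_omega1 M)); express.
Qed.

(* Main.v *)
(** Everything happens inside an arbitrary model [M] of ZFC, whose separation and
    replacement only apply to predicates given by formulas.  The predicates that have a
    formula with parameters are closed under the logical connectives and under
    substitution of definable terms, so every instance needed is found by a syntax-directed
    tactic.

    Breaker under CH: enumerate the subsets of omega as [A_a], [a < omega1].  Whenever
    Maker plays at [b < omega1], Breaker answers at [b] inside the first set [A_a], [a < b],
    (in an enumeration of [b] in type omega) that he has not met there yet.  If Maker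
    owned [A_a x {b}] with [A_a] infinite and [a < b], the [k]-th set would be met after
    finitely many moves of Maker at [b], for every [k], a contradiction.  So the vertices
    joined by Maker to all of [A_a] are at most [a].

    Maker under [omega1 < p]: Maker always plays at the least [b] at which only finitely
    many edges are claimed, choosing his [n]-th edge there inside more and more of the
    infinite neighbourhoods he built before.  The infinite neighbourhoods decrease modulo
    finite sets, so they have a pseudo-intersection [P].  Uncountably many of them contain
    [P] minus one fixed natural number, which is the required copy.

    The two players cannot both win, as their strategies can be played against each other
    by transfinite recursion. *)
From Stdlib Require Import ssreflect ClassicalEpsilon PropExtensionality Setoid.
Require Import Defs.
Set Bullet Behavior "None".

(** * Definability with parameters *)

(** The game is transfinite, and neither argument counts turns. For Breaker, progress is measured by
    the number of Maker's edges at one vertex [b]: any number of turns may pass between two of them,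
    but while they are finitely many, an infinite set that Maker is to own entirely still has an
    unclaimed edge to [b]. For Maker, the first omega1 turns suffice: before each of them only
    countably many edges are claimed, so an untouched [b] exists even at limit turns, and a single
    turn claims at most two edges, so [b] remains his target until infinitely many edges are claimed
    there. Breaker cannot block the finite intersections in which Maker must move, since these are
    infinite and only finitely many edges at the target are gone. Both players use the same
    injections of the countable ordinals [b] into omega: they bring the countably many tasks at [b]
    into play finitely many at a time. GCH is used only to count the subsets of omega, and
    [omega1 < p] only because Maker builds at most omega1 neighbourhoods. Winning copies are handled
    as complete bipartite pairs of an infinite and an uncountable set, never as isomorphisms. *)

Lemma propeq (P Q : Prop) : (P <-> Q) -> P = Q.
Proof. exact: propositional_extensionality. Qed.

(** Even positions [dbl i] read [E] and odd positions [S (dbl i)] read [c], so neither stream ever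
    has to be cut off or shifted past the other. *)
Fixpoint mix {A : Type} (E c : nat -> A) (i : nat) : A :=
  match i with
  | 0 => E 0
  | 1 => c 0
  | S (S i) => mix (fun n => E (S n)) (fun n => c (S n)) i
  end.

Fixpoint dbl (i : nat) : nat := match i with 0 => 0 | S i => S (S (dbl i)) end.

Lemma mix_dbl {A} (E c : nat -> A) i : mix E c (dbl i) = E i.
Proof. by elim: i E c => [|i IH] E c //=; rewrite IH. Qed.

Lemma mix_Sdbl {A} (E c : nat -> A) i : mix E c (S (dbl i)) = c i.
Proof. elim: i E c => [|i IH] E c //. exact: (IH (fun n => E (S n)) (fun n => c (S n))). Qed.

Lemma mix_map {A B} (g : A -> B) (E c : nat -> A) i :
  g (mix E c i) = mix (fun n => g (E n)) (fun n => g (c n)) i.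
Proof.
have [k [->|->]] : exists k, i = dbl k \/ i = S (dbl k).
  elim: i => [|i [k [->|->]]]; [by exists 0; left | by exists k; right | by exists (S k); left].
  by rewrite !mix_dbl.
by rewrite !mix_Sdbl.
Qed.

Lemma mix_ext {A} (E c E' c' : nat -> A) i :
  (forall n, E n = E' n) -> (forall n, c n = c' n) -> mix E c i = mix E' c' i.
Proof.
move=> h h'; have [k [->|->]] : exists k, i = dbl k \/ i = S (dbl k).
  elim: i => [|i [k [->|->]]]; [by exists 0; left | by exists k; right | by exists (S k); left].
  by rewrite !mix_dbl.
by rewrite !mix_Sdbl.
Qed.

Definition up (r : nat -> nat) (n : nat) : nat :=
  match n with 0 => 0 | S n => S (r n) end.

Fixpoint ren (r : nat -> nat) (f : formula) : formula :=
  match f with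
  | FMem i j => FMem (r i) (r j)
  | FEq i j => FEq (r i) (r j)
  | FFalse => FFalse
  | FImp f g => FImp (ren r f) (ren r g)
  | FAnd f g => FAnd (ren r f) (ren r g)
  | FOr f g => FOr (ren r f) (ren r g)
  | FAll f => FAll (ren (up r) f)
  | FEx f => FEx (ren (up r) f)
  end.

(* As a class, the axioms become an implicit argument of the set operations that are chosen from
   them. *)
Existing Class ZFC.

Section Definability.
Context {M : structure} {HZ : ZFC M}.

Lemma ZFC_inhabited : inhabited M.
Proof. by case: HZ => _ [_ [_ [_ [_ [[a _] _]]]]]; constructor. Qed.

Lemma sat_ren (f : formula) : forall (r : nat -> nat) (e e' : nat -> M),
  (forall i, e (r i) = e' i) -> (sat e (ren r f) <-> sat e' f).
Proof.
elim: f => [i j|i j||f IHf g IHg|f IHf g IHg|f IHf g IHg|f IH|f IH] r e e' h /=;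
  rewrite ?h; try (move: (IHf _ _ _ h) (IHg _ _ _ h)); try tauto.
- have h' x i : env_cons x e (up r i) = env_cons x e' i by case: i => //=.
  by split=> H x; apply (IH _ _ _ (h' x)).
- have h' x i : env_cons x e (up r i) = env_cons x e' i by case: i => //=.
  by split; move=> [x H]; exists x; apply (IH _ _ _ (h' x)).
Qed.

Lemma sat_mix f (a b : nat -> nat) (e E c : nat -> M) :
  (forall n, e (a n) = E n) -> (forall n, e (b n) = c n) ->
  (sat e (ren (mix a b) f) <-> sat (mix E c) f).
Proof. by move=> h h'; apply: sat_ren => i; rewrite (mix_map e); apply: mix_ext. Qed.

(* The environment [E] and the parameters [c] are interleaved so that both can be
   extended freely. *)
Inductive Definable (P : (nat -> M) -> Prop) : Prop :=
  D_intro (f : formula) (c : nat -> M) of (forall E, sat (mix E c) f <-> P E).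

Lemma D_ext (P Q : (nat -> M) -> Prop) : (forall E, P E <-> Q E) -> Definable P -> Definable Q.
Proof. by move=> h [f c H]; exists f c => E; move: (H E) (h E); tauto. Qed.

(** Each formula comes with its own parameters; interleaving the two parameter streams lets both
    formulas be renamed to read one common stream. *)
Lemma D_merge (f g : formula) (c d : nat -> M) :
  exists f' g' b, (forall E, sat (mix E b) f' <-> sat (mix E c) f) /\
                  (forall E, sat (mix E b) g' <-> sat (mix E d) g).
Proof.
exists (ren (mix dbl (fun j => S (dbl (dbl j)))) f).
exists (ren (mix dbl (fun j => S (dbl (S (dbl j))))) g), (mix c d).
split=> E; apply: sat_mix => n.
- by rewrite mix_dbl.
- by rewrite mix_Sdbl mix_dbl.
- by rewrite mix_dbl.
- by rewrite mix_Sdbl mix_Sdbl.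
Qed.

Lemma D_False : Definable (fun _ => False).
Proof. by case: ZFC_inhabited => x; exists FFalse (fun _ => x). Qed.

Lemma D_and P Q : Definable P -> Definable Q -> Definable (fun E => P E /\ Q E).
Proof.
move=> [f c Hf] [g d Hg]; have [f' [g' [b [H1 H2]]]] := D_merge f g c d.
by exists (FAnd f' g') b => E /=; move: (H1 E) (H2 E) (Hf E) (Hg E); tauto.
Qed.

Lemma D_or P Q : Definable P -> Definable Q -> Definable (fun E => P E \/ Q E).
Proof.
move=> [f c Hf] [g d Hg]; have [f' [g' [b [H1 H2]]]] := D_merge f g c d.
by exists (FOr f' g') b => E /=; move: (H1 E) (H2 E) (Hf E) (Hg E); tauto.
Qed.

Lemma D_imp P Q : Definable P -> Definable Q -> Definable (fun E => P E -> Q E).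
Proof.
move=> [f c Hf] [g d Hg]; have [f' [g' [b [H1 H2]]]] := D_merge f g c d.
by exists (FImp f' g') b => E /=; move: (H1 E) (H2 E) (Hf E) (Hg E); tauto.
Qed.

Lemma D_not P : Definable P -> Definable (fun E => ~ P E).
Proof. by move=> h; apply: D_imp h D_False. Qed.

Lemma D_iff P Q : Definable P -> Definable Q -> Definable (fun E => P E <-> Q E).
Proof. by move=> h h'; apply: D_and; apply: D_imp. Qed.

(* Moves the bound variable [0] of a quantifier to the front of the interleaving. *)
Lemma D_bind (f : formula) (c : nat -> M) : exists g, forall E x,
  sat (env_cons x (mix E c)) g <-> sat (mix (env_cons x E) c) f.
Proof.
exists (ren (mix (fun j => match j with 0 => 0 | S j => S (dbl j) end)
                 (fun j => S (S (dbl j)))) f) => E x.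
apply: sat_mix => n.
  by case: n => [|n] //=; rewrite mix_dbl.
exact: mix_Sdbl.
Qed.

Lemma D_all (P : M -> (nat -> M) -> Prop) :
  Definable (fun E => P (E 0) (fun n => E (S n))) -> Definable (fun E => forall x, P x E).
Proof.
move=> [f c H]; have [g Hg] := D_bind f c; exists (FAll g) c => E /=.
by split=> h x; move: (h x); rewrite (Hg E x) (H (env_cons x E)).
Qed.

Lemma D_ex (P : M -> (nat -> M) -> Prop) :
  Definable (fun E => P (E 0) (fun n => E (S n))) -> Definable (fun E => exists x, P x E).
Proof.
move=> [f c H]; have [g Hg] := D_bind f c; exists (FEx g) c => E /=.
by split; move=> [x h]; exists x; move: h; rewrite (Hg E x) (H (env_cons x E)).
Qed.

Lemma D_ren (P : (nat -> M) -> Prop) (r : nat -> nat) :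
  Definable P -> Definable (fun E => P (fun n => E (r n))).
Proof.
move=> [f c H]; exists (ren (mix (fun j => dbl (r j)) (fun j => S (dbl j))) f) c => E.
rewrite -H; apply: sat_mix => n.
  exact: mix_dbl.
exact: mix_Sdbl.
Qed.

(** The language has no function symbols, so a term counts as definable when its graph is: variable
    0 is the value, and the arguments are shifted by one. *)
Inductive DefTerm (t : (nat -> M) -> M) : Prop :=
  DT_intro of Definable (fun E => E 0 = t (fun n => E (S n))).

Lemma DT_var i : DefTerm (fun E => E i).
Proof.
case: ZFC_inhabited => x; constructor; exists (FEq 0 (dbl (S i))) (fun _ => x) => E.
by rewrite /= mix_dbl.
Qed.

Lemma DT_const a : DefTerm (fun _ => a).
Proof. by constructor; exists (FEq 0 1) (fun _ => a). Qed.

Lemma DT_ren t (r : nat -> nat) : DefTerm t -> DefTerm (fun E => t (fun n => E (r n))).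
Proof.
move=> [h]; constructor.
exact: (D_ren _ (fun n => match n with 0 => 0 | S n => S (r n) end) h).
Qed.

Lemma D_mem t s : DefTerm t -> DefTerm s -> Definable (fun E => t E ∈ s E).
Proof.
move=> [h] [h'].
have: Definable (fun E => exists x, x = t E /\ exists y, y = s E /\ x ∈ y).
  apply: D_ex; apply: D_and => //; apply: D_ex; apply: D_and.
    exact: (D_ren _ (fun n => match n with 0 => 0 | S n => S (S n) end) h').
  case: ZFC_inhabited => x; exists (FMem 2 0) (fun _ => x) => E.
  by rewrite /=.
apply: D_ext => E; split; last by move=> ?; exists (t E); split=> //; exists (s E).
by move=> [x [-> [y [->]]]].
Qed.

Lemma D_subst (P : M -> (nat -> M) -> Prop) t : DefTerm t ->
  Definable (fun E => P (E 0) (fun n => E (S n))) -> Definable (fun E => P (t E) E).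
Proof.
move=> [h] h'; have: Definable (fun E => exists x, x = t E /\ P x E).
  by apply: D_ex; apply: D_and.
by apply: D_ext => E; split=> [[x [->]]|?] //; exists (t E).
Qed.

Lemma D_eq t s : DefTerm t -> DefTerm s -> Definable (fun E => t E = s E).
Proof.
move=> h h'; apply: (D_subst (fun x E => x = s E) t h).
by case: h' => h'.
Qed.

Lemma DT_subst (s : M -> (nat -> M) -> M) t : DefTerm t ->
  DefTerm (fun E => s (E 0) (fun n => E (S n))) -> DefTerm (fun E => s (t E) E).
Proof.
move=> h [h']; constructor.
apply: (D_subst (fun x E => E 0 = s x (fun n => E (S n))) _ (DT_ren t S h)).
exact: (D_ren _ (fun n => match n with 0 => 1 | S 0 => 0 | S n => S n end) h').
Qed.

Lemma D_comp (P : M -> Prop) t : Definable (fun E => P (E 0)) -> DefTerm t -> Definable (fun E => P (t E)).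
Proof. by move=> dP dt; apply: (D_subst (fun x _ => P x) t dt). Qed.

Lemma DT_comp (F : M -> M) t : DefTerm (fun E => F (E 0)) -> DefTerm t -> DefTerm (fun E => F (t E)).
Proof. by move=> dF dt; apply: (DT_subst (fun x _ => F x) t dt). Qed.

Lemma D_comp2 (R : M -> M -> Prop) t s : Definable (fun E => R (E 0) (E 1)) -> DefTerm t -> DefTerm s ->
  Definable (fun E => R (t E) (s E)).
Proof.
move=> dR dt ds; apply: (D_subst (fun x E => R x (s E)) t dt).
apply: (D_subst (fun y E => R (E 0) y) _ (DT_ren s S ds)).
(* The value of [s] was bound last and sits at index 0, that of [t] at index 1, hence the swap. *)
exact: (D_ren _ (fun n => match n with 0 => 1 | _ => 0 end) dR).
Qed.

Lemma D_comp3 (R : M -> M -> M -> Prop) t s u : Definable (fun E => R (E 0) (E 1) (E 2)) ->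
  DefTerm t -> DefTerm s -> DefTerm u -> Definable (fun E => R (t E) (s E) (u E)).
Proof.
move=> dR dt ds du; apply: (D_subst (fun x E => R x (s E) (u E)) t dt).
apply: (D_subst (fun y E => R (E 0) y (u (fun n => E (S n)))) _ (DT_ren s S ds)).
apply: (D_subst (fun y E => R (E 1) (E 0) y) _ (DT_ren u (fun n => S (S n)) du)).
exact: (D_ren _ (fun n => match n with 0 => 2 | 1 => 1 | _ => 0 end) dR).
Qed.

(** Freezes a whole environment into parameters. A [sep] inside a term has a predicate that depends
    on the current environment, while [in_sep] wants a predicate with one free variable. *)
Lemma D_fix (P : M -> (nat -> M) -> Prop) (E : nat -> M) :
  Definable (fun E => P (E 0) (fun n => E (S n))) -> Definable (fun E' => P (E' 0) E).
Proof.
move=> [f c H]; exists (ren (mix (fun j => match j with 0 => 0 | S j => S (dbl (dbl j)) end)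
     (fun j => S (dbl (S (dbl j))))) f) (mix E c) => E'.
rewrite -(H (env_cons (E' 0) E)).
apply: sat_mix => n; last by rewrite !mix_Sdbl.
by case: n => [|n] //; rewrite mix_Sdbl mix_dbl.
Qed.

Lemma D_fix2 (P : M -> M -> (nat -> M) -> Prop) (E : nat -> M) :
  Definable (fun E => P (E 0) (E 1) (fun n => E (S (S n)))) -> Definable (fun E' => P (E' 0) (E' 1) E).
Proof.
move=> [f c H]; exists (ren (mix (fun j => match j with 0 => 0 | 1 => 2
      | S (S j) => S (dbl (dbl j)) end) (fun j => S (dbl (S (dbl j))))) f) (mix E c) => E'.
rewrite -(H (env_cons (E' 0) (env_cons (E' 1) E))).
apply: sat_mix => n; last by rewrite !mix_Sdbl.
by case: n => [|[|n]] //; rewrite mix_Sdbl mix_dbl.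
Qed.

Lemma definable_separation (P : M -> Prop) : Definable (fun E => P (E 0)) -> forall a,
  exists b, forall x, x ∈ b <-> x ∈ a /\ P x.
Proof.
move=> [f c H] a; have [_ [_ [_ [_ [_ [_ [Hsep _]]]]]]] := HZ.
(* Every free variable is sent to index 0, the candidate element, and the parameters follow it. *)
have [b Hb] := Hsep (ren (mix (fun _ => 0) S) f) c a.
exists b => x; rewrite Hb -(H (fun _ => x)).
suff -> : sat (env_cons x c) (ren (mix (fun _ => 0) S) f) <-> sat (mix (fun _ => x) c) f by [].
by apply: sat_mix.
Qed.

Lemma definable_replacement (R : M -> M -> Prop) : Definable (fun E => R (E 0) (E 1)) -> forall a,
  (forall x y y', x ∈ a -> R x y -> R x y' -> y = y') ->
  exists b, forall y, y ∈ b <-> exists x, x ∈ a /\ R x y.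
Proof.
move=> [f c H] a fR; have [_ [_ [_ [_ [_ [_ [_ [Hrep _]]]]]]]] := HZ.
pose r := mix (fun j => match j with 0 => 0 | _ => 1 end) (fun j => S (S j)).
have key x y : sat (env_cons x (env_cons y c)) (ren r f) <-> R x y.
  rewrite -(H (fun n => match n with 0 => x | _ => y end)).
  apply: sat_mix => //.
  by case.
have [x y y' xa|b Hb] := Hrep (ren r f) c a.
  by move/key => Rxy /key; apply: fR.
exists b => y; rewrite Hb.
by split=> [[x [xa /key h]]|[x [xa h]]]; exists x; split=> //; apply/key.
Qed.

End Definability.

Ltac dfn_hyp :=
  match goal with
  | H : Definable ?P |- Definable (fun E => ?P (fun n => E (@?r n))) => apply (D_ren P r H)
  | H : DefTerm ?P |- DefTerm (fun E => ?P (fun n => E (@?r n))) => apply (DT_ren P r H)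
  | H : Definable (fun E => ?P (E 0)) |- Definable (fun E => ?P _) => apply (D_comp P _ H)
  | H : DefTerm (fun E => ?P (E 0)) |- DefTerm (fun E => ?P _) => apply (DT_comp P _ H)
  | H : Definable (fun E => ?P (E 0) (E 1)) |- Definable (fun E => ?P _ _) => apply (D_comp2 P _ _ H)
  | H : Definable (fun E => ?P (E 0) (E 1) (E 2)) |- Definable (fun E => ?P _ _ _) =>
      apply (D_comp3 P _ _ _ H)
  end.

Create HintDb dfn.

(** Connectives are recognised by their head symbol. Set operations go through the hint database
    [dfn], extended after each definition, whose hints call [dfn] again on the arguments. *)
Ltac dfn_step :=
  cbv beta;
  lazymatch goal with
  | |- Definable (fun E => _ ∈ _) => apply D_mem
  | |- Definable (fun E => _ = _) => apply D_eq
  | |- Definable (fun E => False) => apply D_False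
  | |- Definable (fun E => ~ _) => apply D_not
  | |- Definable (fun E => _ <-> _) => apply D_iff
  | |- Definable (fun E => _ /\ _) => apply D_and
  | |- Definable (fun E => _ \/ _) => apply D_or
  | |- Definable (fun E => exists _, _) => apply D_ex
  | |- Definable (fun E => ?P -> ?Q) => apply (D_imp (fun E => P) (fun E => Q))
  | |- Definable (fun E => forall _, _) => apply D_all
  | |- DefTerm (fun E => E _) => apply DT_var
  | |- _ => first [ assumption | apply DT_const | dfn_hyp | solve [auto 1 with dfn nocore] ]
  end.
Ltac dfn := repeat dfn_step.

(** * Sets *)

Section Sets.
Context {M : structure} {HZ : ZFC M}.
Implicit Types a b c d f p r x y z : M.
Implicit Types t s u : (nat -> M) -> M.

Lemma set_ext x y : (forall z, z ∈ x <-> z ∈ y) -> x = y.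
Proof. by case: HZ => H _; apply: H. Qed.

Definition choose d (P : M -> Prop) : M := epsilon (inhabits d) P.

Lemma chooseP d (P : M -> Prop) : (exists x, P x) -> P (choose d P).
Proof. exact: epsilon_spec. Qed.

(* [sep] and [repl] are meaningful only for definable arguments. *)
Definition sep a (P : M -> Prop) : M := choose a (fun b => forall x, x ∈ b <-> x ∈ a /\ P x).
Definition repl a (F : M -> M) : M :=
  choose a (fun b => forall y, y ∈ b <-> exists x, x ∈ a /\ y = F x).
Definition upair x y : M := choose x (fun p => is_upair p x y).
Definition Un x : M := choose x (fun v => is_union v x).
Definition pow x : M := choose x (fun v => is_powerset v x).

(** Membership laws are equations between propositions, so that plain [rewrite] applies inside
    larger formulas; definability appears as a side goal. *)
Lemma in_sep a P x : Definable (fun E => P (E 0)) -> (x ∈ sep a P) = (x ∈ a /\ P x).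
Proof.
move=> dP; apply: propeq; move: x; rewrite /sep.
by apply: (chooseP _ (fun b => forall x, x ∈ b <-> x ∈ a /\ P x)); apply: definable_separation.
Qed.

Lemma in_repl a F y : DefTerm (fun E => F (E 0)) -> (y ∈ repl a F) = (exists x, x ∈ a /\ y = F x).
Proof.
move=> dF; apply: propeq; move: y; rewrite /repl.
apply: (chooseP _ (fun b => forall y, y ∈ b <-> exists x, x ∈ a /\ y = F x)).
apply: definable_replacement; last by move=> x y y' _ -> ->.
apply: D_eq; first exact: DT_var.
exact: dF.
Qed.

Lemma in_upair x y z : (z ∈ upair x y) = (z = x \/ z = y).
Proof.
by apply: propeq; move: z; apply: (chooseP _ (fun p => is_upair p x y));
  case: HZ => _ [_ [H _]]; apply: H.
Qed.

Lemma in_Un x z : (z ∈ Un x) = (exists y, y ∈ x /\ z ∈ y).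
Proof.
by apply: propeq; move: z; apply: (chooseP _ (fun p => is_union p x));
  case: HZ => _ [_ [_ [H _]]]; apply: H.
Qed.

Lemma in_pow x z : (z ∈ pow x) = subset z x.
Proof.
by apply: propeq; move: z; apply: (chooseP _ (fun p => is_powerset p x));
  case: HZ => _ [_ [_ [_ [H _]]]]; apply: H.
Qed.

(** By extensionality the graph of [t] is expressed through its members. A new operation therefore
    needs only its membership law to become a definable term. *)
Lemma DT_of_mem t (P : M -> (nat -> M) -> Prop) :
  Definable (fun E => P (E 0) (fun n => E (S n))) -> (forall E x, x ∈ t E <-> P x E) -> DefTerm t.
Proof.
move=> dP H; constructor.
have: Definable (fun E => forall x, x ∈ E 0 <-> P x (fun n => E (S n))).
  dfn; exact: (D_ren _ (fun n => match n with 0 => 0 | S n => S (S n) end) dP).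
apply: D_ext => E; split=> [h|->]; last exact: H.
by apply: set_ext => z; rewrite h H.
Qed.

Lemma DT_sep t (P : M -> (nat -> M) -> Prop) : DefTerm t ->
  Definable (fun E => P (E 0) (fun n => E (S n))) -> DefTerm (fun E => sep (t E) (fun x => P x E)).
Proof.
move=> dt dP; apply: (DT_of_mem _ (fun x E => x ∈ t E /\ P x E)); first by dfn.
by move=> E x; rewrite in_sep //; apply: D_fix.
Qed.

Lemma DT_repl t (F : M -> (nat -> M) -> M) : DefTerm t ->
  DefTerm (fun E => F (E 0) (fun n => E (S n))) -> DefTerm (fun E => repl (t E) (fun x => F x E)).
Proof.
move=> dt dF; apply: (DT_of_mem _ (fun y E => exists x, x ∈ t E /\ y = F x E)).
  dfn; exact: (DT_ren _ (fun n => match n with 0 => 0 | S n => S (S n) end) dF).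
move=> E x; rewrite in_repl //; constructor; case: dF => dF.
have := D_fix2 (fun x y E => x = F y E) E; apply.
exact: (D_ren _ (fun n => match n with 0 => 0 | 1 => 1 | S (S n) => S (S n) end) dF).
Qed.

Lemma DT_upair t s : DefTerm t -> DefTerm s -> DefTerm (fun E => upair (t E) (s E)).
Proof.
move=> dt ds; apply: (DT_of_mem _ (fun x E => x = t E \/ x = s E)); first by dfn.
by move=> E x; rewrite in_upair.
Qed.

Lemma DT_Un t : DefTerm t -> DefTerm (fun E => Un (t E)).
Proof.
move=> dt; apply: (DT_of_mem _ (fun x E => exists y, y ∈ t E /\ x ∈ y)); first by dfn.
by move=> E x; rewrite in_Un.
Qed.

Lemma D_subset t s : DefTerm t -> DefTerm s -> Definable (fun E => subset (t E) (s E)).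
Proof. by move=> dt ds; rewrite /subset; dfn. Qed.

End Sets.

#[global] Hint Extern 0 (Definable (fun _ => subset _ _)) => apply D_subset; dfn : dfn.
#[global] Hint Extern 0 (DefTerm (fun _ => sep _ _)) => apply DT_sep; dfn : dfn.
#[global] Hint Extern 0 (DefTerm (fun _ => repl _ _)) => apply DT_repl; dfn : dfn.
#[global] Hint Extern 0 (DefTerm (fun _ => upair _ _)) => apply DT_upair; dfn : dfn.
#[global] Hint Extern 0 (DefTerm (fun _ => Un _)) => apply DT_Un; dfn : dfn.

Section Sets2.
Context {M : structure} {HZ : ZFC M}.
Implicit Types a b c d f p r x y z : M.
Implicit Types t s u : (nat -> M) -> M.

Definition emp : M := epsilon ZFC_inhabited is_empty.
Definition sing x : M := upair x x.
Definition cup x y : M := Un (upair x y).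
Definition succ x : M := cup x (sing x).
Definition opair x y : M := upair (sing x) (upair x y).
Definition diff a b : M := sep a (fun x => ~ x ∈ b).
Definition cprod a b : M :=
  sep (pow (pow (cup a b))) (fun p => exists x y, x ∈ a /\ y ∈ b /\ p = opair x y).
Definition restr f a : M := sep f (fun p => exists x y, x ∈ a /\ p = opair x y).
(* the empty set outside the domain of [f] *)
Definition ap f x : M := Un (sep (Un (Un f)) (fun y => opair x y ∈ f)).
Definition lam a (F : M -> M) : M := repl a (fun x => opair x (F x)).

Lemma in_emp x : (x ∈ emp) = False.
Proof.
apply: propeq; split=> // h; suff: is_empty emp by move=> /(_ x).
apply: epsilon_spec; case: HZ => _ [_ [_ [_ [_ [[a [[z [ez _]] _]] _]]]]].
by exists z.
Qed.

Lemma in_sing x z : (z ∈ sing x) = (z = x).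
Proof. by rewrite in_upair; apply: propeq; tauto. Qed.

Lemma in_cup x y z : (z ∈ cup x y) = (z ∈ x \/ z ∈ y).
Proof.
rewrite in_Un; apply: propeq; split.
  by move=> [w []]; rewrite in_upair => -[->|->]; tauto.
by case=> h; [exists x|exists y]; rewrite in_upair; tauto.
Qed.

Lemma in_succ x z : (z ∈ succ x) = (z ∈ x \/ z = x).
Proof. by rewrite in_cup in_sing. Qed.

Lemma in_diff a b x : (x ∈ diff a b) = (x ∈ a /\ ~ x ∈ b).
Proof. by rewrite in_sep //; dfn. Qed.

Lemma upair_eq x y x' y' : upair x y = upair x' y' ->
  (x = x' /\ y = y') \/ (x = y' /\ y = x').
Proof.
move=> e.
have: x ∈ upair x' y' by rewrite -e in_upair; left.
have: y ∈ upair x' y' by rewrite -e in_upair; right.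
have: x' ∈ upair x y by rewrite e in_upair; left.
have: y' ∈ upair x y by rewrite e in_upair; right.
by rewrite !in_upair; intuition congruence.
Qed.

Lemma upairC x y : upair x y = upair y x.
Proof. by apply: set_ext => z; rewrite !in_upair; tauto. Qed.

Lemma opair_eq x y x' y' : opair x y = opair x' y' -> x = x' /\ y = y'.
Proof.
by move=> /upair_eq[] [] /upair_eq h /upair_eq h'; intuition congruence.
Qed.

Lemma in_prod a b p : (p ∈ cprod a b) = (exists x y, x ∈ a /\ y ∈ b /\ p = opair x y).
Proof.
rewrite in_sep; first by rewrite /opair /sing; dfn.
apply: propeq; split=> [[]|h] //; split=> //; case: h => x [y [xa [yb ->]]].
rewrite in_pow => z; rewrite in_upair => hz; rewrite in_pow => w; rewrite in_cup.
by case: hz => ->; rewrite ?in_sing ?in_upair; [move=> ->|move=> [->|->]]; tauto.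
Qed.

Lemma in_prod_opair a b x y : (opair x y ∈ cprod a b) = (x ∈ a /\ y ∈ b).
Proof.
rewrite in_prod; apply: propeq; split=> [|[]]; last by exists x, y.
by move=> [x' [y' [? [? /opair_eq [-> ->]]]]].
Qed.

Lemma DT_sing t : DefTerm t -> DefTerm (fun E => sing (t E)).
Proof. by move=> dt; rewrite /sing; dfn. Qed.
Lemma DT_cup t s : DefTerm t -> DefTerm s -> DefTerm (fun E => cup (t E) (s E)).
Proof. by move=> dt ds; rewrite /cup; dfn. Qed.
Lemma DT_opair t s : DefTerm t -> DefTerm s -> DefTerm (fun E => opair (t E) (s E)).
Proof. by move=> dt ds; rewrite /opair /sing; dfn. Qed.
Lemma DT_succ t : DefTerm t -> DefTerm (fun E => succ (t E)).
Proof. by move=> dt; rewrite /succ /cup /sing; dfn. Qed.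
Lemma DT_diff t s : DefTerm t -> DefTerm s -> DefTerm (fun E => diff (t E) (s E)).
Proof. by move=> dt ds; rewrite /diff; dfn. Qed.
Lemma DT_pow t : DefTerm t -> DefTerm (fun E => pow (t E)).
Proof.
move=> dt; apply: (DT_of_mem _ (fun x E => subset x (t E))); first by dfn.
by move=> E x; rewrite in_pow.
Qed.

End Sets2.

#[global] Hint Extern 0 (DefTerm (fun _ => sing _)) => apply DT_sing; dfn : dfn.
#[global] Hint Extern 0 (DefTerm (fun _ => cup _ _)) => apply DT_cup; dfn : dfn.
#[global] Hint Extern 0 (DefTerm (fun _ => opair _ _)) => apply DT_opair; dfn : dfn.
#[global] Hint Extern 0 (DefTerm (fun _ => succ _)) => apply DT_succ; dfn : dfn.
#[global] Hint Extern 0 (DefTerm (fun _ => diff _ _)) => apply DT_diff; dfn : dfn.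
#[global] Hint Extern 0 (DefTerm (fun _ => pow _)) => apply DT_pow; dfn : dfn.

Section Functions.
Context {M : structure} {HZ : ZFC M}.
Local Notation emp := (@emp M HZ).
Implicit Types a b c d e f g p r x y z : M.
Implicit Types t s u : (nat -> M) -> M.

Lemma DT_prod t s : DefTerm t -> DefTerm s -> DefTerm (fun E => cprod (t E) (s E)).
Proof. by move=> dt ds; rewrite /cprod; dfn. Qed.
Lemma DT_restr t s : DefTerm t -> DefTerm s -> DefTerm (fun E => restr (t E) (s E)).
Proof. by move=> dt ds; rewrite /restr; dfn. Qed.
Lemma DT_ap t s : DefTerm t -> DefTerm s -> DefTerm (fun E => ap (t E) (s E)).
Proof. by move=> dt ds; rewrite /ap; dfn. Qed.

Lemma in_restr f a p : (p ∈ restr f a) = (p ∈ f /\ exists x y, x ∈ a /\ p = opair x y).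
Proof. by rewrite in_sep //; dfn. Qed.

Lemma in_restr_opair f a x y : (opair x y ∈ restr f a) = (opair x y ∈ f /\ x ∈ a).
Proof.
rewrite in_restr; apply: propeq; split; last by move=> [? ?]; split=> //; exists x, y.
by move=> [h [x' [y' [h' /opair_eq [e _]]]]]; split=> //; rewrite e.
Qed.

(** This and the next equations replace the relational notions of the statement by operations, which
    compose and rewrite. *)
Lemma is_upairE p x y : is_upair p x y = (p = upair x y).
Proof.
apply: propeq; split=> [h|->]; last by move=> z; rewrite in_upair.
by apply: set_ext => z; rewrite h in_upair.
Qed.

Lemma is_opairE p x y : is_opair p x y = (p = opair x y).
Proof.
apply: propeq; rewrite /is_opair; split.
  by move=> [u [v]]; rewrite !is_upairE => -[-> [-> ->]].
by move=> ->; exists (sing x), (upair x y); rewrite !is_upairE.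
Qed.

Lemma appE f x y : app f x y = (opair x y ∈ f).
Proof.
apply: propeq; rewrite /app; split=> [[p]|h]; first by rewrite is_opairE => -[-> ].
by exists (opair x y); rewrite is_opairE.
Qed.

Lemma is_succE y x : is_succ y x = (y = succ x).
Proof.
apply: propeq; split=> [h|->]; last by move=> z; rewrite in_succ.
by apply: set_ext => z; rewrite h in_succ.
Qed.

Lemma is_emptyE x : is_empty x = (x = emp).
Proof.
apply: propeq; split=> [h|->]; last by move=> z; rewrite in_emp.
by apply: set_ext => z; rewrite in_emp; move: (h z); tauto.
Qed.

Lemma is_diffE x a b : is_diff x a b = (x = diff a b).
Proof.
apply: propeq; split=> [h|->]; last by move=> z; rewrite in_diff.
by apply: set_ext => z; rewrite h in_diff.
Qed.

Lemma is_restrictionE r f a : is_restriction r f a = (r = restr f a).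
Proof.
have h p : (exists x y, x ∈ a /\ is_opair p x y) <-> (exists x y, x ∈ a /\ p = opair x y).
  by split; move=> [x [y H]]; exists x, y; move: H; rewrite is_opairE.
apply: propeq; split=> [H|->]; last by move=> z; rewrite in_restr h.
by apply: set_ext => z; rewrite H in_restr h.
Qed.

Lemma D_app t s u : DefTerm t -> DefTerm s -> DefTerm u -> Definable (fun E => app (t E) (s E) (u E)).
Proof. by move=> dt ds du; rewrite /app /is_opair /is_upair; dfn. Qed.

Lemma nonemptyP x : x <> emp -> nonempty x.
Proof.
move=> h; apply: NNPP => h'; apply: h; apply: set_ext => z.
by rewrite in_emp; split=> // ?; apply: h'; exists z.
Qed.

End Functions.

#[global] Hint Extern 0 (DefTerm (fun _ => cprod _ _)) => apply DT_prod; dfn : dfn.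
#[global] Hint Extern 0 (DefTerm (fun _ => restr _ _)) => apply DT_restr; dfn : dfn.
#[global] Hint Extern 0 (DefTerm (fun _ => ap _ _)) => apply DT_ap; dfn : dfn.
#[global] Hint Extern 0 (Definable (fun _ => app _ _ _)) => apply D_app; dfn : dfn.

(** * Functions and equinumerosity *)

Section Maps.
Context {M : structure} {HZ : ZFC M}.
Implicit Types a b c d e f g p r x y z : M.
Implicit Types t s u : (nat -> M) -> M.

Lemma functionalE f : functional f = (forall x y y', opair x y ∈ f -> opair x y' ∈ f -> y = y').
Proof. by apply: propeq; split=> h x y y'; move: (h x y y'); rewrite !appE. Qed.

Lemma ap_eq f x y : functional f -> opair x y ∈ f -> ap f x = y.
Proof.
rewrite functionalE => ff h; apply: set_ext => z; rewrite in_Un; split.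
  move=> [y' []]; rewrite in_sep; first by dfn.
  by move=> [_ h']; rewrite (ff _ _ _ h h').
move=> zy; exists y; split=> //; rewrite in_sep; first by dfn.
split=> //; rewrite in_Un; exists (upair x y); rewrite in_upair; split; last by right.
by rewrite in_Un; exists (opair x y); rewrite in_upair; split; last right.
Qed.

Lemma function_ap f a b x : is_function f a b -> x ∈ a -> ap f x ∈ b /\ opair x (ap f x) ∈ f.
Proof.
move=> [Hf [tot ff]] /tot [y]; rewrite appE => h; rewrite (ap_eq _ _ _ ff h); split=> //.
by have [x' [y' [_ [? ]]]] := Hf _ h; rewrite is_opairE => /opair_eq [_ ->].
Qed.

Lemma function_dom f a b x y : is_function f a b -> opair x y ∈ f -> x ∈ a /\ y ∈ b /\ y = ap f x.
Proof.
move=> [Hf [tot ff]] h; rewrite (ap_eq _ _ _ ff h).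
have [x' [y' [? [? ]]]] := Hf _ h.
by rewrite is_opairE => /opair_eq [-> ->].
Qed.

Definition graph a b (R : M -> M -> Prop) : M :=
  sep (cprod a b) (fun p => exists x y, p = opair x y /\ R x y).

Lemma in_graph a b R x y : Definable (fun E => R (E 0) (E 1)) ->
  (opair x y ∈ graph a b R) = (x ∈ a /\ y ∈ b /\ R x y).
Proof.
move=> dR; rewrite in_sep.
  by dfn.
rewrite in_prod_opair; apply: propeq; split; last by move=> [? [? ?]]; split=> //; exists x, y.
by move=> [[? ?] [x' [y' [/opair_eq [<- <-]]]]].
Qed.

Lemma graph_function a b (R : M -> M -> Prop) : Definable (fun E => R (E 0) (E 1)) ->
  (forall x, x ∈ a -> exists y, y ∈ b /\ R x y) ->
  (forall x y y', x ∈ a -> R x y -> R x y' -> y = y') -> is_function (graph a b R) a b.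
Proof.
move=> dR tot fR; split; [|split].
- move=> p h; have: p ∈ cprod a b.
    move: h; rewrite in_sep; last by case.
    by dfn.
  by rewrite in_prod => -[x [y [? [? ?]]]]; exists x, y; rewrite is_opairE.
- by move=> x /[dup] xa /tot [y [? ?]]; exists y; rewrite appE in_graph.
- rewrite functionalE => x y y'; rewrite !in_graph // => -[xa [_ h]] [_ [_ h']].
  exact: fR xa h h'.
Qed.

Definition Inj a b : Prop := exists f, is_injection f a b.

Lemma is_injectionP f a b : is_injection f a b <-> is_function f a b /\
  (forall x x', x ∈ a -> x' ∈ a -> ap f x = ap f x' -> x = x').
Proof.
split=> [[ff inj]|[ff inj]]; split=> //.
  move=> x x' xa x'a e; have [_ h] := function_ap _ _ _ _ ff xa.
  have [_ h'] := function_ap _ _ _ _ ff x'a.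
  by apply: (inj _ _ (ap f x)); rewrite appE // e.
move=> x x' y; rewrite !appE => /(function_dom _ _ _ _ _ ff) [xa [_ e]].
by move=> /(function_dom _ _ _ _ _ ff) [x'a [_ e']]; apply: inj => //; rewrite -e -e'.
Qed.

Lemma Inj_rel a b (R : M -> M -> Prop) : Definable (fun E => R (E 0) (E 1)) ->
  (forall x, x ∈ a -> exists y, y ∈ b /\ R x y) ->
  (forall x y y', x ∈ a -> R x y -> R x y' -> y = y') ->
  (forall x x' y, x ∈ a -> x' ∈ a -> R x y -> R x' y -> x = x') -> Inj a b.
Proof.
move=> dR tot fR iR; exists (graph a b R); split; first exact: graph_function.
move=> x x' y; rewrite !appE !in_graph // => -[? [_ ?]] [? [_ ?]].
exact: (iR _ _ y).
Qed.

Lemma Inj_fun a b (F : M -> M) : DefTerm (fun E => F (E 0)) -> (forall x, x ∈ a -> F x ∈ b) ->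
  (forall x x', x ∈ a -> x' ∈ a -> F x = F x' -> x = x') -> Inj a b.
Proof.
move=> dF tot iF; apply: (Inj_rel _ _ (fun x y => y = F x)).
- by dfn.
- by move=> x xa; exists (F x); split=> //; apply: tot.
- by move=> x y y' _ -> ->.
- by move=> x x' y xa x'a ->; apply: iF.
Qed.

Lemma InjE a b : Inj a b -> exists f, (forall x, x ∈ a -> ap f x ∈ b) /\
  (forall x x', x ∈ a -> x' ∈ a -> ap f x = ap f x' -> x = x').
Proof.
move=> [f /is_injectionP [ff inj]]; exists f; split=> // x xa.
by case: (function_ap _ _ _ _ ff xa).
Qed.

Lemma Inj_subset a b : subset a b -> Inj a b.
Proof. by move=> h; apply: (Inj_fun _ _ (fun x => x)) => //; dfn. Qed.

Lemma Inj_trans b a c : Inj a b -> Inj b c -> Inj a c.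
Proof.
move=> /InjE [f [tf jf]] /InjE [g [tg jg]].
apply: (Inj_fun _ _ (fun x => ap g (ap f x))); first by dfn.
- by move=> x xa; apply: tg; apply: tf.
- by move=> x x' xa x'a /jg h; apply: jf => //; apply: h; apply: tf.
Qed.

Lemma graph_bijection a b (R : M -> M -> Prop) : Definable (fun E => R (E 0) (E 1)) ->
  (forall x, x ∈ a -> exists y, y ∈ b /\ R x y) ->
  (forall y, y ∈ b -> exists x, x ∈ a /\ R x y) ->
  (forall x y y', x ∈ a -> R x y -> R x y' -> y = y') ->
  (forall x x' y, x ∈ a -> x' ∈ a -> R x y -> R x' y -> x = x') -> is_bijection (graph a b R) a b.
Proof.
move=> dR tot sur fR iR; split; last first.
  by move=> y /[dup] yb /sur [x [? ?]]; exists x; rewrite appE in_graph.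
split; first exact: graph_function.
move=> x x' y; rewrite !appE !in_graph // => -[? [_ ?]] [? [_ ?]].
exact: (iR _ _ y).
Qed.

Lemma eqn_rel a b (R : M -> M -> Prop) : Definable (fun E => R (E 0) (E 1)) ->
  (forall x, x ∈ a -> exists y, y ∈ b /\ R x y) ->
  (forall y, y ∈ b -> exists x, x ∈ a /\ R x y) ->
  (forall x y y', x ∈ a -> R x y -> R x y' -> y = y') ->
  (forall x x' y, x ∈ a -> x' ∈ a -> R x y -> R x' y -> x = x') -> equinumerous a b.
Proof.
by move=> *; exists (graph a b R); apply: graph_bijection.
Qed.

Lemma eqn_fun a b (F : M -> M) : DefTerm (fun E => F (E 0)) -> (forall x, x ∈ a -> F x ∈ b) ->
  (forall y, y ∈ b -> exists x, x ∈ a /\ y = F x) ->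
  (forall x x', x ∈ a -> x' ∈ a -> F x = F x' -> x = x') -> equinumerous a b.
Proof.
move=> dF tot sur iF; apply: (eqn_rel _ _ (fun x y => y = F x)) => //.
- by dfn.
- by move=> x xa; exists (F x); split=> //; apply: tot.
- by move=> x y y' _ -> ->.
- by move=> x x' y xa x'a ->; apply: iF.
Qed.

Lemma eqnE a b : equinumerous a b -> exists f, (forall x, x ∈ a -> ap f x ∈ b) /\
  (forall y, y ∈ b -> exists x, x ∈ a /\ y = ap f x) /\
  (forall x x', x ∈ a -> x' ∈ a -> ap f x = ap f x' -> x = x').
Proof.
move=> [f [/is_injectionP [ff inj] sur]]; exists f; split.
  by move=> x xa; case: (function_ap _ _ _ _ ff xa).
split=> // y /sur [x]; rewrite appE => /(function_dom _ _ _ _ _ ff) [? [? ?]].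
by exists x.
Qed.

Lemma eqn_Inj a b : equinumerous a b -> Inj a b.
Proof. by move=> [f [h _]]; exists f. Qed.

Lemma eqn_refl a : equinumerous a a.
Proof. by apply: (eqn_fun _ _ (fun x => x)) => //; [dfn|move=> y ?; exists y]. Qed.

Lemma eqn_sym a b : equinumerous a b -> equinumerous b a.
Proof.
move=> /eqnE [f [tf [sf jf]]].
apply: (eqn_rel _ _ (fun y x => x ∈ a /\ y = ap f x)); first by dfn.
- by move=> y /sf [x [? ?]]; exists x.
- by move=> x xa; exists (ap f x); split=> //; apply: tf.
- by move=> y x x' _ [xa ->] [x'a e]; apply: jf.
- by move=> y y' x _ _ [_ ->] [_ ->].
Qed.

Lemma eqn_trans b a c : equinumerous a b -> equinumerous b c -> equinumerous a c.
Proof.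
move=> /eqnE [f [tf [sf jf]]] /eqnE [g [tg [sg jg]]].
apply: (eqn_fun _ _ (fun x => ap g (ap f x))); first by dfn.
- by move=> x xa; apply: tg; apply: tf.
- by move=> z /sg [y [/sf [x [? ->]] ->]]; exists x.
- by move=> x x' xa x'a /jg h; apply: jf => //; apply: h; apply: tf.
Qed.

Lemma Inj_image a b : Inj a b -> exists c, subset c b /\ equinumerous a c.
Proof.
move=> /InjE [f [tf jf]]; exists (repl a (fun x => ap f x)); split.
  by move=> y; rewrite in_repl; [dfn|move=> [x [xa ->]]; apply: tf].
apply: (eqn_fun _ _ (fun x => ap f x)) => //; first by dfn.
- by move=> x xa; rewrite in_repl; [dfn|exists x].
- by move=> y; rewrite in_repl; [dfn|].
Qed.

Lemma D_functional t : DefTerm t -> Definable (fun E => functional (t E)).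
Proof. by move=> dt; rewrite /functional; dfn. Qed.

End Maps.
#[global] Hint Extern 0 (Definable (fun _ => functional _)) => apply D_functional; dfn : dfn.

Section Maps2.
Context {M : structure} {HZ : ZFC M}.
Implicit Types t s u : (nat -> M) -> M.
Lemma D_is_function t s u : DefTerm t -> DefTerm s -> DefTerm u ->
  Definable (fun E => is_function (t E) (s E) (u E)).
Proof. by move=> dt ds du; rewrite /is_function /is_opair /is_upair; dfn. Qed.
Lemma D_is_injection t s u : DefTerm t -> DefTerm s -> DefTerm u ->
  Definable (fun E => is_injection (t E) (s E) (u E)).
Proof.
move=> dt ds du; rewrite /is_injection; apply: D_and; first exact: D_is_function.
by dfn.
Qed.
Lemma D_Inj t s : DefTerm t -> DefTerm s -> Definable (fun E => Inj (t E) (s E)).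
Proof. by move=> dt ds; rewrite /Inj; dfn; apply: D_is_injection; dfn. Qed.
Lemma D_equinumerous t s : DefTerm t -> DefTerm s -> Definable (fun E => equinumerous (t E) (s E)).
Proof.
by move=> dt ds; rewrite /equinumerous /is_bijection; dfn; apply: D_is_injection; dfn.
Qed.
Lemma D_claimed t s u : DefTerm t -> DefTerm s -> DefTerm u -> Definable (fun E => claimed (t E) (s E) (u E)).
Proof. by move=> dt ds du; rewrite /claimed; dfn. Qed.
End Maps2.
#[global] Hint Extern 0 (Definable (fun _ => is_function _ _ _)) => apply D_is_function; dfn : dfn.
#[global] Hint Extern 0 (Definable (fun _ => is_injection _ _ _)) => apply D_is_injection; dfn : dfn.
#[global] Hint Extern 0 (Definable (fun _ => Inj _ _)) => apply D_Inj; dfn : dfn.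
#[global] Hint Extern 0 (Definable (fun _ => equinumerous _ _)) => apply D_equinumerous; dfn : dfn.
#[global] Hint Extern 0 (Definable (fun _ => claimed _ _ _)) => apply D_claimed; dfn : dfn.

(** * Ordinals and recursion *)

Section Ordinals.
Context {M : structure} {HZ : ZFC M}.
Local Notation emp := (@emp M HZ).
Implicit Types a b c d e f g h m n p r x y z : M.
Implicit Types t s u : (nat -> M) -> M.

Lemma foundationP x : nonempty x -> exists y, y ∈ x /\ forall z, z ∈ x -> ~ z ∈ y.
Proof. by case: HZ => _ [H _]; apply: H. Qed.

Lemma mem_irrefl x : ~ x ∈ x.
Proof.
have [|y [+ h] xx] := foundationP (sing x); first by exists x; rewrite in_sing.
by rewrite in_sing => e; move: h; rewrite e => /(_ x); rewrite in_sing => /(_ eq_refl).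
Qed.

Lemma mem_asym x y : x ∈ y -> ~ y ∈ x.
Proof.
move=> xy yx; have [|z [+ h]] := foundationP (upair x y); first by exists x; rewrite in_upair; left.
rewrite in_upair => -[e|e]; move: h; rewrite e.
- by move=> /(_ y); rewrite in_upair; apply; [right|].
- by move=> /(_ x); rewrite in_upair; apply; [left|].
Qed.

Definition trans a : Prop := forall x y, x ∈ y -> y ∈ a -> x ∈ a.
(** Under foundation, transitive sets of transitive sets are exactly the ordinals; [is_ordinalE]
    identifies this shorter form with [is_ordinal]. *)
Definition Ord a : Prop := trans a /\ forall x, x ∈ a -> trans x.

Lemma D_Ord t : DefTerm t -> Definable (fun E => Ord (t E)).
Proof. by move=> dt; rewrite /Ord /trans; dfn. Qed.

Lemma Ord_mem a x : Ord a -> x ∈ a -> Ord x.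
Proof.
move=> [ta h] xa; split; first exact: h.
by move=> y yx; apply: h; apply: ta yx xa.
Qed.

Lemma Ord_trans a x y : Ord a -> x ∈ y -> y ∈ a -> x ∈ a.
Proof. by move=> [ta _]; apply: ta. Qed.

Lemma Ord_of_trans a : trans a -> (forall x, x ∈ a -> Ord x) -> Ord a.
Proof. by move=> ta h; split=> // x /h []. Qed.

Lemma Ord_succ a : Ord a -> Ord (succ a).
Proof.
move=> oa; apply: Ord_of_trans; last first.
  by move=> x; rewrite in_succ => -[|->] //; apply: Ord_mem.
move=> x y xy; rewrite !in_succ => -[ya|e]; left; last by rewrite -e.
exact: Ord_trans oa xy ya.
Qed.

Lemma Ord_emp : Ord emp.
Proof. by apply: Ord_of_trans => x; [move=> y _|]; rewrite in_emp. Qed.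

Lemma least_ordinal (P : M -> Prop) a : Definable (fun E => P (E 0)) -> Ord a -> P a ->
  exists m, Ord m /\ P m /\ (m = a \/ m ∈ a) /\ forall x, x ∈ m -> ~ P x.
Proof.
move=> dP oa Pa; have [|m] := foundationP (sep (succ a) P).
  by exists a; rewrite in_sep // in_succ; split=> //; right.
rewrite in_sep // => -[[ma Pm] h]; exists m; have om := Ord_mem _ _ (Ord_succ _ oa) ma.
split=> //; split=> //; split; first by move: ma; rewrite in_succ; tauto.
move=> x xm Px; apply: (h x _ xm); rewrite in_sep //; split=> //.
exact: Ord_trans (Ord_succ _ oa) xm ma.
Qed.

Lemma Ord_ind (P : M -> Prop) : Definable (fun E => P (E 0)) ->
  (forall a, Ord a -> (forall x, x ∈ a -> P x) -> P a) -> forall a, Ord a -> P a.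
Proof.
move=> dP IH a oa; apply: NNPP => nP.
have [|m [om [nPm [_ h]]]] := least_ordinal (fun x => ~ P x) a _ oa nP; first by dfn.
by apply: nPm; apply: IH => // x /h /NNPP.
Qed.

Lemma Ord_total a b : Ord a -> Ord b -> a ∈ b \/ a = b \/ b ∈ a.
Proof.
move=> oa ob; move: a oa b ob; pose C a b := a ∈ b \/ a = b \/ b ∈ a.
apply: (Ord_ind (fun a => forall b, Ord b -> C a b)).
  by rewrite /C; dfn; apply: D_Ord; dfn.
move=> a oa IHa; apply: Ord_ind; first by rewrite /C; dfn.
(* If [a] and [b] were incomparable they would have the same members: the induction hypotheses
   compare a member of one with the other, and every outcome except membership makes [a] and [b]
   comparable. *)
move=> b ob IHb; apply: NNPP => n; apply: (n); right; left; apply: set_ext => x; split=> hx.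
- have [//|[e|h]] := IHa _ hx _ ob; case: n; right; right; first by rewrite -e.
  exact: Ord_trans oa h hx.
- have [h|[e|//]] := IHb _ hx; case: n; left; last by rewrite e.
  exact: Ord_trans ob h hx.
Qed.

Lemma Ord_subset a b : Ord a -> Ord b -> subset a b <-> a ∈ b \/ a = b.
Proof.
move=> oa ob; split=> [h|[h|->]] //; last by move=> x xa; apply: Ord_trans ob xa h.
have [?|[?|h']] := Ord_total _ _ oa ob; [by left|by right|].
by case: (mem_irrefl b); apply: h.
Qed.

Lemma Ord_notin a b : Ord a -> Ord b -> ~ a ∈ b <-> subset b a.
Proof.
move=> oa ob; split=> [h|h h']; last by apply: (mem_irrefl a); apply: h.
by apply (Ord_subset _ _ ob oa); have [//|[->|]] := Ord_total _ _ oa ob; tauto.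
Qed.

Lemma is_ordinalE a : is_ordinal a = Ord a.
Proof.
apply: propeq; split=> [[ta [_ [tr _]]]|oa].
  split=> // x xa y z yz zx; have za := ta _ _ zx xa.
  exact: (tr y z x (ta _ _ yz za)).
split; first by move=> x y; apply: Ord_trans.
split; first by move=> x _; apply: mem_irrefl.
split; first by move=> x y z _ _ za xy yz; apply: Ord_trans (Ord_mem _ _ oa za) xy yz.
split; first by move=> x y /(Ord_mem _ _ oa) ox /(Ord_mem _ _ oa) oy; apply: Ord_total.
move=> S Sa /foundationP [m [mS h]]; exists m; split=> // x xS.
have om := Ord_mem _ _ oa (Sa _ mS); have ox := Ord_mem _ _ oa (Sa _ xS).
by have [|[|/(h _ xS)]] := Ord_total _ _ om ox; tauto.
Qed.

End Ordinals.

#[global] Hint Extern 0 (Definable (fun _ => Ord _)) => apply D_Ord; dfn : dfn.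

(** * Transfinite recursion along an ordinal *)

Section Recursion.
Context {M : structure} {HZ : ZFC M}.
Local Notation emp := (@emp M HZ).
Implicit Types a b c d e f g h m n p r x y z : M.
Context (G : M -> M) (dG : DefTerm (fun E => G (E 0))).

(** [G] receives the whole history [restr h x], so one clause covers zero, successor and limit
    stages. *)
Definition approx b h : Prop := forall p, p ∈ h <-> exists x, x ∈ b /\ p = opair x (G (restr h x)).

Lemma DT_G (t : (nat -> M) -> M) : DefTerm t -> DefTerm (fun E => G (t E)).
Proof.
move=> dt; apply: (DT_subst (fun x _ => G x) t dt).
exact: dG.
Qed.

#[local] Hint Extern 0 (DefTerm (fun _ => G _)) => apply DT_G; dfn : dfn.

Lemma D_approx (t s : (nat -> M) -> M) : DefTerm t -> DefTerm s -> Definable (fun E => approx (t E) (s E)).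
Proof. by move=> dt ds; rewrite /approx; dfn. Qed.
#[local] Hint Extern 0 (Definable (fun _ => approx _ _)) => apply D_approx; dfn : dfn.

Lemma approx_restr b h x : Ord b -> approx b h -> x ∈ b -> approx x (restr h x).
Proof.
move=> ob H xb; have ox := Ord_mem _ _ ob xb.
have rr y : y ∈ x -> restr (restr h x) y = restr h y.
  move=> yx; apply: set_ext => p; rewrite !in_restr; split; first by tauto.
  move=> [ph [z [w [zy e]]]]; split; last by exists z, w.
  by split=> //; exists z, w; split=> //; apply: Ord_trans ox zy yx.
move=> p; rewrite in_restr; split.
  move=> [/H [y [yb ->]] [y' [z [h' /opair_eq [e _]]]]].
  by exists y; rewrite e rr.
move=> [y [yx ->]]; rewrite rr //; split; last by exists y, (G (restr h y)).
by apply/H; exists y; split=> //; apply: Ord_trans ob yx xb.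
Qed.

Lemma approx_unique b h h' : Ord b -> approx b h -> approx b h' -> h = h'.
Proof.
move=> ob; move: b ob h h'.
apply: Ord_ind; first by dfn.
move=> b ob IH h h' H H'; apply: set_ext => p; rewrite (H p) (H' p).
by split; move=> [x [xb ->]]; exists x; split=> //; congr (opair _ (G _));
  apply: (IH x xb); apply: (approx_restr b).
Qed.

Lemma approx_exists b : Ord b -> exists h, approx b h.
Proof.
apply: (Ord_ind (fun b => exists h, approx b h)) b; first by dfn.
move=> b ob IH.
have ofb x : x ∈ b -> Ord x by apply: Ord_mem.
(* The value at [x] is [G] of the unique approximation of length [x]. Replacement collects these
   values directly, without gluing functions together. *)
have [||h H] := definable_replacement
  (fun x p => exists h, approx x h /\ p = opair x (G h)) _ b.
  by dfn.
  move=> x y y' xb [h [H ->]] [h' [H' ->]].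
  by rewrite (approx_unique _ _ _ (ofb _ xb) H H').
exists h => p; rewrite H.
have key x h' : x ∈ b -> approx x h' -> restr h x = h'.
  move=> xb H'; apply: set_ext => q; rewrite in_restr H H'; split.
    move=> [[y [yb [h'' [H'' ->]]]] [y' [z [h3 /opair_eq [e _]]]]].
    move: h3; rewrite -e => yx.
    exists y; split=> //; congr (opair _ (G _)).
    apply: (approx_unique y) => //; first exact: ofb.
    by apply: approx_restr yx => //; apply: ofb.
  move=> [y [yx ->]]; have yb := Ord_trans _ _ _ ob yx xb.
  split; last by exists y, (G (restr h' y)).
  exists y; split=> //; exists (restr h' y); split=> //.
  by apply: approx_restr yx => //; apply: ofb.
split.
  by move=> [x [xb [h' [H' ->]]]]; exists x; split=> //; rewrite (key _ _ xb H').
move=> [x [xb ->]]; exists x; split=> //; have [h' H'] := IH x xb.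
by exists h'; split=> //; rewrite (key _ _ xb H').
Qed.

Lemma recursion b : Ord b -> exists h, (forall x, x ∈ b -> ap h x = G (restr h x)) /\
  (forall p, p ∈ h <-> exists x, x ∈ b /\ p = opair x (ap h x)).
Proof.
move=> /[dup] ob /approx_exists [h H].
have fh : functional h.
  rewrite functionalE => x y y' /H [z [_ /opair_eq [-> ->]]].
  by move=> /H [z' [_ /opair_eq [-> ->]]].
have e x : x ∈ b -> ap h x = G (restr h x).
  by move=> xb; apply: ap_eq => //; apply/H; exists x.
exists h; split=> // p; rewrite H.
by split; move=> [x [xb ->]]; exists x; rewrite e.
Qed.

End Recursion.

(** * Collapse of sets of ordinals, order isomorphisms and Hartogs ordinals *)

Section Collapse.
Context {M : structure} {HZ : ZFC M}.
Local Notation emp := (@emp M HZ).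
Implicit Types a b c d e f g h m n p r x y z : M.

Lemma collapse a c : Ord a -> subset c a -> exists d, Ord d /\ subset d a /\ equinumerous c d.
Proof.
move=> oa ca.
(* Mostowski collapse: the value at [x] is the set of values at the members of [c] below [x]. The
   recursion runs along all of [a]; only the image of [c] is kept. *)
pose (G := fun h => sep (Un (Un h)) (fun z => exists y, y ∈ c /\ opair y z ∈ h)).
have [|h [eh ih]] := recursion G _ a oa; first by rewrite /G; dfn.
have inh x z : x ∈ a -> z ∈ ap h x <-> exists y, y ∈ c /\ y ∈ x /\ z = ap h y.
  move=> xa; rewrite eh // in_sep; first by dfn.
  split.
    move=> [_ [y [yc]]]; rewrite in_restr_opair => -[/ih [y' [_ /opair_eq [e ->]]] yx].
    by exists y; rewrite -e.
  move=> [y [yc [yx ->]]].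
  have yh : opair y (ap h y) ∈ restr h x.
    rewrite in_restr_opair; split=> //; apply/ih; exists y; split=> //.
    exact: Ord_trans oa yx xa.
  split; last by exists y.
  rewrite in_Un; exists (upair y (ap h y)); rewrite in_upair; split; last by right.
  by rewrite in_Un; exists (opair y (ap h y)); split=> //; rewrite in_upair; right.
pose (d := repl c (fun y => ap h y)).
have ind z : z ∈ d <-> exists y, y ∈ c /\ z = ap h y by rewrite in_repl; [dfn|].
have oh x : Ord x -> x ∈ a -> Ord (ap h x) /\ subset (ap h x) x.
  move: x; apply: Ord_ind; first by dfn.
  move=> x ox IH xa; have xa' y : y ∈ x -> y ∈ a by move=> yx; apply: Ord_trans oa yx xa.
  split.
    apply: Ord_of_trans.
      move=> z w zw /(inh _ _ xa) [y [yc [yx e]]]; apply/inh => //.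
      move: zw; rewrite e => /(inh _ _ (xa' _ yx)) [v [vc [vy ->]]].
      by exists v; split=> //; split=> //; apply: Ord_trans ox vy yx.
    move=> z /(inh _ _ xa) [y [yc [yx ->]]]; have [] := IH y yx; last by [].
    exact: xa'.
  move=> z /(inh _ _ xa) [y [yc [yx ->]]]; have [oy sy] := IH y yx (xa' y yx).
  move: sy; rewrite Ord_subset //; first exact: Ord_mem ox yx.
  by move=> [h'|->] //; apply: Ord_trans ox h' yx.
have oa' x : x ∈ a -> Ord x by apply: Ord_mem.
have mono x y : x ∈ c -> y ∈ a -> x ∈ y -> ap h x ∈ ap h y.
  by move=> xc yc xy; apply/inh => //; exists x.
exists d; split; [|split].
- apply: Ord_of_trans.
    move=> z w zw /ind [y [yc e]]; move: zw; rewrite e.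
    move=> /(inh _ _ (ca _ yc)) [v [vc [vy ->]]].
    by apply/ind; exists v.
  move=> z /ind [y [yc ->]]; have ya := ca _ yc; have [] := oh y (oa' _ ya) ya.
  by [].
- move=> z /ind [y [yc ->]]; have ya := ca _ yc; have [o1] := oh y (oa' _ ya) ya.
  rewrite Ord_subset //; first exact: oa'.
  by move=> [h'|->] //; apply: Ord_trans oa h' ya.
- apply: (eqn_fun _ _ (fun y => ap h y)); first by dfn.
  + by move=> x xc; apply/ind; exists x.
  + by move=> y /ind.
  + move=> x x' xc x'c e; have [h'|[//|h']] := Ord_total _ _ (oa' _ (ca _ xc)) (oa' _ (ca _ x'c)).
    * by case: (mem_irrefl (ap h x)); rewrite {2}e; apply: mono => //; apply: ca.
    * by case: (mem_irrefl (ap h x)); rewrite {1}e; apply: mono => //; apply: ca.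
Qed.

(** By induction such an [F] is the identity: [F x] consists of the values of [F] below [x]. *)
Lemma Ord_iso a b (F : M -> M) : DefTerm (fun E => F (E 0)) -> Ord a -> Ord b ->
  (forall x, x ∈ a -> F x ∈ b) -> (forall y, y ∈ b -> exists x, x ∈ a /\ y = F x) ->
  (forall x y, x ∈ a -> y ∈ a -> (x ∈ y <-> F x ∈ F y)) -> a = b.
Proof.
move=> dF oa ob tot sur mono.
have id x : Ord x -> x ∈ a -> F x = x.
  move: x; apply: Ord_ind.
    apply: D_imp; first by dfn.
    by apply: D_eq; [exact: dF|exact: DT_var].
  move=> x ox IH xa; apply: set_ext => z; split=> hz.
    have [y [ya e]] := sur z (Ord_trans _ _ _ ob hz (tot _ xa)).
    have yx : y ∈ x by apply/mono => //; rewrite -e.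
    by rewrite e IH.
  have za := Ord_trans _ _ _ oa hz xa.
  by have := proj1 (mono z x za xa) hz; rewrite (IH z hz za).
apply: set_ext => z; split=> hz.
  by rewrite -(id z (Ord_mem _ _ oa hz) hz); apply: tot.
by have [x [xa ->]] := sur z hz; rewrite (id x (Ord_mem _ _ oa xa) xa).
Qed.

(** The ordinals that inject into [a] form a set [H], being the order types of certain relations on
    [a]. [H] is itself an ordinal, so an injection into [a] would put it in itself. *)
Lemma Hartogs a : exists b, Ord b /\ ~ Inj b a.
Proof.
(* [r] is the order copied onto the range of [f]. It is taken reflexive so that the range can be
   read off [r] even when [b] has a single element. *)
pose (R := fun r b => Ord b /\ exists f, is_injection f b a /\ forall p, p ∈ r <->
  exists x y, x ∈ b /\ y ∈ b /\ (x ∈ y \/ x = y) /\ p = opair (ap f x) (ap f y)).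
have inj_of r b b' f f' : is_injection f b a -> is_injection f' b' a ->
    (forall p, p ∈ r <-> exists x y, x ∈ b /\ y ∈ b /\ (x ∈ y \/ x = y) /\
       p = opair (ap f x) (ap f y)) ->
    (forall p, p ∈ r <-> exists x y, x ∈ b' /\ y ∈ b' /\ (x ∈ y \/ x = y) /\
       p = opair (ap f' x) (ap f' y)) ->
    (forall x, x ∈ b -> exists x', x' ∈ b' /\ ap f' x' = ap f x) /\
    (forall x y x' y', x ∈ b -> y ∈ b -> x' ∈ b' -> y' ∈ b' -> ap f' x' = ap f x ->
       ap f' y' = ap f y -> x ∈ y -> x' ∈ y').
  move=> /is_injectionP [_ jf] /is_injectionP [_ jf'] H H'; split.
    move=> x xb; have /H' : opair (ap f x) (ap f x) ∈ r.
      by apply/H; exists x, x; do 2 split=> //; split=> //; right.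
    by move=> [x' [_ [? [_ [_ /opair_eq [e _]]]]]]; exists x'.
  move=> x y x' y' xb yb xb' yb' e1 e2 xy.
  have /H' : opair (ap f x) (ap f y) ∈ r by apply/H; exists x, y; do 2 split=> //; split=> //; left.
  move=> [v [w [vb [wb [h /opair_eq]]]]]; rewrite -e1 -e2 => -[/jf' e3 /jf' e4].
  rewrite e3 // e4 //; case: h => // e5; case: (mem_irrefl x); rewrite {2}(_ : x = y) //.
  by apply: jf => //; rewrite -e1 -e2 e3 // e4 // e5.
have [||H HH] := definable_replacement R _ (pow (cprod a a)).
  by rewrite /R; dfn.
  move=> r b b' _ [ob [f [If Hf]]] [ob' [f' [If' Hf']]].
  have [t1 m1] := inj_of _ _ _ _ _ If If' Hf Hf'.
  have [t2 m2] := inj_of _ _ _ _ _ If' If Hf' Hf.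
  have /is_injectionP [_ jf] := If; have /is_injectionP [_ jf'] := If'.
  (* The inverse of [f'] applied after [f]; the union extracts the element of a singleton. *)
  pose (F := fun x => Un (sep b' (fun x' => ap f' x' = ap f x))).
  have FE x x' : x' ∈ b' -> ap f' x' = ap f x -> F x = x'.
    move=> xb' e; apply: set_ext => z; rewrite in_Un; split.
      move=> [w []]; rewrite in_sep; first by dfn.
      by move=> [wb' e' zw]; rewrite (jf' x' w) // e e'.
    by move=> zx; exists x'; rewrite in_sep //; dfn.
  apply: (Ord_iso _ _ F) => //; first by rewrite /F; dfn.
    by move=> x /t1 [x' [xb' e]]; rewrite (FE _ _ xb' e).
    by move=> y /[dup] yb' /t2 [x [xb e]]; exists x; rewrite (FE _ _ yb').
  move=> x y xb yb; have [x' [xb' e]] := t1 _ xb; have [y' [yb' e']] := t1 _ yb.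
  rewrite (FE _ _ xb' e) (FE _ _ yb' e'); split; first exact: m1.
  exact: m2.
have inH b : b ∈ H <-> Ord b /\ Inj b a.
  rewrite HH; split; first by move=> [r [_ [ob [f [If _]]]]]; split=> //; exists f.
  move=> [ob [f If]]; have /is_injectionP [ff _] := If.
  exists (sep (cprod a a) (fun p => exists x y, x ∈ b /\ y ∈ b /\ (x ∈ y \/ x = y) /\
    p = opair (ap f x) (ap f y))); split.
    by rewrite in_pow => p; rewrite in_sep; [dfn|case].
  split=> //; exists f; split=> // p; rewrite in_sep; first by dfn.
  split=> [[]//|h]; split=> //; case: h => x [y [xb [yb [_ ->]]]].
  rewrite in_prod_opair; have [? _] := function_ap _ _ _ _ ff xb.
  by have [? _] := function_ap _ _ _ _ ff yb.
exists H; have oH : Ord H.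
  apply: Ord_of_trans; last by move=> x /inH [].
  move=> x y xy /inH [oy iy]; apply/inH; split; first exact: Ord_mem oy xy.
  by apply: Inj_trans iy; apply: Inj_subset => z zx; apply: Ord_trans oy zx xy.
by split=> // iH; apply: (mem_irrefl H); apply/inH.
Qed.

Lemma cardinal_of_ordinal a : Ord a -> exists d, has_cardinality a d /\ subset d a.
Proof.
move=> oa; have [||d [od [ed [h md]]]] := least_ordinal (fun d => equinumerous a d) a _ oa.
  by dfn.
  exact: eqn_refl.
exists d; split; last by apply/Ord_subset => //; tauto.
split=> //; split; first by rewrite is_ordinalE.
by move=> x xd e; apply: (md x xd); apply: eqn_trans ed _; apply: eqn_sym.
Qed.

End Collapse.

(** * Finite sets *)

Section Omega.
Context {M : structure} {HZ : ZFC M}.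
Local Notation emp := (@emp M HZ).
Implicit Types a b c d e f g h k m n p r x y z w : M.
Implicit Types t s u : (nat -> M) -> M.

Lemma is_limitE a : is_limit a = (Ord a /\ nonempty a /\ forall x, x ∈ a -> succ x ∈ a).
Proof.
rewrite /is_limit is_ordinalE; apply: propeq; split=> -[h1 [h2 h3]]; do 2 split=> //.
  by move=> x /h3 [y []]; rewrite is_succE => ->.
by move=> x xa; exists (succ x); rewrite is_succE; split=> //; apply: h3.
Qed.

Lemma D_is_limit t : DefTerm t -> Definable (fun E => is_limit (t E)).
Proof.
move=> dt; apply: (D_ext (fun E => Ord (t E) /\ nonempty (t E) /\ forall x, x ∈ t E -> succ x ∈ t E)).
  by move=> E; rewrite is_limitE.
by rewrite /nonempty; dfn.
Qed.

Lemma omega_exists : exists w, is_omega w.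
Proof.
have [_ [_ [_ [_ [_ [[a [[z [ez za]] ha]] _]]]]]] := HZ.
(* The set given by infinity is merely closed under successor. Its ordinals that are also subsets of
   it form a limit ordinal, and omega is the least limit ordinal. *)
pose (c := sep a (fun x => Ord x /\ subset x a)).
have inc x : x ∈ c <-> x ∈ a /\ Ord x /\ subset x a by rewrite in_sep; [dfn|].
have lc : is_limit c.
  rewrite is_limitE; split; [|split].
  - apply: Ord_of_trans; last by move=> x /inc [_ []].
    move=> x y xy /inc [ya [oy sy]]; apply/inc; split; first exact: sy.
    split; first exact: Ord_mem oy xy.
    by move=> v vx; apply: sy; apply: Ord_trans oy vx xy.
  - exists z; apply/inc; move: za; rewrite is_emptyE in ez; rewrite ez => za; split=> //.
    by split; [exact: Ord_emp|move=> v; rewrite in_emp].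
  - move=> x /inc [xa [ox sx]]; apply/inc; split.
      by have [y []] := ha x xa; rewrite is_succE => ->.
    split; first exact: Ord_succ.
    by move=> v; rewrite in_succ => -[/sx|->].
have [||m [om [lm [_ h]]]] := least_ordinal is_limit c _ _ lc.
  by apply: D_is_limit; dfn.
  by move: lc; rewrite is_limitE => -[].
by exists m; split.
Qed.

Definition W : M := epsilon ZFC_inhabited is_omega.

Lemma is_omega_W : is_omega W.
Proof. exact: epsilon_spec omega_exists. Qed.

Lemma Ord_W : Ord W.
Proof. by have [+ _] := is_omega_W; rewrite is_limitE => -[]. Qed.

Lemma is_omegaE w : is_omega w = (w = W).
Proof.
apply: propeq; split=> [[lw hw]|->]; last exact: is_omega_W.
have ow : Ord w by move: lw; rewrite is_limitE => -[].
have [lW hW] := is_omega_W.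
by have [/hW|[|/hw]] := Ord_total _ _ ow Ord_W.
Qed.

Lemma W_succ n : n ∈ W -> succ n ∈ W.
Proof. by have [+ _] := is_omega_W; rewrite is_limitE => -[_ [_ h]]; apply: h. Qed.

Lemma W_case n : n ∈ W -> n = emp \/ exists m, m ∈ W /\ n = succ m.
Proof.
move=> nW; have [_ hW] := is_omega_W; case: (classic (n = emp)) => [|/nonemptyP ne]; first by left.
right; have on := Ord_mem _ _ Ord_W nW; have := hW n nW; rewrite is_limitE => nl.
have [x hx] : exists x, ~ (x ∈ n -> succ x ∈ n) by apply: not_all_ex_not => h; apply: nl.
have xn : x ∈ n by apply: NNPP; tauto.
have xW := Ord_trans _ _ _ Ord_W xn nW; exists x; split=> //.
have ox := Ord_mem _ _ on xn.
have [h|[//|]] := Ord_total _ _ on (Ord_succ _ ox); last by tauto.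
move: h; rewrite in_succ => -[/mem_asym //|e].
by case: (mem_irrefl n); rewrite {1}e.
Qed.

Lemma W_emp : emp ∈ W.
Proof.
have [lW _] := is_omega_W; move: (lW); rewrite is_limitE => -[_ [/foundationP [m [mW h]] _]].
have -> // : emp = m.
apply: set_ext => z; rewrite in_emp; split=> // zm; apply: (h z _ zm).
exact: Ord_trans Ord_W zm mW.
Qed.

Lemma W_ind (P : M -> Prop) : Definable (fun E => P (E 0)) -> P emp ->
  (forall n, n ∈ W -> P n -> P (succ n)) -> forall n, n ∈ W -> P n.
Proof.
move=> dP P0 PS n nW.
have on := Ord_mem _ _ Ord_W nW; move: n on nW; apply: Ord_ind; first by dfn.
move=> n on IH nW; have [->//|[m [mW e]]] := W_case n nW.
by rewrite e; apply: PS => //; apply: IH => //; rewrite e in_succ; right.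
Qed.

Lemma finiteE x : finite x = (exists n, n ∈ W /\ equinumerous x n).
Proof.
apply: propeq; split; first by move=> [w [n []]]; rewrite is_omegaE => -> h; exists n.
by move=> [n h]; exists W, n; split=> //; exact: is_omega_W.
Qed.

Lemma D_finite t : DefTerm t -> Definable (fun E => finite (t E)).
Proof.
move=> dt; apply: (D_ext (fun E => exists n, n ∈ W /\ equinumerous (t E) n)).
  by move=> E; rewrite finiteE.
by dfn.
Qed.

Lemma D_infinite t : DefTerm t -> Definable (fun E => infinite (t E)).
Proof. by move=> dt; apply: D_not; apply: D_finite. Qed.

End Omega.
#[global] Hint Extern 0 (Definable (fun _ => finite _)) => apply D_finite; dfn : dfn.
#[global] Hint Extern 0 (Definable (fun _ => infinite _)) => apply D_infinite; dfn : dfn.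

Section Finite.
Context {M : structure} {HZ : ZFC M}.
Local Notation emp := (@emp M HZ).
Local Notation W := (@W M HZ).
Implicit Types a b c d e f g h k m n p r x y z w : M.

Lemma no_Inj_succ n : n ∈ W -> ~ Inj (succ n) n.
Proof.
apply: (W_ind (fun n => ~ Inj (succ n) n)) n; first by dfn.
  by move=> /InjE [f [h _]]; have := h emp; rewrite in_emp; apply; rewrite in_succ; right.
move=> n nW IH /InjE [f [tf jf]]; apply: IH.
(* The value at the extra point becomes free once that point is dropped; it replaces the value [n]
   wherever that occurs, leaving an injection of [succ n] into [n]. *)
pose v := ap f (succ n).
have i1 x : x ∈ succ n -> x ∈ succ (succ n) by rewrite (in_succ (succ n)); left.
have i2 : succ n ∈ succ (succ n) by rewrite (in_succ (succ n)); right.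
have ne x : x ∈ succ n -> ap f x <> v.
  by move=> xn /(jf _ _ (i1 _ xn) i2) e; apply: (mem_irrefl x); rewrite {2}e.
apply: (Inj_rel _ _ (fun x y => (ap f x = n /\ y = v) \/ (ap f x <> n /\ y = ap f x))).
- by dfn.
- move=> x xn; case: (classic (ap f x = n)) => e.
    exists v; split; last by left.
    by have := tf _ i2; rewrite in_succ => -[//|e']; case: (ne x xn); rewrite e.
  exists (ap f x); split; last by right.
  by have := tf _ (i1 _ xn); rewrite in_succ => -[//|/e].
- by move=> x y y' _ [[? ->]|[? ->]] [[? ->]|[? ->]].
- move=> x x' y xn xn' [[e ->]|[? ->]] [[e' h]|[? h]].
  + by apply: jf; [exact: i1|exact: i1|rewrite e e'].
  + by case: (ne x' xn').
  + by case: (ne x xn).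
  + by apply: jf => //; exact: i1.
Qed.

Lemma finite_Inj x y : Inj x y -> finite y -> finite x.
Proof.
rewrite !finiteE => ixy [n [nW /eqn_Inj iyn]].
have [c [cn xc]] := Inj_image _ _ (Inj_trans _ _ _ ixy iyn).
have on := Ord_mem _ _ Ord_W nW.
have [d [od [dn cd]]] := collapse n c on cn.
exists d; split; last exact: eqn_trans xc cd.
by move: dn; rewrite Ord_subset // => -[h|->] //; apply: Ord_trans Ord_W h nW.
Qed.

Lemma finite_subset x y : subset x y -> finite y -> finite x.
Proof. by move=> /Inj_subset; apply: finite_Inj. Qed.

Lemma Inj_insert x y a b : Inj x y -> ~ b ∈ y -> Inj (cup x (sing a)) (cup y (sing b)).
Proof.
move=> /InjE [f [tf jf]] nb.
apply: (Inj_rel _ _ (fun z w => (z ∈ x /\ w = ap f z) \/ (~ z ∈ x /\ w = b))).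
- by dfn.
- move=> z; rewrite in_cup in_sing => h; case: (classic (z ∈ x)) => zx.
    by exists (ap f z); rewrite in_cup; split; left=> //; apply: tf.
  by exists b; rewrite in_cup in_sing; split; right.
- by move=> z w w' _ [[? ->]|[? ->]] [[? ->]|[? ->]].
- move=> z z' w; rewrite !in_cup !in_sing => h h' [[zx ->]|[zx ->]] [[zx' e]|[zx' e]].
  + exact: jf.
  + by case: nb; rewrite -e; apply: tf.
  + by case: nb; rewrite e; apply: tf.
  + by case: h h' => [//|->] [//|->].
Qed.

Lemma finite_emp : finite emp.
Proof. by rewrite finiteE; exists emp; split; [exact: W_emp|exact: eqn_refl]. Qed.

Lemma finite_W n : n ∈ W -> finite n.
Proof. by move=> nW; rewrite finiteE; exists n; split=> //; exact: eqn_refl. Qed.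

Lemma finite_insert x a : finite x -> finite (cup x (sing a)).
Proof.
rewrite {1}finiteE => -[n [nW /eqn_Inj h]].
apply: (finite_Inj _ (succ n)); last by apply: finite_W; apply: W_succ.
by apply: Inj_insert => //; exact: mem_irrefl.
Qed.

Lemma finite_ind (P : M -> Prop) : Definable (fun E => P (E 0)) -> P emp ->
  (forall x a, finite x -> P x -> P (cup x (sing a))) -> forall x, finite x -> P x.
Proof.
move=> dP P0 PS x; rewrite finiteE => -[n [nW]].
move: nW x; apply: (W_ind (fun n => forall x, equinumerous x n -> P x)) n; first by dfn.
  move=> x /eqnE [f [tf _]]; have -> // : x = emp.
  by apply: set_ext => z; rewrite in_emp; split=> // /tf; rewrite in_emp.
move=> n nW IH x /eqnE [f [tf [sf jf]]].
have [a [ax ea]] : exists a, a ∈ x /\ n = ap f a by apply: sf; rewrite in_succ; right.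
have -> : x = cup (diff x (sing a)) (sing a).
  apply: set_ext => z; rewrite in_cup in_diff in_sing; split; last by move=> [[]|->].
  by case: (classic (z = a)); tauto.
have e : equinumerous (diff x (sing a)) n.
  apply: (eqn_fun _ _ (ap f)); first by dfn.
  - move=> z; rewrite in_diff in_sing => -[zx za]; have := tf z zx; rewrite in_succ => -[//|e].
    by case: za; apply: jf => //; rewrite -ea.
  - move=> y yn; have [z [zx e]] : exists z, z ∈ x /\ y = ap f z by apply: sf; rewrite in_succ; left.
    exists z; rewrite in_diff in_sing; do 2 split=> //.
    by move=> e'; apply: (mem_irrefl n); rewrite {1}ea -e' -e.
  - by move=> z z'; rewrite !in_diff => -[? _] [? _]; apply: jf.
apply: PS; last exact: IH.
by rewrite finiteE; exists n.
Qed.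

Lemma finite_cup x y : finite x -> finite y -> finite (cup x y).
Proof.
move=> fx; apply: (finite_ind (fun y => finite (cup x y))) y; first by dfn.
  by apply: finite_subset fx => z; rewrite in_cup in_emp; tauto.
move=> y a _ /(finite_insert _ a); apply: finite_subset => z.
by rewrite !in_cup; tauto.
Qed.

Lemma finite_image x (F : M -> M) : DefTerm (fun E => F (E 0)) -> finite x -> finite (repl x F).
Proof.
move=> dF; apply: (finite_ind (fun x => finite (repl x F))) x.
- apply: D_finite; apply: DT_repl; first by dfn.
  exact: dF.
- apply: finite_subset finite_emp => z; rewrite in_repl // => -[x []].
  by rewrite in_emp.
- move=> x a _ /(finite_insert _ (F a)); apply: finite_subset => z.
  rewrite in_cup in_sing !in_repl // => -[y []]; rewrite in_cup in_sing => -[h ->|-> ->].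
    by left; exists y.
  by right.
Qed.

Lemma finite_max x : finite x -> nonempty x -> (forall y, y ∈ x -> Ord y) ->
  exists m, m ∈ x /\ forall y, y ∈ x -> y = m \/ y ∈ m.
Proof.
apply: (finite_ind (fun x => nonempty x -> (forall y, y ∈ x -> Ord y) ->
  exists m, m ∈ x /\ forall y, y ∈ x -> y = m \/ y ∈ m)) x; first by rewrite /nonempty; dfn.
  by move=> [y]; rewrite in_emp.
move=> x a _ IH _ ox.
have oa : Ord a by apply: ox; rewrite in_cup in_sing; right.
have ox' y : y ∈ x -> Ord y by move=> yx; apply: ox; rewrite in_cup; left.
case: (classic (nonempty x)) => [ne|ne]; last first.
  exists a; rewrite in_cup in_sing; split; first by right.
  by move=> y; rewrite in_cup in_sing => -[yx|]; [case: ne; exists y|left].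
have [m [mx hm]] := IH ne ox'.
have [h|[e|h]] := Ord_total _ _ oa (ox' _ mx).
- exists m; rewrite in_cup; split; first by left.
  by move=> y; rewrite in_cup in_sing => -[/hm|->] //; right.
- exists m; rewrite in_cup; split; first by left.
  by move=> y; rewrite in_cup in_sing => -[/hm|->] //; left.
- exists a; rewrite in_cup in_sing; split; first by right.
  move=> y; rewrite in_cup in_sing => -[yx|]; last by left.
  by right; have [->//|h'] := hm y yx; apply: Ord_trans oa h' h.
Qed.

Lemma finite_prod x y : finite x -> finite y -> finite (cprod x y).
Proof.
move=> fx fy; apply: (finite_ind (fun x => finite (cprod x y))) x fx; first by dfn.
  apply: finite_subset finite_emp => z; rewrite in_prod => -[v [w []]].
  by rewrite in_emp.
move=> x a _ fx.
have fi : finite (repl y (fun z => opair a z)) by apply: finite_image => //; dfn.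
apply: finite_subset (finite_cup _ _ fx fi) => z; rewrite in_cup in_repl; first by dfn.
rewrite !in_prod => -[v [w []]]; rewrite in_cup in_sing => -[vx|->] [wy ->].
  by left; exists v, w.
by right; exists w.
Qed.

Lemma infinite_W : infinite W.
Proof.
rewrite /infinite finiteE => -[n [nW /eqn_Inj h]].
apply: (no_Inj_succ n nW); apply: Inj_trans h; apply: Inj_subset => z.
by rewrite in_succ => -[zn|->] //; apply: Ord_trans Ord_W zn nW.
Qed.

Lemma infinite_diff x y : infinite x -> finite y -> exists z, z ∈ x /\ ~ z ∈ y.
Proof.
move=> ix fy; apply: NNPP => h; apply: ix; apply: finite_subset fy => z zx.
by apply: NNPP => zy; apply: h; exists z.
Qed.

Lemma is_cardinal_W : is_cardinal W.
Proof.
split; first by rewrite is_ordinalE; exact: Ord_W.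
by move=> n nW /eqn_sym h; apply: infinite_W; rewrite finiteE; exists n.
Qed.

Lemma W_bounded x : finite x -> subset x W -> exists k, k ∈ W /\ subset x k.
Proof.
move=> fx xW; case: (classic (nonempty x)) => [ne|ne]; last first.
  by exists emp; split; [exact: W_emp|move=> z zx; case: ne; exists z].
have [|m [mx hm]] := finite_max x fx ne; first by move=> y /xW; apply: Ord_mem; exact: Ord_W.
exists (succ m); split; first by apply: W_succ; apply: xW.
by move=> z /hm; rewrite in_succ; tauto.
Qed.

End Finite.

(** * Countable sets and the first uncountable ordinal *)

Section Countable.
Context {M : structure} {HZ : ZFC M}.
Local Notation emp := (@emp M HZ).
Local Notation W := (@W M HZ).
Implicit Types a b c d e f g h k m n p r x y z w i j : M.

Lemma in_lam a (F : M -> M) p : DefTerm (fun E => F (E 0)) ->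
  (p ∈ lam a F) = (exists x, x ∈ a /\ p = opair x (F x)).
Proof. by move=> dF; rewrite in_repl //; dfn. Qed.

Lemma ap_lam a (F : M -> M) x : DefTerm (fun E => F (E 0)) -> x ∈ a -> ap (lam a F) x = F x.
Proof.
move=> dF xa; apply: ap_eq; last by rewrite in_lam //; exists x.
rewrite functionalE => v y y'; rewrite !in_lam // => -[z [_ /opair_eq [-> ->]]].
by move=> [z' [_ /opair_eq [-> ->]]].
Qed.

Lemma choice_function a : (forall x, x ∈ a -> nonempty x) ->
  exists f, forall x, x ∈ a -> ap f x ∈ x.
Proof.
have [_ [_ [_ [_ [_ [_ [_ [_ H]]]]]]]] := HZ.
move=> /H [f [u [_ [ff h]]]]; exists f => x xa.
have [_ ?] := function_ap _ _ _ _ ff xa.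
by apply: h => //; rewrite appE.
Qed.

Lemma choice_rel a b (R : M -> M -> Prop) : Definable (fun E => R (E 0) (E 1)) ->
  (forall x, x ∈ a -> exists y, y ∈ b /\ R x y) ->
  exists f, forall x, x ∈ a -> ap f x ∈ b /\ R x (ap f x).
Proof.
move=> dR tot; have dR' x : Definable (fun E => R x (E 0)) by dfn.
have dS : DefTerm (fun E => sep b (fun y => R (E 0) y)) by dfn.
have [x|c hc] := choice_function (repl a (fun x => sep b (fun y => R x y))).
  rewrite in_repl // => -[z [/tot [y [yb Rzy]] ->]]; exists y.
  by rewrite in_sep.
exists (lam a (fun x => ap c (sep b (fun y => R x y)))) => x xa.
rewrite ap_lam //; first by dfn.
have := hc (sep b (fun y => R x y)); rewrite in_repl // in_sep //.
by apply; exists x.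
Qed.

Lemma Inj_repl a (F : M -> M) : DefTerm (fun E => F (E 0)) -> Inj (repl a F) a.
Proof.
move=> dF; have [||f hf] := choice_rel (repl a F) a (fun y x => y = F x).
  by dfn.
  by move=> y; rewrite in_repl.
apply: (Inj_fun _ _ (ap f)); first by dfn.
  by move=> y /hf [].
by move=> y y' /hf [_ e] /hf [_ e'] e''; rewrite e e' e''.
Qed.

Lemma Ord_cup a b : Ord a -> Ord b -> cup a b = a \/ cup a b = b.
Proof.
move=> oa ob; have [h|[->|h]] := Ord_total _ _ oa ob.
- right; apply: set_ext => z; rewrite in_cup; split; last by right.
  by move=> [za|//]; apply: Ord_trans ob za h.
- by left; apply: set_ext => z; rewrite in_cup; tauto.
- left; apply: set_ext => z; rewrite in_cup; split; last by left.
  by move=> [//|zb]; apply: Ord_trans oa zb h.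
Qed.

Lemma W_cup m n : m ∈ W -> n ∈ W -> cup m n ∈ W.
Proof.
by move=> mW nW; case: (Ord_cup m n (Ord_mem _ _ Ord_W mW) (Ord_mem _ _ Ord_W nW)) => ->.
Qed.

(* Goedel's well-ordering of pairs: by maximum, then lexicographically. *)
Definition pair_lt i j m n : Prop :=
  cup i j ∈ cup m n \/ (cup i j = cup m n /\ (i ∈ m \/ (i = m /\ j ∈ n))).

Definition pair_seg m n : M := sep (cprod W W) (fun p => exists i j, p = opair i j /\ pair_lt i j m n).

Lemma in_pair_seg i j m n : (opair i j ∈ pair_seg m n) = (i ∈ W /\ j ∈ W /\ pair_lt i j m n).
Proof.
rewrite in_sep; first by rewrite /pair_lt; dfn.
rewrite in_prod_opair; apply: propeq; split; last by move=> [? [? ?]]; split=> //; exists i, j.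
by move=> [[? ?] [i' [j' [/opair_eq [<- <-]]]]].
Qed.

Lemma finite_pair_seg m n : m ∈ W -> n ∈ W -> finite (pair_seg m n).
Proof.
move=> mW nW; have kW := W_succ _ (W_cup _ _ mW nW); set k := succ _ in kW.
have ok := Ord_mem _ _ Ord_W kW.
apply: finite_subset (finite_prod _ _ (finite_W _ kW) (finite_W _ kW)) => p hp.
have: p ∈ cprod W W by move: hp; rewrite in_sep; [rewrite /pair_lt; dfn|case].
rewrite in_prod => -[i [j [iW [jW e]]]]; move: hp.
rewrite e in_pair_seg => -[_ [_ h]]; rewrite in_prod_opair.
have oi := Ord_mem _ _ Ord_W iW; have oj := Ord_mem _ _ Ord_W jW.
have hk : cup i j ∈ k by rewrite in_succ; case: h => [|[]]; tauto.
have le x : Ord x -> subset x (cup i j) -> x ∈ k.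
  move=> ox /Ord_subset; have oc := Ord_mem _ _ ok hk; move=> /(_ ox oc) [h'|->] //.
  exact: Ord_trans ok h' hk.
by split; apply: le => // z; rewrite in_cup; tauto.
Qed.

Lemma pair_lt_total i j m n : i ∈ W -> j ∈ W -> m ∈ W -> n ∈ W ->
  pair_lt i j m n \/ (i = m /\ j = n) \/ pair_lt m n i j.
Proof.
move=> iW jW mW nW; rewrite /pair_lt.
have oW x : x ∈ W -> Ord x by apply: Ord_mem; exact: Ord_W.
have := Ord_total _ _ (oW _ (W_cup _ _ iW jW)) (oW _ (W_cup _ _ mW nW)).
have := Ord_total _ _ (oW _ iW) (oW _ mW).
have := Ord_total _ _ (oW _ jW) (oW _ nW).
by intuition.
Qed.

Lemma pair_lt_trans i j m n k l : k ∈ W -> l ∈ W -> m ∈ W -> n ∈ W ->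
  pair_lt i j m n -> pair_lt m n k l -> pair_lt i j k l.
Proof.
move=> kW lW mW nW; rewrite /pair_lt.
have oW x : x ∈ W -> Ord x by apply: Ord_mem; exact: Ord_W.
have t1 : cup i j ∈ cup m n -> cup m n ∈ cup k l -> cup i j ∈ cup k l.
  by apply: Ord_trans; apply: oW; apply: W_cup.
have t2 : i ∈ m -> m ∈ k -> i ∈ k by apply: Ord_trans; apply: oW.
have t3 : j ∈ n -> n ∈ l -> j ∈ l by apply: Ord_trans; apply: oW.
move=> [h1|[e1 h1]] [h2|[e2 h2]].
- by left; apply: t1.
- by left; rewrite -e2.
- by left; rewrite e1.
- right; split; first by rewrite e1.
  case: h1 h2 => [h1|[e3 h1]] [h2|[e4 h2]].
  + by left; apply: t2.
  + by left; rewrite -e4.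
  + by left; rewrite e3.
  + by right; split; [rewrite e3|apply: t3].
Qed.

Lemma pair_lt_irrefl m n : ~ pair_lt m n m n.
Proof. by move=> [/mem_irrefl|[_ [/mem_irrefl|[_ /mem_irrefl]]]]. Qed.

(** A pair is sent to the number of its predecessors, finite because maxima are compared first. The
    segment of a larger pair contains that of a smaller one together with the smaller pair itself,
    so equal counts contradict [no_Inj_succ]. *)
Lemma Inj_WW : Inj (cprod W W) W.
Proof.
apply: (Inj_rel _ _ (fun p c => c ∈ W /\ exists m n, p = opair m n /\ equinumerous (pair_seg m n) c)).
- by rewrite /pair_seg /pair_lt; dfn.
- move=> p; rewrite in_prod => -[m [n [mW [nW ->]]]].
  have := finite_pair_seg _ _ mW nW; rewrite finiteE => -[c [cW e]].
  by exists c; do 2 split=> //; exists m, n.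
- move=> p c c' _ [cW [m [n [-> e]]]] [cW' [m' [n' [/opair_eq [<- <-] e']]]].
  have oc := Ord_mem _ _ Ord_W cW; have oc' := Ord_mem _ _ Ord_W cW'.
  have key x y : x ∈ W -> y ∈ W -> equinumerous y x -> ~ x ∈ y.
    move=> xW yW exy xy; apply: (no_Inj_succ x xW).
    apply: Inj_trans (eqn_Inj _ _ exy); apply: Inj_subset => z; rewrite in_succ => -[zx|->] //.
    exact: Ord_trans (Ord_mem _ _ Ord_W yW) zx xy.
  have ecc : equinumerous c c' by apply: eqn_trans e'; apply: eqn_sym.
  have [h|[//|h]] := Ord_total _ _ oc oc'.
    by case: (key c c'  cW cW' (eqn_sym _ _ ecc) h).
  by case: (key c' c cW' cW ecc h).
- move=> p p' c; rewrite !in_prod => -[m [n [mW [nW ->]]]] [m' [n' [mW' [nW' ->]]]].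
  move=> [cW [i [j [/opair_eq [<- <-] e]]]] [_ [i' [j' [/opair_eq [<- <-] e']]]].
  have key k l k' l' : k ∈ W -> l ∈ W -> k' ∈ W -> l' ∈ W -> equinumerous (pair_seg k l) c ->
      equinumerous (pair_seg k' l') c -> ~ pair_lt k l k' l'.
    move=> kW lW kW' lW' ek ek' lt; apply: (no_Inj_succ c cW).
    apply: (Inj_trans (cup (pair_seg k l) (sing (opair k l)))).
      apply: Inj_insert; first by apply: eqn_Inj; apply: eqn_sym.
      by rewrite in_pair_seg => -[_ [_ /pair_lt_irrefl]].
    apply: Inj_trans (eqn_Inj _ _ ek'); apply: Inj_subset => q; rewrite in_cup in_sing.
    move=> [hq|->]; last by rewrite in_pair_seg.
    have: q ∈ cprod W W by move: hq; rewrite in_sep; [rewrite /pair_lt; dfn|case].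
    rewrite in_prod => -[v [w [vW [wW eq]]]]; move: hq; rewrite eq !in_pair_seg.
    by move=> [? [? h]]; do 2 split=> //; apply: pair_lt_trans h lt.
  have [h|[[-> ->]//|h]] := pair_lt_total _ _ _ _ mW nW mW' nW'.
    by case: (key _ _ _ _ mW nW mW' nW' e e').
  by case: (key _ _ _ _ mW' nW' mW nW e' e).
Qed.

(** A countable union of countable sets: choice fixes an injection for each piece, and [z] goes to
    the pair of a piece index and its code there. Contraposed, it is the pigeonhole principle used
    for uncountable sets. *)
Lemma ctbl_cover x (R : M -> M -> Prop) : Definable (fun E => R (E 0) (E 1)) ->
  (forall z, z ∈ x -> exists k, k ∈ W /\ R k z) ->
  (forall k, k ∈ W -> Inj (sep x (R k)) W) -> Inj x W.
Proof.
move=> dR cov ctb; have dR' k : Definable (fun E => R k (E 0)) by dfn.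
have [||h hh] := choice_rel W (pow (cprod x W)) (fun k f => is_injection f (sep x (fun z => R k z)) W).
  by dfn.
  move=> k /ctb [f /[dup] [[[ff _] _] If]]; exists f; split=> //.
  rewrite in_pow => p /ff [v [w []]]; rewrite in_sep // is_opairE => -[vx _] [wW ->].
  by rewrite in_prod_opair.
apply: Inj_trans Inj_WW.
have [||K hK] := choice_rel x W (fun z k => R k z) => //; first by dfn.
apply: (Inj_fun _ _ (fun z => opair (ap K z) (ap (ap h (ap K z)) z))); first by dfn.
  move=> z /[dup] zx /hK [kW Rkz]; rewrite in_prod_opair; split=> //.
  have [_ /is_injectionP [ff _]] := hh _ kW.
  have hz : z ∈ sep x (R (ap K z)) by rewrite in_sep.
  by case: (function_ap _ _ _ _ ff hz).
move=> z z' zx zx' /opair_eq [e]; rewrite -e => e'.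
have [kW Rkz] := hK _ zx; have [_ Rkz'] := hK _ zx'.
have [_ /is_injectionP [_ jf]] := hh _ kW.
by apply: jf e'; rewrite in_sep //; split=> //; rewrite e.
Qed.

Lemma ctbl_cup x y : Inj x W -> Inj y W -> Inj (cup x y) W.
Proof.
move=> cx cy; apply: (ctbl_cover _ (fun k z => (k = emp /\ z ∈ x) \/ (k <> emp /\ z ∈ y))).
- by dfn.
- move=> z; rewrite in_cup => -[zx|zy]; first by exists emp; split; [exact: W_emp|left].
  exists (succ emp); split; first by apply: W_succ; exact: W_emp.
  right; split=> // e; have: emp ∈ succ emp by rewrite in_succ; right.
  by rewrite e in_emp.
- move=> k kW; case: (classic (k = emp)) => ke.
    apply: Inj_trans cx; apply: Inj_subset => z; rewrite in_sep; first by dfn.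
    by tauto.
  apply: Inj_trans cy; apply: Inj_subset => z; rewrite in_sep; first by dfn.
  by tauto.
Qed.

Lemma ctbl_succ x : Inj x W -> Inj (succ x) W.
Proof.
move=> cx; apply: ctbl_cup => //; apply: (Inj_fun _ _ (fun z => emp)); first by dfn.
  by move=> _ _; exact: W_emp.
by move=> z z'; rewrite !in_sing => -> ->.
Qed.

End Countable.

(** * The first uncountable ordinal *)

Section Omega1.
Context {M : structure} {HZ : ZFC M}.
Local Notation emp := (@emp M HZ).
Local Notation W := (@W M HZ).
Implicit Types a b c d e f g h k l m n p r x y z w i j o : M.

Lemma is_omega1E o : is_omega1 o = is_card_succ o W.
Proof.
apply: propeq; split; first by move=> [w []]; rewrite is_omegaE => ->.
by move=> h; exists W; split=> //; exact: is_omega_W.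
Qed.

Lemma no_Inj_smaller_cardinal a b : is_cardinal a -> Ord b -> b ∈ a -> ~ Inj a b.
Proof.
move=> [+ ca] ob ba /Inj_image [c [cb e]]; rewrite is_ordinalE => oa.
have [d [od [db ed]]] := collapse b c ob cb.
apply: (ca d); last by apply: eqn_sym; apply: eqn_trans ed.
by move: db; rewrite Ord_subset // => -[h|->] //; apply: Ord_trans oa h ba.
Qed.

Lemma omega1_Ord o : is_omega1 o -> Ord o.
Proof. by rewrite is_omega1E => -[[+ _] _]; rewrite is_ordinalE. Qed.

Lemma omega1_uncountable o : is_omega1 o -> ~ Inj o W.
Proof. by rewrite is_omega1E => -[co [Wo _]]; apply: no_Inj_smaller_cardinal => //; exact: Ord_W. Qed.

Lemma omega1_countable o a : is_omega1 o -> a ∈ o -> Inj a W.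
Proof.
move=> /[dup] ho; rewrite is_omega1E => -[co [Wo min]] ao; have oo := omega1_Ord _ ho.
have oa := Ord_mem _ _ oo ao.
have [l [[cl el] la]] := cardinal_of_ordinal a oa.
have ol : Ord l by case: cl; rewrite is_ordinalE.
apply: Inj_trans (eqn_Inj _ _ el) _; apply: Inj_subset; apply/Ord_notin => //; first exact: Ord_W.
move=> /(min l cl) h; apply: (mem_irrefl a).
by case: h => h; [apply: la; rewrite -h|apply: la; apply: Ord_trans ol ao h].
Qed.

Lemma omega1_succ o a : is_omega1 o -> a ∈ o -> succ a ∈ o.
Proof.
move=> ho ao; have oo := omega1_Ord _ ho; have oa := Ord_mem _ _ oo ao.
have [//|h] := Ord_total _ _ (Ord_succ _ oa) oo.
case: (omega1_uncountable o ho); apply: (Inj_trans (succ a)); last first.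
  by apply: ctbl_succ; apply: omega1_countable ao.
apply: Inj_subset; apply/Ord_subset => //; first exact: Ord_succ.
by case: h => [->|]; tauto.
Qed.

Lemma omega1_subset o c : is_omega1 o -> subset c o -> ~ Inj c W -> equinumerous c o.
Proof.
move=> ho co nc; have oo := omega1_Ord _ ho.
have [d [od [dn e]]] := collapse o c oo co.
have [h|<- //] := proj1 (Ord_subset _ _ od oo) dn.
by case: nc; apply: Inj_trans (eqn_Inj _ _ e) (omega1_countable _ _ ho h).
Qed.

Lemma omega_subset c : subset c W -> infinite c -> equinumerous c W.
Proof.
move=> cW ic; have [d [od [dn e]]] := collapse W c Ord_W cW.
have [h|<- //] := proj1 (Ord_subset _ _ od Ord_W) dn.
by case: ic; rewrite finiteE; exists d.
Qed.

(** It is the least ordinal without an injection into omega; [Hartogs] supplies a first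
    candidate. *)
Lemma omega1_exists : exists o, is_omega1 o.
Proof.
have [b [ob nb]] := Hartogs W.
have [|o [oo [no [_ ho]]]] := least_ordinal (fun b => ~ Inj b W) b _ ob nb; first by dfn.
have ct a : a ∈ o -> Inj a W by move=> /ho /NNPP.
exists o; rewrite is_omega1E; split; [split|split].
- by rewrite is_ordinalE.
- by move=> a ao e; apply: no; apply: Inj_trans (ct a ao); apply: eqn_Inj; apply: eqn_sym.
- apply: NNPP => h; apply: no; apply: Inj_subset; apply/Ord_notin => //; exact: Ord_W.
- move=> m cm Wm; have om : Ord m by case: cm; rewrite is_ordinalE.
  have nm := no_Inj_smaller_cardinal _ _ cm Ord_W Wm.
  have [|[|h]] := Ord_total _ _ oo om; [by right|by left|].
  by case: nm; apply: ct.
Qed.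

Lemma omega1_unique o o' : is_omega1 o -> is_omega1 o' -> o = o'.
Proof.
move=> ho ho'; have [h|[//|h]] := Ord_total _ _ (omega1_Ord _ ho) (omega1_Ord _ ho').
  by case: (omega1_uncountable _ ho); apply: omega1_countable h.
by case: (omega1_uncountable _ ho'); apply: omega1_countable h.
Qed.

End Omega1.

(** * Strategies and plays *)

Section Game.
Context {M : structure} {HZ : ZFC M}.
Local Notation emp := (@emp M HZ).
Local Notation W := (@W M HZ).
Implicit Types a b c d e f g h k m n p q r x y z w i j : M.

Lemma claimedE mk br e : claimed mk br e =
  ((exists x, opair x e ∈ mk) \/ (exists x, opair x e ∈ br)).
Proof.
by apply: propeq; split; (move=> [[x h]|[x h]]; [left|right]; exists x; move: h); rewrite appE.
Qed.

Lemma position_of_lengthsE Ed mk br a b : position_of_lengths Ed mk br a b =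
  (Ord a /\ Ord b /\ is_injection mk a Ed /\ is_injection br b Ed /\
   forall e x y, opair x e ∈ mk -> opair y e ∈ br -> False).
Proof.
rewrite /position_of_lengths !is_ordinalE; apply: propeq; split=> -[oa [ob [im [ib h]]]];
  do 4 split=> //.
- by move=> e x y h1 h2; apply: (h e); [exists x|exists y]; rewrite appE.
- by move=> e [x h1] [y h2]; move: h1 h2; rewrite !appE; apply: h.
Qed.

(** The preference binds only when some legal edge meets it, so good moves exist in every unfinished
    position. That the preference can be met is left to the analysis of a particular play. *)
Definition good_move Ed (Good : M -> M -> M -> Prop) mk br e : Prop :=
  e ∈ Ed /\ ~ claimed mk br e /\
  ((exists e', e' ∈ Ed /\ ~ claimed mk br e' /\ Good mk br e') -> Good mk br e).

(* Choice turns a definable preference [Good] among the unclaimed edges into a strategy;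
   Hartogs bounds the length of positions, so that strategies are sets. *)
Lemma strategy_exists Ed (Good : M -> M -> M -> Prop) : Definable (fun E => Good (E 0) (E 1) (E 2)) ->
  exists f, functional f /\
    (forall mk br a b, position_of_lengths Ed mk br a b -> unfinished Ed mk br ->
       exists e, opair (opair mk br) e ∈ f) /\
    (forall mk br e, unfinished Ed mk br -> opair (opair mk br) e ∈ f ->
       good_move Ed Good mk br e).
Proof.
move=> dG; have [th [oth nth]] := Hartogs Ed.
have [x|c hc] := choice_function (sep (pow Ed) nonempty).
  by rewrite in_sep; [rewrite /nonempty; dfn|case].
pose (L := fun mk br => sep Ed (fun e => good_move Ed Good mk br e)).
have inL mk br e : e ∈ L mk br <-> good_move Ed Good mk br e.
  rewrite in_sep; first by rewrite /good_move; dfn.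
  by split=> [[]|] // h; split=> //; case: h.
pose (Q := pow (cprod th Ed)).
pose (R := fun q e => exists mk br, q = opair mk br /\ e = ap c (L mk br)).
have dR : Definable (fun E => R (E 0) (E 1)) by rewrite /R /L /good_move; dfn.
have cL mk br : unfinished Ed mk br -> ap c (L mk br) ∈ L mk br.
  move=> [e [eE ne]]; apply: hc; rewrite in_sep; first by rewrite /nonempty; dfn.
  split; first by rewrite in_pow => z /inL [].
  case: (classic (exists e', e' ∈ Ed /\ ~ claimed mk br e' /\ Good mk br e')) => [[e' h]|n].
    by exists e'; apply/inL; case: h => ? [? ?]; split.
  by exists e; apply/inL; split.
exists (graph (cprod Q Q) Ed R); split; [|split].
- rewrite functionalE => q e e'; rewrite !in_graph //.
  by move=> [_ [_ [mk [br [-> ->]]]]] [_ [_ [mk' [br' [/opair_eq [-> ->] ->]]]]].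
- move=> mk br a b; rewrite position_of_lengthsE => -[oa [ob [im [ib _]]]] un.
  have inQ f d : Ord d -> is_injection f d Ed -> f ∈ Q.
    move=> od If; rewrite in_pow => p; have [[ff _] _] := If => /ff [x [y [xd [yE]]]].
    rewrite is_opairE => ->; rewrite in_prod_opair; split=> //.
    have [h|[h|h]] := Ord_total _ _ od oth.
    + exact: Ord_trans oth xd h.
    + by rewrite -h.
    + case: nth; apply: (Inj_trans d); last by exists f.
      by apply: Inj_subset => z zt; apply: Ord_trans od zt h.
  exists (ap c (L mk br)); rewrite in_graph // in_prod_opair.
  split; first by split; [apply: inQ oa im|apply: inQ ob ib].
  split; last by exists mk, br.
  by have /inL [] := cL _ _ un.
- move=> mk br e un; rewrite in_graph // => -[_ [_ [mk' [br' [/opair_eq [<- <-] ->]]]]].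
  by apply/inL; apply: cL.
Qed.

Lemma claimed_restr mk br a b e : claimed (restr mk a) (restr br b) e <->
  (exists x, x ∈ a /\ opair x e ∈ mk) \/ (exists x, x ∈ b /\ opair x e ∈ br).
Proof.
rewrite claimedE; split; (move=> [[x h]|[x h]]; [left|right]; exists x; move: h);
  rewrite ?in_restr_opair; tauto.
Qed.

(* [T] and [S] are the numbers of moves of Maker and of Breaker. *)
Definition play Ed mk br T S : Prop :=
  position_of_lengths Ed mk br T S /\ (T = S \/ T = succ S) /\
  forall e, e ∈ Ed -> claimed mk br e.

Lemma complete_playP Ed mk br : complete_play Ed mk br <-> exists T S, play Ed mk br T S.
Proof.
split.
  move=> [[T [S [h p]]] nu]; exists T, S; split=> //; split.
    by case: h; [left|rewrite is_succE; right].
  by move=> e eE; apply: NNPP => n; apply: nu; exists e.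
move=> [T [S [p [h cl]]]]; split; last by move=> [e [eE]]; apply; apply: cl.
by exists T, S; rewrite is_succE.
Qed.

Lemma play_subset Ed mk br T S : play Ed mk br T S -> subset S T.
Proof. by move=> [_ [[->|->] _]] z //; rewrite in_succ; left. Qed.

Lemma unclaimed_maker Ed mk br T S t : play Ed mk br T S -> t ∈ T ->
  ap mk t ∈ Ed /\ ~ claimed (restr mk t) (restr br t) (ap mk t).
Proof.
move=> [+ _] tT; rewrite position_of_lengthsE => -[_ [_ [[fm jm] [_ dis]]]].
have [eE h] := function_ap _ _ _ _ fm tT; split=> // /claimed_restr [[x [xt h']]|[x [xt h']]].
  by case: (mem_irrefl x); rewrite {2}(_ : x = t) //; apply: (jm _ _ (ap mk t)); rewrite appE.
exact: dis h h'.
Qed.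

Lemma unclaimed_breaker Ed mk br T S t : play Ed mk br T S -> t ∈ S ->
  ap br t ∈ Ed /\ ~ claimed (restr mk (succ t)) (restr br t) (ap br t).
Proof.
move=> [+ _] tT; rewrite position_of_lengthsE => -[_ [_ [_ [[fm jm] dis]]]].
have [eE h] := function_ap _ _ _ _ fm tT; split=> // /claimed_restr [[x [xt h']]|[x [xt h']]].
  exact: dis h' h.
by case: (mem_irrefl x); rewrite {2}(_ : x = t) //; apply: (jm _ _ (ap br t)); rewrite appE.
Qed.

Lemma maker_strategy_exists Ed (Good : M -> M -> M -> Prop) :
  Definable (fun E => Good (E 0) (E 1) (E 2)) ->
  exists f, maker_strategy Ed f /\ forall mk br T S t, play Ed mk br T S -> maker_follows f mk br ->
    t ∈ T -> good_move Ed Good (restr mk t) (restr br t) (ap mk t).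
Proof.
move=> /(strategy_exists Ed) [f [ff [tot good]]]; exists f; split.
  split=> // mk br p [[t pos] un]; rewrite is_opairE => ->.
  have [e h] := tot _ _ _ _ pos un; exists e; rewrite appE; split=> //.
  by have [? [? _]] := good _ _ _ un h.
move=> mk br T S t pl fol tT; have [eE ne] := unclaimed_maker _ _ _ _ _ _ pl tT.
apply: good; first by exists (ap mk t).
have [+ _] := pl; rewrite position_of_lengthsE => -[_ [_ [[fm _] _]]].
have [_ h] := function_ap _ _ _ _ fm tT.
rewrite -appE; apply: (fol t _ (restr mk t) (restr br t)).
- by rewrite appE.
- by rewrite is_restrictionE.
- by rewrite is_restrictionE.
- by rewrite is_opairE.
Qed.

Lemma breaker_strategy_exists Ed (Good : M -> M -> M -> Prop) :
  Definable (fun E => Good (E 0) (E 1) (E 2)) ->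
  exists f, breaker_strategy Ed f /\ forall mk br T S t, play Ed mk br T S ->
    breaker_follows f mk br -> t ∈ S ->
    good_move Ed Good (restr mk (succ t)) (restr br t) (ap br t).
Proof.
move=> /(strategy_exists Ed) [f [ff [tot good]]]; exists f; split.
  split=> // mk br p [[t [s [_ pos]]] un]; rewrite is_opairE => ->.
  have [e h] := tot _ _ _ _ pos un; exists e; rewrite appE; split=> //.
  by have [? [? _]] := good _ _ _ un h.
move=> mk br T S t pl fol tS; have [eE ne] := unclaimed_breaker _ _ _ _ _ _ pl tS.
apply: good; first by exists (ap br t).
have [+ _] := pl; rewrite position_of_lengthsE => -[_ [_ [_ [[fm _] _]]]].
have [_ h] := function_ap _ _ _ _ fm tS.
rewrite -appE; apply: (fol t (succ t) _ (restr mk (succ t)) (restr br t)).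
- by rewrite appE.
- by rewrite is_succE.
- by rewrite is_restrictionE.
- by rewrite is_restrictionE.
- by rewrite is_opairE.
Qed.

End Game.

(** * The board as a set of edges [edge m b] *)

Section Bipartite.
Context {M : structure} {HZ : ZFC M}.
Local Notation emp := (@emp M HZ).
Local Notation W := (@W M HZ).
Implicit Types a b c d e f g h k m n p q r x y z w i j l : M.

Definition one : M := succ emp.
Definition vL m : M := opair m emp.
Definition vR b : M := opair b one.
Definition edge m b : M := upair (vL m) (vR b).

Lemma emp_neq_one : emp <> one.
Proof.
move=> e; have: emp ∈ one by rewrite in_succ; right.
by rewrite -e in_emp.
Qed.

Lemma vL_neq_vR m b : vL m <> vR b.
Proof. by move=> /opair_eq [_ /emp_neq_one]. Qed.

Lemma vL_inj m m' : vL m = vL m' -> m = m'.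
Proof. by move=> /opair_eq []. Qed.

Lemma vR_inj m m' : vR m = vR m' -> m = m'.
Proof. by move=> /opair_eq []. Qed.

Lemma edge_inj m b m' b' : edge m b = edge m' b' -> m = m' /\ b = b'.
Proof.
move=> /upair_eq [[/vL_inj -> /vR_inj ->]|[h _]] //.
by case: (vL_neq_vR m b').
Qed.

Lemma DT_vL (t : (nat -> M) -> M) : DefTerm t -> DefTerm (fun E => vL (t E)).
Proof. by move=> dt; rewrite /vL; dfn. Qed.
Lemma DT_vR (t : (nat -> M) -> M) : DefTerm t -> DefTerm (fun E => vR (t E)).
Proof. by move=> dt; rewrite /vR; dfn. Qed.
Lemma DT_edge (t s : (nat -> M) -> M) : DefTerm t -> DefTerm s -> DefTerm (fun E => edge (t E) (s E)).
Proof. by move=> dt ds; rewrite /edge /vL /vR; dfn. Qed.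

Definition bip_vertices V l k : Prop := forall v, v ∈ V <->
  (exists a, a ∈ l /\ v = vL a) \/ (exists b, b ∈ k /\ v = vR b).
Definition bip_edges Ed l k : Prop := forall e, e ∈ Ed <->
  exists a b, a ∈ l /\ b ∈ k /\ e = edge a b.

Lemma is_complete_bipartiteP V Ed l k : is_complete_bipartite V Ed l k <->
  bip_vertices V l k /\ bip_edges Ed l k.
Proof.
have hv v z a : (exists x, x ∈ a /\ is_opair v x z) <-> (exists x, x ∈ a /\ v = opair x z).
  by split; move=> [x [? h]]; exists x; split=> //; move: h; rewrite is_opairE.
have he e : (exists a b u v, a ∈ l /\ b ∈ k /\ is_opair u a emp /\ is_opair v b one /\
    is_upair e u v) <-> (exists a b, a ∈ l /\ b ∈ k /\ e = edge a b).
  split.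
    move=> [a [b [u [v]]]]; rewrite !is_opairE is_upairE => -[? [? [-> [-> ->]]]].
    by exists a, b.
  move=> [a [b [? [? ->]]]]; exists a, b, (vL a), (vR b).
  by rewrite !is_opairE is_upairE.
split.
  move=> [z [o [+ [+ [hV hE]]]]]; rewrite is_emptyE => ez; rewrite is_succE => eo; subst z o.
  by split=> v; [rewrite hV !hv|rewrite hE he].
move=> [hV hE]; exists emp, one; rewrite is_emptyE is_succE; do 2 split=> //.
by split=> v; [rewrite hV !hv|rewrite hE he].
Qed.

Lemma bipartite_exists l k : exists V Ed, is_complete_bipartite V Ed l k.
Proof.
pose (V := cup (cprod l (sing emp)) (cprod k (sing one))).
have hV : bip_vertices V l k.
  move=> v; rewrite in_cup !in_prod; split.
    by move=> [] [x [y [xl []]]]; rewrite in_sing => -> ->; [left|right]; exists x.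
  by move=> [] [x [xl ->]]; [left; exists x, emp|right; exists x, one]; rewrite in_sing.
exists V, (sep (pow V) (fun e => exists a b, a ∈ l /\ b ∈ k /\ e = edge a b)).
apply/is_complete_bipartiteP; split=> // e; rewrite in_sep; first by dfn; apply: DT_edge; dfn.
split=> [[]|h] //; split=> //; case: h => a [b [al [bk ->]]].
rewrite in_pow => v; rewrite in_upair => -[->|->]; apply/hV.
  by left; exists a.
by right; exists b.
Qed.

Lemma bipartite_unique V Ed V' Ed' l k : is_complete_bipartite V Ed l k ->
  is_complete_bipartite V' Ed' l k -> V = V' /\ Ed = Ed'.
Proof.
move=> /is_complete_bipartiteP [hV hE] /is_complete_bipartiteP [hV' hE'].
by split; apply: set_ext => z; rewrite ?hV ?hV' ?hE ?hE'.
Qed.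

End Bipartite.
#[global] Hint Extern 0 (DefTerm (fun _ => vL _)) => apply DT_vL; dfn : dfn.
#[global] Hint Extern 0 (DefTerm (fun _ => vR _)) => apply DT_vR; dfn : dfn.
#[global] Hint Extern 0 (DefTerm (fun _ => edge _ _)) => apply DT_edge; dfn : dfn.

(** * Maker's strategy *)

Section Chains.
Context {M : structure} {HZ : ZFC M}.
Local Notation emp := (@emp M HZ).
Local Notation W := (@W M HZ).
Implicit Types a b c d e f g h k m n p q r x y z w i j : M.

(** A finite subfamily of a chain modulo finite sets has an almost smallest member: at each
    insertion, the new set is compared with the previous almost smallest one. *)
Lemma chain_inter F : (forall x y, x ∈ F -> y ∈ F -> finite (diff x y) \/ finite (diff y x)) ->
  forall s, finite s -> nonempty s -> subset s F ->
  exists x, x ∈ s /\ finite (sep x (fun z => exists y, y ∈ s /\ ~ z ∈ y)).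
Proof.
move=> ch s fs.
apply: (finite_ind (fun s => nonempty s -> subset s F ->
  exists x, x ∈ s /\ finite (sep x (fun z => exists y, y ∈ s /\ ~ z ∈ y)))) s fs.
- by rewrite /nonempty; dfn.
- by move=> [z]; rewrite in_emp.
move=> s a fs IH _ sF.
have aF : a ∈ F by apply: sF; rewrite in_cup in_sing; right.
have sF' : subset s F by move=> z zs; apply: sF; rewrite in_cup; left.
case: (classic (nonempty s)) => ne; last first.
  exists a; rewrite in_cup in_sing; split; first by right.
  apply: finite_subset finite_emp => z; rewrite in_sep; first by dfn.
  move=> [za [y []]]; rewrite in_cup in_sing => -[ys|->] // _.
  by case: ne; exists y.
have [x [xs fx]] := IH ne sF'; have [f|f] := ch x a (sF' _ xs) aF.
- exists x; rewrite in_cup; split; first by left.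
  apply: finite_subset (finite_cup _ _ fx f) => z.
  rewrite in_cup in_diff !in_sep; try by dfn.
  move=> [zx [y [+ ny]]]; rewrite in_cup in_sing => -[ys|e]; last by right; rewrite -e.
  by left; split=> //; exists y.
- exists a; rewrite in_cup in_sing; split; first by right.
  apply: finite_subset (finite_cup _ _ fx f) => z.
  rewrite in_cup in_diff !in_sep; try by dfn.
  move=> [za [y [+ ny]]]; rewrite in_cup in_sing => -[ys|e]; last by case: ny; rewrite e.
  case: (classic (z ∈ x)) => zx; last by right.
  by left; split=> //; exists y.
Qed.

End Chains.

Section Neighbourhoods.
Context {M : structure} {HZ : ZFC M}.
Local Notation emp := (@emp M HZ).
Local Notation W := (@W M HZ).
Implicit Types a b c d e f g h k m n p q r x y z w i j t s : M.

Definition nbrs mk b : M := sep W (fun m => exists t, opair t (edge m b) ∈ mk).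
Definition taken mk br b : M := sep W (fun m => claimed mk br (edge m b)).

Lemma DT_nbrs (t s : (nat -> M) -> M) : DefTerm t -> DefTerm s -> DefTerm (fun E => nbrs (t E) (s E)).
Proof. by move=> dt ds; rewrite /nbrs; dfn. Qed.
Lemma DT_taken (t s u : (nat -> M) -> M) : DefTerm t -> DefTerm s -> DefTerm u ->
  DefTerm (fun E => taken (t E) (s E) (u E)).
Proof. by move=> dt ds du; rewrite /taken; dfn. Qed.

End Neighbourhoods.
#[global] Hint Extern 0 (DefTerm (fun _ => nbrs _ _)) => apply DT_nbrs; dfn : dfn.
#[global] Hint Extern 0 (DefTerm (fun _ => taken _ _ _)) => apply DT_taken; dfn : dfn.

(** * Analysis of a play in which Maker follows his strategy *)

Section Maker.
Context {M : structure} {HZ : ZFC M}.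
Local Notation emp := (@emp M HZ).
Local Notation W := (@W M HZ).
Local Notation edge := (@edge M HZ).
Implicit Types a b c d e f g h k m n p q r x y z w i j t s : M.

Lemma in_nbrs mk t b m : (m ∈ nbrs (restr mk t) b) = (m ∈ W /\ exists s, s ∈ t /\ opair s (edge m b) ∈ mk).
Proof.
rewrite in_sep; first by dfn.
by apply: propeq; split; move=> [mW [s h]]; split=> //; exists s; move: h; rewrite in_restr_opair; tauto.
Qed.

Lemma in_taken mk br t t' b m : (m ∈ taken (restr mk t) (restr br t') b) = (m ∈ W /\
  ((exists s, s ∈ t /\ opair s (edge m b) ∈ mk) \/ (exists s, s ∈ t' /\ opair s (edge m b) ∈ br))).
Proof. by rewrite in_sep; [dfn|rewrite (propeq _ _ (claimed_restr _ _ _ _ _))]. Qed.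

Definition current o mk br b : Prop :=
  b ∈ o /\ finite (taken mk br b) /\ forall c, c ∈ b -> infinite (taken mk br c).

(* [ap (ap h b)] is an injection of the countable ordinal [b] into omega; the
   requirement to stay inside the neighbourhood of [c] becomes active once Maker owns
   an edge at [b] whose other end exceeds the code of [c]. *)
Definition maker_good o h mk br e : Prop := exists b m, m ∈ W /\ e = edge m b /\
  current o mk br b /\
  forall c, c ∈ b -> infinite (nbrs mk c) ->
    (exists n, n ∈ nbrs mk b /\ ap (ap h b) c ∈ n) -> m ∈ nbrs mk c.

Lemma D_current (t s u v : (nat -> M) -> M) : DefTerm t -> DefTerm s -> DefTerm u -> DefTerm v ->
  Definable (fun E => current (t E) (s E) (u E) (v E)).
Proof. by move=> dt ds du dv; rewrite /current; dfn. Qed.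
#[local] Hint Extern 0 (Definable (fun _ => current _ _ _ _)) => apply D_current; dfn : dfn.

Lemma D_maker_good o h : Definable (fun E => maker_good o h (E 0) (E 1) (E 2)).
Proof. by rewrite /maker_good; dfn. Qed.

Lemma countable_codes o : is_omega1 o -> exists h, forall b, b ∈ o -> is_injection (ap h b) b W.
Proof.
move=> ho; have oo : Ord o by exact: omega1_Ord.
have [||h hh] := choice_rel o (pow (cprod o W)) (fun b f => is_injection f b W).
- by dfn.
- move=> b bo; have [f If] := omega1_countable _ _ ho bo; exists f; split=> //.
  rewrite in_pow => p; have [[ff _] _] := If => /ff [x [y [xb [yW]]]]; rewrite is_opairE => ->.
  by rewrite in_prod_opair; split=> //; apply: Ord_trans oo xb bo.
- by exists h => b /hh [].
Qed.

Context (o h Ed mk br T S : M) (ho : is_omega1 o)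
  (hh : forall b, b ∈ o -> is_injection (ap h b) b W) (hE : bip_edges Ed W o)
  (pl : play Ed mk br T S)
  (good : forall t, t ∈ T -> good_move Ed (maker_good o h) (restr mk t) (restr br t) (ap mk t)).

Let oo : Ord o := omega1_Ord _ ho.
Let Ordo x : x ∈ o -> Ord x. Proof. by apply: Ord_mem. Qed.

Local Notation Nt := (fun t => nbrs (restr mk t)).
Local Notation Ct := (fun t => taken (restr mk t) (restr br t)).
Local Notation cur := (fun t => current o (restr mk t) (restr br t)).
Local Notation G := (fun t => maker_good o h (restr mk t) (restr br t) (ap mk t)).

Let posT : Ord T. Proof. by have [+ _] := pl; rewrite position_of_lengthsE => -[]. Qed.
Let mkI : is_injection mk T Ed.
Proof. by have [+ _] := pl; rewrite position_of_lengthsE => -[_ [_ []]]. Qed.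
Let brI : is_injection br S Ed.
Proof. by have [+ _] := pl; rewrite position_of_lengthsE => -[_ [_ [_ []]]]. Qed.

(** Choose for each touched vertex a turn that plays at it; one turn of one player claims one edge,
    so the choice is injective. *)
Lemma ctbl_touched f A t : is_injection f A Ed -> Inj t W ->
  Inj (sep o (fun b => exists m s, s ∈ t /\ opair s (edge m b) ∈ f)) W.
Proof.
move=> [[_ [_ ff]] _] ct; apply: Inj_trans ct; rewrite functionalE in ff.
have [||g hg] := choice_rel (sep o (fun b => exists m s, s ∈ t /\ opair s (edge m b) ∈ f)) t
  (fun b s => exists m, opair s (edge m b) ∈ f).
- by dfn.
- by move=> b; rewrite in_sep; [dfn|move=> [_ [m [s [st ?]]]]; exists s; split=> //; exists m].
apply: (Inj_fun _ _ (ap g)); first by dfn.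
  by move=> b /hg [].
move=> b b' /hg [_ [m e]] /hg [_ [m' +]] eq; rewrite -eq => e'.
by have /edge_inj [] := ff _ _ _ e e'.
Qed.

Lemma untouched t : Inj t W -> exists b, b ∈ o /\ forall m, ~ m ∈ Ct t b.
Proof.
move=> ct; apply: NNPP => nex; apply: (omega1_uncountable _ ho).
apply: Inj_trans (ctbl_cup _ _ (ctbl_touched _ _ _ mkI ct) (ctbl_touched _ _ _ brI ct)).
apply: Inj_subset => b bo; rewrite in_cup !in_sep; try by dfn.
have [m hm] : exists m, m ∈ Ct t b.
  apply: NNPP => h'; apply: nex; exists b; split=> // m hm; apply: h'; by exists m.
by move: hm; rewrite in_taken => -[_ [[s h']|[s h']]]; [left|right]; split=> //; exists m, s.
Qed.

(** A play of countable length would leave some [b] untouched, although all edges are claimed at its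
    end. *)
Lemma o_T : subset o T.
Proof.
apply/Ord_notin => // To; have cT : Inj T W by exact: omega1_countable To.
have [b [bo hb]] := untouched T cT.
have eE : edge emp b ∈ Ed by apply/hE; exists emp, b; split=> //; exact: W_emp.
have [_ [_ /(_ _ eE)]] := pl; rewrite claimedE => cl; apply: (hb emp).
rewrite in_taken; split; first exact: W_emp.
have [[fm _] _] := mkI; have [[fb _] _] := brI.
case: cl => [[x hx]|[x hx]]; [left|right]; exists x; split=> //.
  by have [x' [y' [+ [_]]]] := fm _ hx; rewrite is_opairE => + /opair_eq [-> _].
have [x' [y' [+ [_]]]] := fb _ hx; rewrite is_opairE => + /opair_eq [-> _].
exact: (play_subset _ _ _ _ _ pl).
Qed.

Lemma move_at t : t ∈ o -> opair t (ap mk t) ∈ mk.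
Proof. by move=> /o_T tT; have [ff _] := mkI; case: (function_ap _ _ _ _ ff tT). Qed.

Lemma move_eq t e : opair t e ∈ mk -> e = ap mk t.
Proof. by have [ff _] := mkI => /(function_dom _ _ _ _ _ ff) [_ []]. Qed.

Lemma time_eq t t' e : opair t e ∈ mk -> opair t' e ∈ mk -> t = t'.
Proof. by have [_ j] := mkI => h1 h2; apply: (j _ _ e); rewrite appE. Qed.

Lemma taken_mono t t' b : subset t t' -> subset (Ct t b) (Ct t' b).
Proof.
move=> tt m; rewrite !in_taken => -[mW hm]; split=> //.
by case: hm => -[s [st h']]; [left|right]; exists s; split=> //; apply: tt.
Qed.

Lemma nbrs_taken t b : subset (Nt t b) (Ct t b).
Proof. by move=> m; rewrite in_nbrs in_taken => -[mW h']; split=> //; left. Qed.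

(** Claimed edges accumulate, so a vertex passed over because infinitely many of its edges were
    taken never becomes the target again. *)
Lemma current_mono t t' b b' : subset t t' -> cur t b -> cur t' b' -> ~ b' ∈ b.
Proof.
move=> tt [bo [_ hb]] [_ [fb' _]] h'; apply: (hb _ h').
by apply: finite_subset fb'; apply: taken_mono.
Qed.

Lemma current_exists t : t ∈ o -> exists b, cur t b.
Proof.
move=> to; have [b [bo hb]] := untouched t (omega1_countable _ _ ho to).
have fb : finite (Ct t b) by apply: finite_subset finite_emp => m /hb.
have [|m [om [fm [mb hm]]]] := least_ordinal (fun b => finite (Ct t b)) b _ (Ordo _ bo) fb.
  by dfn.
exists m; split; last by split.
by case: mb => [->|mb] //; apply: Ord_trans oo mb bo.
Qed.

Lemma good_current t m b : t ∈ o -> G t -> ap mk t = edge m b -> cur t b.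
Proof. by move=> to [b' [m' [_ [-> [cb _]]]]] /edge_inj [_ <-]. Qed.

(** Once Maker owns an edge from [n] to [b] with [n] beyond the code of [c], all his later moves at
    [b] stay in the neighbourhood of [c]. His earlier ones are finitely many. *)
Lemma tower t c b : Ord t -> subset t o -> (forall s, s ∈ t -> G s) -> c ∈ b -> b ∈ o ->
  infinite (Nt t b) -> infinite (Nt t c) -> finite (diff (Nt t b) (Nt t c)).
Proof.
move=> ot sto Gs cb bo ib ic.
have [fcode _] := hh _ bo; have [jW _] := function_ap _ _ _ _ fcode cb.
set j := ap (ap h b) c in jW.
(* A neighbour outside [succ j] exceeds the code [j] of [c]; [s0] is the turn at which it is
   claimed. *)
have [n []] := infinite_diff _ _ ib (finite_W _ (W_succ _ jW)).
rewrite in_nbrs => -[nW [s0 [s0t hs0]]] nj.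
have jn : j ∈ n.
  have [//|h'] := Ord_total _ _ (Ord_mem _ _ Ord_W jW) (Ord_mem _ _ Ord_W nW).
  by case: nj; rewrite in_succ; case: h' => [->|]; tauto.
have st x y : x ∈ y -> y ∈ t -> subset x y.
  by move=> xy yt z zx; apply: Ord_trans (Ord_mem _ _ ot yt) zx xy.
have cs s m b' : s ∈ t -> opair s (edge m b') ∈ mk -> cur s b'.
  by move=> st' /move_eq e; apply: (good_current s m); [exact: sto|exact: Gs|].
(* The possible exceptions: what Maker owned at [b] when it was his target at turn [s0], and [n]
   itself. *)
have f0 : finite (cup (Nt s0 b) (sing n)).
  apply: finite_insert; have [_ [+ _]] := cs _ _ _ s0t hs0.
  by apply: finite_subset; apply: nbrs_taken.
apply: finite_subset f0 => m; rewrite in_diff !in_nbrs in_cup in_sing in_nbrs.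
move=> [[mW [s [st' hs]]] nm].
have os := Ord_mem _ _ ot st'; have os0 := Ord_mem _ _ ot s0t.
have [h'|[h'|h']] := Ord_total _ _ os os0.
- by left; split=> //; exists s.
- right; move: hs; rewrite h' => /move_eq; rewrite -(move_eq _ _ hs0).
  by move=> /edge_inj [].
case: nm; split=> //.
have [b' [m' [_ [e [[_ [_ _]] act]]]]] := Gs s st'.
move: e; rewrite -(move_eq _ _ hs) => /edge_inj [em eb].
(* While Maker plays at [b] he is done with the smaller [c] for good, so the neighbourhood of [c] is
   already complete, hence infinite, at turn [s], and the rule about it is active. *)
have sub : subset (Nt t c) (Nt s c).
  move=> z; rewrite !in_nbrs => -[zW [v [vt hv]]]; split=> //; exists v; split=> //.
  have [//|h2] := Ord_total _ _ (Ord_mem _ _ ot vt) os.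
  case: (current_mono s v b c _ (cs _ _ _ st' hs) (cs _ _ _ vt hv) cb).
  by apply/Ord_subset => //; [exact: Ord_mem ot vt|case: h2 => [->|]; tauto].
have : m' ∈ Nt s c.
  apply: act; first by rewrite -eb.
    by move=> fs; apply: ic; apply: finite_subset fs.
  exists n; rewrite -eb; split=> //; rewrite in_nbrs; split=> //.
  by exists s0.
rewrite -em in_nbrs => -[_ [v [vs hv]]]; exists v; split=> //.
exact: Ord_trans ot vs st'.
Qed.

Lemma chain t : Ord t -> subset t o -> (forall s, s ∈ t -> G s) -> forall b c, b ∈ o -> c ∈ o ->
  infinite (Nt t b) -> infinite (Nt t c) ->
  finite (diff (Nt t b) (Nt t c)) \/ finite (diff (Nt t c) (Nt t b)).
Proof.
move=> ot sto Gs b c bo co ib ic.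
have [h'|[->|h']] := Ord_total _ _ (Ordo _ bo) (Ordo _ co).
- by right; apply: tower.
- by left; apply: finite_subset finite_emp => z; rewrite in_diff; tauto.
- by left; apply: tower.
Qed.

(** The strategy promises a preferred move only if there is one. By induction the earlier moves were
    preferred, so the infinite neighbourhoods form a chain modulo finite sets, and finitely many of
    them leave room for a move. *)
Lemma all_good t : t ∈ o -> G t.
Proof.
move=> to; have ot := Ordo _ to; move: t ot to; apply: Ord_ind.
  apply: D_imp; first by dfn.
  by apply: (D_comp3 (maker_good o h)); [exact: D_maker_good| dfn..].
move=> t ot IH to.
have sto : subset t o by move=> s st; apply: Ord_trans oo st to.
have Gs s : s ∈ t -> G s by move=> st; apply: IH => //; apply: sto.
have [_ [_ ]] := good t (o_T _ to); apply.
have [b cb] := current_exists t to; have [bo [fb hb]] := cb.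
have [k [kW nk]] : exists k, k ∈ W /\ subset (Nt t b) k.
  apply: W_bounded; first by apply: finite_subset fb; apply: nbrs_taken.
  by move=> m; rewrite in_nbrs => -[].
pose (act := fun c => infinite (Nt t c) /\ exists n, n ∈ Nt t b /\ ap (ap h b) c ∈ n).
have dA : Definable (fun E => act (E 0)) by rewrite /act; dfn.
pose (A := sep b act).
(* The codes of active requirements lie below the bound [k] of the finite neighbourhood of [b]. *)
have fA : finite A.
  apply: finite_Inj (finite_W _ kW); have /is_injectionP [_ jb] := hh _ bo.
  apply: (Inj_fun _ _ (ap (ap h b))); first by dfn.
    move=> c; rewrite in_sep // => -[_ [_ [n [/nk nk' cn]]]].
    exact: Ord_trans (Ord_mem _ _ Ord_W kW) cn nk'.
  by move=> c c'; rewrite !in_sep // => -[? _] [? _]; apply: jb.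
pose (s := repl A (Nt t)).
have dN : DefTerm (fun E => Nt t (E 0)) by dfn.
have fs : finite s by apply: finite_image.
(* [X] is an almost smallest active neighbourhood, or all of omega when nothing is active yet. *)
have [X [iX [XW fX]]] : exists X, infinite X /\ subset X W /\
    finite (sep X (fun z => exists y, y ∈ s /\ ~ z ∈ y)).
  case: (classic (nonempty s)) => ne; last first.
    exists W; split; first exact: infinite_W.
    split=> //; apply: finite_subset finite_emp => z; rewrite in_sep; first by dfn.
    by move=> [_ [y [ys _]]]; case: ne; exists y.
  have ins y : y ∈ s -> exists c, c ∈ o /\ infinite (Nt t c) /\ y = Nt t c.
    rewrite in_repl // => -[c [+ ->]]; rewrite in_sep // => -[cb' [ic _]].
    by exists c; split=> //; apply: Ord_trans oo cb' bo.
  have [||x [xs fx]] := chain_inter s _ s fs ne.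
    by move=> x y /ins [c [co [ic ->]]] /ins [c' [co' [ic' ->]]]; apply: chain.
    by [].
  exists x; have [c [_ [ic e]]] := ins _ xs; rewrite e; split=> //; split; last by rewrite -e.
  by move=> z; rewrite in_nbrs => -[].
(* Avoid the finitely many points of [X] missing from some active neighbourhood and the finitely
   many edges already taken at [b]. *)
have [m [mX nm]] := infinite_diff _ _ iX (finite_cup _ _ fX fb).
have mW := XW _ mX.
have eE : edge m b ∈ Ed by apply/hE; exists m, b.
exists (edge m b); split=> //; split.
  by move=> cl; apply: nm; rewrite in_cup; right; rewrite in_sep; [dfn|].
exists b, m; do 3 split=> //.
move=> c cb' ic hc; apply: NNPP => nmc; apply: nm; rewrite in_cup; left.
rewrite in_sep; first by dfn.
split=> //; exists (Nt t c); split=> //; rewrite in_repl //; exists c; split=> //.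
by rewrite in_sep.
Qed.

Definition built : M := sep o (fun b => exists t m, t ∈ o /\ opair t (edge m b) ∈ mk).

Lemma in_built b : (b ∈ built) = (b ∈ o /\ exists t m, t ∈ o /\ opair t (edge m b) ∈ mk).
Proof. by rewrite in_sep //; dfn. Qed.

Lemma move_edge t : t ∈ o -> exists m b, m ∈ W /\ b ∈ built /\ ap mk t = edge m b.
Proof.
move=> to; have [b [m [mW [e [[bo _] _]]]]] := all_good t to; exists m, b; split=> //; split=> //.
by rewrite in_built; split=> //; exists t, m; rewrite -e; split=> //; apply: move_at.
Qed.

(** Otherwise Maker plays at [b] in finitely many turns below omega1. In the turn after the last of
    them only finitely many edges at [b] are claimed, so [b] is still the target, a
    contradiction. *)
Lemma built_infinite b : b ∈ built -> infinite (Nt o b).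
Proof.
rewrite in_built => -[bo [t0 [m0 [t0o ht0]]]] fN.
pose (X := sep o (fun t => exists m, m ∈ W /\ ap mk t = edge m b)).
have inX t : t ∈ X <-> t ∈ o /\ exists m, m ∈ W /\ ap mk t = edge m b by rewrite in_sep; [dfn|].
have fX : finite X.
  apply: finite_Inj fN; apply: (Inj_rel _ _ (fun t m => ap mk t = edge m b)); first by dfn.
  - move=> t /inX [to [m [mW e]]]; exists m; split=> //; rewrite in_nbrs; split=> //.
    by exists t; rewrite -e; split=> //; apply: move_at.
  - by move=> t m m' _ -> /edge_inj [].
  - move=> t t' m /inX [to _] /inX [to' _] e e'; apply: (time_eq _ _ (edge m b)).
      by rewrite -e; apply: move_at.
    by rewrite -e'; apply: move_at.
have t0X : t0 ∈ X.
  apply/inX; split=> //; exists m0; rewrite -(move_eq _ _ ht0); split=> //.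
  by have [m [b' [mW [_]]]] := move_edge _ t0o; rewrite -(move_eq _ _ ht0) => /edge_inj [->].
have [|t [/[dup] tX /inX [to [m [mW e]]] hmax]] := finite_max X fX (ex_intro (fun z => z ∈ X) _ t0X).
  by move=> t /inX [to _]; apply: Ordo.
have sto : succ t ∈ o by exact: omega1_succ.
have [m' [b' [mW' [bb e']]]] := move_edge _ sto.
have ct := good_current t m b to (all_good _ to) e.
have cs := good_current _ _ _ sto (all_good _ sto) e'.
have sub : subset t (succ t) by move=> z; rewrite in_succ; left.
have eb : b' = b.
  have bo' := proj1 cs.
  have [h'|[//|h']] := Ord_total _ _ (Ordo _ bo') (Ordo _ bo).
    by case: (current_mono _ _ _ _ sub ct cs h').
  case: (proj2 (proj2 cs) b h').
  (* Turn [t] adds Maker's edge from [m] and at most one edge of Breaker to those taken before. *)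
  apply: (finite_subset _ (cup (cup (Ct t b) (sing m)) (sep W (fun k => ap br t = edge k b)))).
    move=> z; rewrite in_taken !in_cup in_taken in_sing in_sep; first by dfn.
    move=> [zW [[s []]|[s []]]]; rewrite in_succ => -[st|->] hs.
    - by left; left; split=> //; left; exists s.
    - by left; right; have /edge_inj [] : edge z b = edge m b by rewrite (move_eq _ _ hs).
    - by left; left; split=> //; right; exists s.
    - right; split=> //; have [ff _] := brI.
      by have [_ [_ ->]] := function_dom _ _ _ _ _ ff hs.
  apply: finite_cup; first by apply: finite_insert; case: ct => _ [].
  case: (classic (exists k, ap br t = edge k b)) => [[k ek]|n].
    apply: (finite_subset _ (cup emp (sing k))); last by apply: finite_insert; exact: finite_emp.
    move=> z; rewrite in_cup in_sing in_sep; first by dfn.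
    by rewrite ek => -[_ /edge_inj [->]]; right.
  apply: finite_subset finite_emp => z; rewrite in_sep; first by dfn.
  by move=> [_ h2]; case: n; exists z.
have : succ t ∈ X by apply/inX; split=> //; exists m'; rewrite -eb.
have tt : t ∈ succ t by rewrite in_succ; right.
move=> /hmax [h'|/mem_asym //].
by move: tt; rewrite h' => /mem_irrefl.
Qed.

(** A turn is determined by the two ends of its edge. With countably many left ends, countably many
    right ends would leave only countably many turns below omega1. *)
Lemma built_uncountable : ~ Inj built W.
Proof.
move=> cb; apply: (omega1_uncountable _ ho).
apply: (ctbl_cover _ (fun m t => exists b, b ∈ built /\ ap mk t = edge m b)); first by dfn.
  by move=> t /move_edge [m [b [mW [bb e]]]]; exists m; split=> //; exists b.
move=> m mW; apply: Inj_trans cb.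
apply: (Inj_rel _ _ (fun t b => b ∈ built /\ ap mk t = edge m b)); first by dfn.
- by move=> t; rewrite in_sep; [dfn|move=> [_ [b []]]; exists b].
- by move=> t b b' _ [_ ->] [_ /edge_inj []].
- move=> t t' b; rewrite !in_sep; try by dfn.
  move=> [to _] [to' _] [_ e] [_ e']; apply: (time_eq _ _ (edge m b)).
    by rewrite -e; apply: move_at.
  by rewrite -e'; apply: move_at.
Qed.

Lemma maker_biclique k : is_pseudo_intersection_number k -> o ∈ k ->
  exists A B, subset A W /\ subset B o /\ infinite A /\ ~ Inj B W /\
    forall m b, m ∈ A -> b ∈ B -> exists t, opair t (edge m b) ∈ mk.
Proof.
move=> [_ pmin] ok.
have dN : DefTerm (fun E => Nt o (E 0)) by dfn.
have bo b : b ∈ built -> b ∈ o by rewrite in_built => -[].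
have sub : subset o o by [].
pose (F := repl built (Nt o)).
have inF x : x ∈ F <-> exists b, b ∈ built /\ x = Nt o b by rewrite in_repl.
have ch b c : b ∈ built -> c ∈ built ->
    finite (diff (Nt o b) (Nt o c)) \/ finite (diff (Nt o c) (Nt o b)).
  move=> hb hc; apply: chain => //; [exact: all_good|exact: bo|exact: bo| |];
    exact: built_infinite.
(* At most omega1 neighbourhoods are built, fewer than the pseudo-intersection number, so this
   family cannot witness it. *)
have [l [cl lo]] : exists l, has_cardinality F l /\ subset l o.
  have [c [co e]] := Inj_image _ _ (Inj_trans _ _ _ (Inj_repl built (Nt o) dN) (Inj_subset _ _ bo)).
  have [d [od [dc ed]]] := collapse o c oo co.
  have [l [[cl el] ld]] := cardinal_of_ordinal d od.
  exists l; split; last by move=> z /ld /dc.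
  by split=> //; apply: eqn_trans el; apply: eqn_trans ed.
have nw : ~ p_witness F.
  move=> /pmin /(_ cl) h'; have ol : Ord l by case: cl => -[]; rewrite is_ordinalE.
  by apply: (mem_irrefl o); apply: lo; case: h' => [<-|h'] //; apply: Ord_trans ol ok h'.
have FW x : x ∈ F -> subset x W by move=> /inF [b [_ ->]] m; rewrite in_nbrs => -[].
have fip : strong_fip F.
  move=> s i sF fs ne hi fi.
  have [|x [xs fx]] := chain_inter F _ s fs ne sF.
    by move=> x y /inF [b [hb ->]] /inF [c [hc ->]]; apply: ch.
  have /inF [b [hb e]] := sF _ xs; apply: (built_infinite _ hb); rewrite -e.
  apply: finite_subset (finite_cup _ _ fi fx) => z zx; rewrite in_cup in_sep; first by dfn.
  case: (classic (z ∈ i)) => zi; first by left.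
  right; split=> //; apply: NNPP => n; apply: zi; apply/hi => y ys.
  by apply: NNPP => zy; apply: n; exists y.
have [P [iP pP]] : exists P, infinite P /\ pseudo_intersection P F.
  apply: NNPP => n; apply: nw; split; last by split.
  by exists W; split=> //; exact: is_omega_W.
have pb b : b ∈ built -> finite (diff P (Nt o b)).
  by move=> hb; apply: (pP (Nt o b)); [apply/inF; exists b|rewrite is_diffE].
have [b0 hb0] : nonempty built.
  apply: NNPP => n; apply: built_uncountable; apply: Inj_subset => z zb.
  by case: n; exists z.
(* A pseudo-intersection need not consist of natural numbers. Its part in omega is still infinite,
   as only finitely many of its elements lie outside a given neighbourhood. *)
pose (Q := sep P (fun z => z ∈ W)).
have inQ z : z ∈ Q <-> z ∈ P /\ z ∈ W by rewrite in_sep; [dfn|].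
have iQ : infinite Q.
  move=> fQ; apply: iP; apply: finite_subset (finite_cup _ _ fQ (pb _ hb0)) => z zP.
  rewrite in_cup inQ in_diff; case: (classic (z ∈ W)) => zW; first by left.
  by right; split=> //; rewrite in_nbrs => -[].
(* Each [b] in [built] has some [n] beyond which [Q] lies in its neighbourhood; one [n] must serve
   uncountably many [b]. *)
pose (R := fun n b => subset (diff Q n) (Nt o b)).
have dR : Definable (fun E => R (E 0) (E 1)) by rewrite /R; dfn.
have [n [nW un]] : exists n, n ∈ W /\ ~ Inj (sep built (R n)) W.
  apply: NNPP => none; apply: built_uncountable; apply: (ctbl_cover _ R) => //.
    move=> b hb; have [||n [nW hn]] := W_bounded (diff Q (Nt o b)).
    - by apply: finite_subset (pb _ hb) => z; rewrite !in_diff inQ; tauto.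
    - by move=> z; rewrite in_diff inQ; tauto.
    exists n; split=> // z; rewrite in_diff => -[zQ zn]; apply: NNPP => zN; apply: zn.
    by apply: hn; rewrite in_diff.
  by move=> n nW; apply: NNPP => h'; apply: none; exists n.
have dRn : Definable (fun E => R n (E 0)) by dfn.
exists (diff Q n), (sep built (R n)); split; [|split; [|split; [|split]]] => //.
- by move=> z; rewrite in_diff inQ; tauto.
- by move=> b; rewrite in_sep // => -[/bo].
- move=> fd; apply: iQ; apply: finite_subset (finite_cup _ _ fd (finite_W _ nW)) => z zQ.
  by rewrite in_cup in_diff; case: (classic (z ∈ n)); tauto.
- move=> m b mA; rewrite in_sep // => -[_ /(_ _ mA)]; rewrite in_nbrs => -[_ [t [_ ht]]].
  by exists t.
Qed.

End Maker.

(** * Copies of the complete bipartite graph *)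

Section Copies.
Context {M : structure} {HZ : ZFC M}.
Local Notation emp := (@emp M HZ).
Local Notation W := (@W M HZ).
Local Notation edge := (@edge M HZ).
Local Notation vL := (@vL M HZ).
Local Notation vR := (@vR M HZ).
Implicit Types a b c d e f g h k m n p q r x y z w i j t s : M.

Lemma upair_LL a a' m b : upair (vL a) (vL a') <> edge m b.
Proof. by move=> /upair_eq [[_ h]|[h _]]; apply: vL_neq_vR h. Qed.

Lemma upair_RR a a' m b : upair (vR a) (vR a') <> edge m b.
Proof. by move=> /upair_eq [[h _]|[_ h]]; apply: vL_neq_vR (eq_sym h). Qed.

Lemma copy_of_biclique V Ed o EM A B : is_omega1 o -> bip_vertices V W o -> bip_edges Ed W o ->
  subset A W -> infinite A -> subset B o -> ~ Inj B W ->
  (forall a b, a ∈ A -> b ∈ B -> edge a b ∈ EM) -> contains_copy V EM V Ed.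
Proof.
move=> ho hV hE AW iA Bo uB hEM.
have [f1 [t1 [s1 j1]]] := eqnE _ _ (omega_subset _ AW iA).
have [f2 [t2 [s2 j2]]] := eqnE _ _ (omega1_subset _ _ ho Bo uB).
pose (V' := sep V (fun v => (exists a, a ∈ A /\ v = vL a) \/ (exists b, b ∈ B /\ v = vR b))).
(* Only the edges between [A] and [B] are kept, because an isomorphism must also reflect
   non-edges. *)
pose (E' := sep EM (fun e => exists a b, a ∈ A /\ b ∈ B /\ e = edge a b)).
have inV v : v ∈ V' <-> (exists a, a ∈ A /\ v = vL a) \/ (exists b, b ∈ B /\ v = vR b).
  rewrite in_sep; first by dfn.
  split=> [[]|h] //; split=> //; apply/hV.
  by case: h => -[x [hx ->]]; [left|right]; exists x; split=> //; [apply: AW|apply: Bo].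
have inE e : e ∈ E' <-> exists a b, a ∈ A /\ b ∈ B /\ e = edge a b.
  rewrite in_sep; first by dfn.
  by split=> [[]|h] //; split=> //; case: h => a [b [aA [bB ->]]]; apply: hEM.
pose (R := fun v w => (exists a, a ∈ A /\ v = vL a /\ w = vL (ap f1 a)) \/
                      (exists b, b ∈ B /\ v = vR b /\ w = vR (ap f2 b))).
have dR : Definable (fun E => R (E 0) (E 1)) by rewrite /R; dfn.
exists V', E'; split.
  split; [|split].
  - move=> e /inE [a [b [aA [bB ->]]]]; exists (vL a), (vR b).
    split; first by apply/inV; left; exists a.
    split; first by apply/inV; right; exists b.
    by split; [exact: vL_neq_vR|rewrite is_upairE].
  - by move=> v; rewrite in_sep; [dfn|case].
  - by move=> v; rewrite in_sep; [dfn|case].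
exists (graph V' V R); split.
  apply: graph_bijection => //.
  - move=> v /inV [[a [aA ->]]|[b [bB ->]]].
      exists (vL (ap f1 a)); split; last by left; exists a.
      by apply/hV; left; exists (ap f1 a); split=> //; apply: t1.
    exists (vR (ap f2 b)); split; last by right; exists b.
    by apply/hV; right; exists (ap f2 b); split=> //; apply: t2.
  - move=> w /hV [[m [/s1 [a [aA ->]] ->]]|[m [/s2 [b [bB ->]] ->]]].
      by exists (vL a); split; [apply/inV; left; exists a|left; exists a].
    by exists (vR b); split; [apply/inV; right; exists b|right; exists b].
  - move=> v w w' _ [[a [aA [-> ->]]]|[b [bB [-> ->]]]] [[a' [aA' [h ->]]]|[b' [bB' [h ->]]]].
    + by rewrite (vL_inj _ _ h).
    + by case: (vL_neq_vR _ _ h).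
    + by case: (vL_neq_vR _ _ (eq_sym h)).
    + by rewrite (vR_inj _ _ h).
  - move=> v v' w _ _ [[a [aA [-> ->]]]|[b [bB [-> ->]]]] [[a' [aA' [-> h]]]|[b' [bB' [-> h]]]].
    + by rewrite (j1 a a') //; apply: vL_inj h.
    + by case: (vL_neq_vR _ _ h).
    + by case: (vL_neq_vR _ _ (eq_sym h)).
    + by rewrite (j2 b b') //; apply: vR_inj h.
move=> x y x' y' e e'; rewrite !appE !in_graph // !is_upairE.
move=> [_ [_ hx]] [_ [_ hy]] -> ->; rewrite inE hE.
case: hx => [[a [aA [-> ->]]]|[a [aA [-> ->]]]]; case: hy => [[b [bB [-> ->]]]|[b [bB [-> ->]]]].
- by split; move=> [m [n [_ [_ h]]]]; case: (upair_LL _ _ _ _ h).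
- by split=> _; [exists (ap f1 a), (ap f2 b)|exists a, b]; split=> //; auto.
- rewrite (upairC (vR a)) (upairC (vR (ap f2 a))).
  by split=> _; [exists (ap f1 b), (ap f2 a)|exists b, a]; split=> //; auto.
- by split; move=> [m [n [_ [_ h]]]]; case: (upair_RR _ _ _ _ h).
Qed.

(** A copy might conceivably exchange the two sides of the board. Cardinality forbids it: the
    uncountable side does not fit into omega. *)
Lemma biclique_of_copy V Ed o EM : is_omega1 o -> bip_vertices V W o -> bip_edges Ed W o ->
  subset EM Ed -> contains_copy V EM V Ed -> exists A B, subset A W /\ infinite A /\
    subset B o /\ ~ Inj B W /\ forall a b, a ∈ A -> b ∈ B -> edge a b ∈ EM.
Proof.
move=> ho hV hE EME [V' [E' [[_ [V'V E'E]] [f [[[ff jf] sf] iso]]]]].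
have [_ [_ fun_f]] := ff; rewrite functionalE in fun_f.
have pre v : v ∈ V -> exists x, opair x v ∈ f by move=> /sf [x]; rewrite appE; exists x.
have preL m : m ∈ W -> exists x, opair x (vL m) ∈ f.
  by move=> mW; apply: pre; apply/hV; left; exists m.
have preR b : b ∈ o -> exists x, opair x (vR b) ∈ f.
  by move=> bo; apply: pre; apply/hV; right; exists b.
have jf' x x' y : opair x y ∈ f -> opair x' y ∈ f -> x = x'.
  by move=> h h'; apply: (jf _ _ y); rewrite appE.
have ed m b x y : m ∈ W -> b ∈ o -> opair x (vL m) ∈ f -> opair y (vR b) ∈ f -> upair x y ∈ EM.
  move=> mW bo hx hy; apply: E'E.
  apply (iso x y (vL m) (vR b) (upair x y) (edge m b)); rewrite ?appE ?is_upairE //.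
  by apply/hE; exists m, b.
have sides m b x y : m ∈ W -> b ∈ o -> opair x (vL m) ∈ f -> opair y (vR b) ∈ f ->
    exists a c, a ∈ W /\ c ∈ o /\ ((x = vL a /\ y = vR c) \/ (x = vR c /\ y = vL a)).
  move=> mW bo hx hy; have /EME /hE [a [c [aW [co h]]]] := ed _ _ _ _ mW bo hx hy.
  by exists a, c; split=> //; split=> //; apply: upair_eq.
(* If one vertex of the countable side came from the right, adjacency would force the whole
   uncountable side to come from the left, giving an injection of omega1 into omega. *)
have left_side m x : m ∈ W -> opair x (vL m) ∈ f -> exists a, a ∈ W /\ x = vL a.
  move=> mW hx; apply: NNPP => n; apply: (omega1_uncountable _ ho).
  apply: (Inj_rel _ _ (fun b a => opair (vL a) (vR b) ∈ f)); first by dfn.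
  - move=> b bo; have [y hy] := preR b bo.
    have [a [c [aW [co [[ex ey]|[ex ey]]]]]] := sides _ _ _ _ mW bo hx hy.
      by case: n; exists a.
    by exists a; rewrite -ey.
  - by move=> b a a' _ h h'; apply: vL_inj; apply: jf' h h'.
  - by move=> b b' a _ _ h h'; apply: vR_inj; apply: fun_f h h'.
have right_side b y : b ∈ o -> opair y (vR b) ∈ f -> exists c, c ∈ o /\ y = vR c.
  move=> bo hy; have [x hx] := preL _ W_emp.
  have [a [c [aW [co [[ex ey]|[ex ey]]]]]] := sides _ _ _ _ W_emp bo hx hy; first by exists c.
  have [a' [_ ex']] := left_side _ _ W_emp hx.
  by case: (vL_neq_vR a' c); rewrite -ex -ex'.
pose (A := sep W (fun a => exists m, m ∈ W /\ opair (vL a) (vL m) ∈ f)).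
pose (B := sep o (fun b => exists c, c ∈ o /\ opair (vR b) (vR c) ∈ f)).
have inA a : a ∈ A <-> a ∈ W /\ exists m, m ∈ W /\ opair (vL a) (vL m) ∈ f by rewrite in_sep; [dfn|].
have inB b : b ∈ B <-> b ∈ o /\ exists c, c ∈ o /\ opair (vR b) (vR c) ∈ f by rewrite in_sep; [dfn|].
exists A, B; split; [|split; [|split; [|split]]].
- by move=> a /inA [].
- move=> fA; apply: infinite_W; apply: finite_Inj fA.
  apply: (Inj_rel _ _ (fun m a => opair (vL a) (vL m) ∈ f)); first by dfn.
  + move=> m mW; have [x hx] := preL m mW; have [a [aW e]] := left_side _ _ mW hx.
    by exists a; rewrite -e; split=> //; apply/inA; split=> //; exists m; rewrite -e.
  + by move=> b a a' _ h h'; apply: vL_inj; apply: jf' h h'.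
  + by move=> b b' a _ _ h h'; apply: vL_inj; apply: fun_f h h'.
- by move=> b /inB [].
- move=> cB; apply: (omega1_uncountable _ ho); apply: Inj_trans cB.
  apply: (Inj_rel _ _ (fun c b => opair (vR b) (vR c) ∈ f)); first by dfn.
  + move=> m mW; have [x hx] := preR m mW; have [a [aW e]] := right_side _ _ mW hx.
    by exists a; rewrite -e; split=> //; apply/inB; split=> //; exists m; rewrite -e.
  + by move=> b a a' _ h h'; apply: vR_inj; apply: jf' h h'.
  + by move=> b b' a _ _ h h'; apply: vR_inj; apply: fun_f h h'.
- move=> a b /inA [_ [m [mW hm]]] /inB [_ [c [co hc]]].
  exact: ed mW co hm hc.
Qed.

End Copies.

Section MakerWins.
Context {M : structure} {HZ : ZFC M}.
Local Notation W := (@W M HZ).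

Lemma maker_wins : omega1_lt_p M -> maker_wins_MB_K_omega_omega1 M.
Proof.
move=> [o [k [ho [hk ok]]]].
have [h hh] := countable_codes o ho.
have [V [Ed bip]] := bipartite_exists W o.
have /is_complete_bipartiteP [hV hE] := bip.
exists W, o, V, Ed; split; first exact: is_omega_W.
do 2 split=> //.
have [f [sf hf]] := maker_strategy_exists Ed (maker_good o h) (D_maker_good o h).
exists f; split=> // mk br /complete_playP [T [S pl]] fol.
have good t tT := hf mk br T S t pl fol tT.
have [A [B [AW [Bo [iA [uB hAB]]]]]] :=
  maker_biclique o h Ed mk br T S ho hh hE pl good k hk ok.
exists (sep Ed (fun e => exists t, app mk t e)); split.
  move=> e; rewrite in_sep; first by dfn.
  split=> [[]|[t ht]] //; split; last by exists t.
  have [+ _] := pl; rewrite position_of_lengthsE => -[_ [_ [[ff _] _]]].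
  by move: ht; rewrite appE => /(function_dom _ _ _ _ _ ff) [_ []].
apply: (copy_of_biclique V Ed o _ A B) => // a b aA bB; rewrite in_sep; first by dfn.
split; first by apply/hE; exists a, b; split; [exact: AW|split=> //; exact: Bo].
by have [t ht] := hAB _ _ aA bB; exists t; rewrite appE.
Qed.

End MakerWins.

(** * Breaker's strategy *)

Section Breaker.
Context {M : structure} {HZ : ZFC M}.
Local Notation emp := (@emp M HZ).
Local Notation W := (@W M HZ).
Local Notation edge := (@edge M HZ).
Implicit Types a b c d e f g k m n p r x y z w i j t s : M.

(* [ap q a] is the [a]-th subset of omega in an enumeration of length omega1. *)
Definition hit q br b a : Prop := exists m s, m ∈ ap q a /\ opair s (edge m b) ∈ br.
(** The second alternative frees Breaker from a set with no unclaimed edge left at [b], so that the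
    unsettled sets are those in which he can still answer. *)
Definition settled q mk br b a : Prop := hit q br b a \/
  ~ exists m, m ∈ W /\ m ∈ ap q a /\ ~ claimed mk br (edge m b).

(** A position does not name the turn in progress: it is recovered as a turn [t] in which Maker has
    moved and Breaker has not. Breaker answers at the same [b], inside the unsettled set of least
    code. *)
Definition breaker_good q h mk br e : Prop := exists t m0 b m a,
  opair t (edge m0 b) ∈ mk /\ ~ (exists e', opair t e' ∈ br) /\
  e = edge m b /\ a ∈ b /\ m ∈ ap q a /\ ~ settled q mk br b a /\
  forall c, c ∈ b -> ap (ap h b) c ∈ ap (ap h b) a -> settled q mk br b c.

Lemma D_settled (t s u v w : (nat -> M) -> M) : DefTerm t -> DefTerm s -> DefTerm u -> DefTerm v ->
  DefTerm w -> Definable (fun E => settled (t E) (s E) (u E) (v E) (w E)).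
Proof. by move=> dt ds du dv dw; rewrite /settled /hit; dfn. Qed.
#[local] Hint Extern 0 (Definable (fun _ => settled _ _ _ _ _)) => apply D_settled; dfn : dfn.

Lemma D_breaker_good q h : Definable (fun E => breaker_good q h (E 0) (E 1) (E 2)).
Proof. by rewrite /breaker_good; dfn. Qed.

Lemma settled_mono q mk br x y x' y' b a : subset x x' -> subset y y' ->
  settled q (restr mk x) (restr br y) b a -> settled q (restr mk x') (restr br y') b a.
Proof.
move=> xx yy [[m [s [ma hs]]]|n]; [left; move: hs|right].
  by rewrite in_restr_opair => -[? ?]; exists m, s; rewrite in_restr_opair; split=> //; split=> //; apply: yy.
move=> [m [mW [ma cl]]]; apply: n; exists m; do 2 split=> //.
move=> h; apply: cl; apply/claimed_restr.
by move/claimed_restr: h => [[s [hs ?]]|[s [hs ?]]];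
  [left|right]; exists s; split=> //; [exact: xx|exact: yy].
Qed.

Context (o q h Ed mk br T S : M) (ho : is_omega1 o)
  (hh : forall b, b ∈ o -> is_injection (ap h b) b W) (hE : bip_edges Ed W o)
  (hq : forall a, a ∈ o -> subset (ap q a) W)
  (pl : play Ed mk br T S)
  (good : forall t, t ∈ S ->
     good_move Ed (breaker_good q h) (restr mk (succ t)) (restr br t) (ap br t)).

(** The situation to be refuted: Maker owns every edge between an infinite enumerated set and a
    later vertex [b]. *)
Context (b a : M) (bo : b ∈ o) (ab : a ∈ b) (infa : infinite (ap q a))
  (all_maker : forall m, m ∈ ap q a -> exists t, opair t (edge m b) ∈ mk).

Local Notation code := (ap (ap h b)).
Local Notation Nt := (fun t => nbrs (restr mk t) b).

Let oo : Ord o := omega1_Ord _ ho.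
Let posT : Ord T. Proof. by have [+ _] := pl; rewrite position_of_lengthsE => -[]. Qed.
Let mkI : is_injection mk T Ed.
Proof. by have [+ _] := pl; rewrite position_of_lengthsE => -[_ [_ []]]. Qed.
Let brI : is_injection br S Ed.
Proof. by have [+ _] := pl; rewrite position_of_lengthsE => -[_ [_ [_ []]]]. Qed.
Let dis e x y : opair x e ∈ mk -> opair y e ∈ br -> False.
Proof. by have [+ _] := pl; rewrite position_of_lengthsE => -[_ [_ [_ [_ d]]]]; apply: d. Qed.

(** Wait for Maker's next move at [b], which must come since he will own infinitely many edges there
    and has finitely many at [s]. All sets with smaller codes are settled, so Breaker's answer takes
    care of [c], unless it was settled already. *)
Lemma next_response s c : Ord s -> subset s T -> finite (Nt s) -> c ∈ b ->
  (forall d, d ∈ b -> code d ∈ code c -> settled q (restr mk s) (restr br s) b d) ->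
  exists t, Ord t /\ subset s t /\ subset t T /\ finite (Nt t) /\
    settled q (restr mk t) (restr br t) b c.
Proof.
move=> os sT fs cb hs.
have aW : subset (ap q a) W by apply: hq; apply: Ord_trans oo ab bo.
have [fm _] := mkI; have [fbr _] := brI.
have [t [ot [[tT [ns [m [mW ht]]]] min]]] : exists t, Ord t /\
    (t ∈ T /\ ~ t ∈ s /\ exists m, m ∈ W /\ opair t (edge m b) ∈ mk) /\
    forall x, x ∈ t -> ~ (x ∈ T /\ ~ x ∈ s /\ exists m, m ∈ W /\ opair x (edge m b) ∈ mk).
  have [m [ma nm]] := infinite_diff _ _ infa fs; have [t ht] := all_maker _ ma.
  have [tT _] := function_dom _ _ _ _ _ fm ht.
  have [||t' [ot [ht' [_ min]]]] := least_ordinal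
    (fun t => t ∈ T /\ ~ t ∈ s /\ exists m, m ∈ W /\ opair t (edge m b) ∈ mk) t _ (Ord_mem _ _ posT tT).
  - by dfn.
  - split=> //; split; last by exists m; split=> //; apply: aW.
    by move=> ts; apply: nm; rewrite in_nbrs; split; [exact: aW|exists t].
  - by exists t'.
have st : subset s t by apply/Ord_notin.
have st' : subset s (succ t) by move=> x /st; rewrite in_succ; left.
have tT' : subset (succ t) T.
  by move=> x; rewrite in_succ => -[xt|->] //; apply: Ord_trans posT xt tT.
exists (succ t); split; first exact: Ord_succ.
do 2 split=> //; split.
  (* By minimality of [t], the only neighbour gained since [s] is [m]. *)
  apply: finite_subset (finite_insert _ m fs) => z; rewrite in_cup in_sing !in_nbrs.
  move=> [zW [x []]]; rewrite in_succ => -[xt|->] hx.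
    left; split=> //; exists x; split=> //; apply: NNPP => xs; apply: (min x xt).
    by split; [apply: Ord_trans posT xt tT|split=> //; exists z].
  right; have [_ [_ e]] := function_dom _ _ _ _ _ fm hx.
  have [_ [_ e']] := function_dom _ _ _ _ _ fm ht.
  by have /edge_inj [] : edge z b = edge m b by rewrite e e'.
apply: NNPP => uns.
have uns' : ~ settled q (restr mk (succ t)) (restr br t) b c.
  move=> h'; apply: uns; apply: settled_mono h' => // x.
  by rewrite in_succ; left.
have [m' [mW' [mc' ncl]]] : exists m', m' ∈ W /\ m' ∈ ap q c /\
    ~ claimed (restr mk (succ t)) (restr br t) (edge m' b).
  by apply: NNPP => n; apply: uns'; right.
have eE : edge m' b ∈ Ed by apply/hE; exists m', b.
(* Breaker does answer in turn [t]: otherwise it is the final half turn, after which every edge is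
   claimed, including [edge m' b]. *)
have tS : t ∈ S.
  have [_ [[e|e] cl]] := pl; first by rewrite -e.
  move: (tT); rewrite e in_succ => -[//|et]; case: ncl; apply/claimed_restr; rewrite et -e.
  move: (cl _ eE); rewrite claimedE => -[[x hx]|[x hx]]; [left|right]; exists x; split=> //.
    by case: (function_dom _ _ _ _ _ fm hx).
  by case: (function_dom _ _ _ _ _ fbr hx).
(* The edge from [m'] is a preferred answer, so the answer actually given is preferred as well; it
   remains to identify its data. *)
have [_ [_ ]] := good t tS; case.
  exists (edge m' b); do 2 split=> //; exists t, m, b, m', c.
  split; first by rewrite in_restr_opair in_succ; split=> //; right.
  split; first by move=> [e']; rewrite in_restr_opair => -[_ /mem_irrefl].
  do 4 split=> //; move=> d db /(hs d db); apply: settled_mono => //.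
move=> t1 [m1 [b1 [m2 [c1 [h1 [h2 [h3 [h4 [h5 [h6 h7]]]]]]]]]].
have [_ hbr] := function_ap _ _ _ _ fbr tS.
(* Breaker has already answered every turn before [t], so [t] is the only turn that can be in
   progress. *)
have et : t1 = t.
  move: h1; rewrite in_restr_opair in_succ => -[_ [t1t|//]]; case: h2.
  exists (ap br t1); rewrite in_restr_opair; split=> //.
  have t1S : t1 ∈ S.
    have [+ _] := pl; rewrite position_of_lengthsE => -[_ [oS _]].
    exact: Ord_trans oS t1t tS.
  by case: (function_ap _ _ _ _ fbr t1S).
have eb : b1 = b.
  move: h1; rewrite et in_restr_opair => -[h1 _].
  have [_ [_ e]] := function_dom _ _ _ _ _ fm h1.
  have [_ [_ e']] := function_dom _ _ _ _ _ fm ht.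
  by have /edge_inj [] : edge m1 b1 = edge m b by rewrite e e'.
subst b1; have /is_injectionP [fc jc] := hh _ bo.
have [cW _] := function_ap _ _ _ _ fc cb; have [c1W _] := function_ap _ _ _ _ fc h4.
(* A smaller code belongs to a set already settled, an equal code means that [c] has just been hit,
   and a larger code contradicts the choice of the least unsettled one. *)
have [h8|[h8|h8]] := Ord_total _ _ (Ord_mem _ _ Ord_W c1W) (Ord_mem _ _ Ord_W cW).
- by apply: h6; apply: settled_mono (hs _ h4 h8).
- apply: uns; left; exists m2, t; rewrite -(jc _ _ h4 cb h8); split=> //.
  by rewrite in_restr_opair -h3 in_succ; split=> //; right.
- by apply: uns'; apply: h7.
Qed.

Lemma settle_all j : j ∈ W -> exists s, Ord s /\ subset s T /\ finite (Nt s) /\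
  forall c, c ∈ b -> code c ∈ j -> settled q (restr mk s) (restr br s) b c.
Proof.
apply: (W_ind (fun j => exists s, Ord s /\ subset s T /\ finite (Nt s) /\
  forall c, c ∈ b -> code c ∈ j -> settled q (restr mk s) (restr br s) b c)) j.
- by dfn.
- exists emp; split; first exact: Ord_emp.
  split; first by move=> x; rewrite in_emp.
  split; last by move=> c _; rewrite in_emp.
  by apply: finite_subset finite_emp => z; rewrite in_nbrs => -[_ [s []]]; rewrite in_emp.
move=> j jW [s [os [sT [fs hs]]]].
have /is_injectionP [fc jc] := hh _ bo.
(* The codes need not exhaust omega; a number that is not a code requires no waiting. *)
case: (classic (exists c, c ∈ b /\ code c = j)) => [[c [cb ec]]|n].
  have [|t [ot [st [tT [ft h']]]]] := next_response s c os sT fs cb.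
    by move=> d db; rewrite ec; apply: hs.
  exists t; do 3 split=> //; move=> d db; rewrite in_succ => -[dj|e].
    by apply: settled_mono (hs d db dj).
  by rewrite (jc d c) // ec.
exists s; do 3 split=> //; move=> d db; rewrite in_succ => -[dj|e]; first exact: hs.
by case: n; exists d.
Qed.

(** Consider a stage at which [a] is settled and Maker has finitely many edges at [b]. A hit would
    give Breaker an edge that Maker owns, and otherwise the infinite [ap q a] still has an unclaimed
    edge to [b]. *)
Lemma breaker_prevents : False.
Proof.
have /is_injectionP [fc _] := hh _ bo; have [cW _] := function_ap _ _ _ _ fc ab.
have [s [os [sT [fs hs]]]] := settle_all _ (W_succ _ cW).
have [[m [t [ma]]]|n] : settled q (restr mk s) (restr br s) b a.
- by apply: hs => //; rewrite in_succ; right.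
- by rewrite in_restr_opair => -[ht _]; have [t' ht'] := all_maker _ ma; apply: dis ht' ht.
have [m [ma nm]] := infinite_diff _ _ infa fs; apply: n.
have mW : m ∈ W by apply: hq ma; apply: Ord_trans oo ab bo.
exists m; do 2 split=> //; move=> /claimed_restr [[x hx]|[x [xs hx]]].
  by apply: nm; rewrite in_nbrs; split=> //; exists x.
by have [t' ht'] := all_maker _ ma; apply: dis ht' hx.
Qed.

End Breaker.

Section BreakerWins.
Context {M : structure} {HZ : ZFC M}.
Local Notation W := (@W M HZ).

Lemma breaker_wins : GCH M -> breaker_wins_MB_K_omega_omega1 M.
Proof.
move=> gch; have [o ho] := @omega1_exists M HZ.
have [h hh] := countable_codes o ho.
have [V [Ed bip]] := bipartite_exists W o.
have /is_complete_bipartiteP [hV hE] := bip.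
(* GCH at omega gives an enumeration of all subsets of omega in type omega1. *)
have /eqn_sym /eqnE [q [tq [sq _]]] : equinumerous (pow W) o.
  apply: (gch W W) => //.
  - exact: is_omega_W.
  - exact: is_cardinal_W.
  - by move: ho; rewrite is_omega1E.
  - by move=> z; rewrite in_pow.
exists W, o, V, Ed; split; first exact: is_omega_W.
do 2 split=> //.
have [f [sf hf]] := breaker_strategy_exists Ed (breaker_good q h) (D_breaker_good q h).
exists f; split=> // mk br /complete_playP [T [S pl]] fol [EM [hEM cp]].
have EME : subset EM Ed.
  move=> e /hEM [t]; have [+ _] := pl; rewrite position_of_lengthsE => -[_ [_ [[ff _] _]]].
  by rewrite appE => /(function_dom _ _ _ _ _ ff) [_ []].
have [A [B [AW [iA [Bo [uB hAB]]]]]] := biclique_of_copy V Ed o EM ho hV hE EME cp.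
have [a [ao eA]] : exists a, a ∈ o /\ A = ap q a by apply: sq; rewrite in_pow.
have oo : Ord o by exact: omega1_Ord.
(* The uncountable [B] is not contained in the countable [succ a], so some member lies above [a]. *)
have [b [bB ab]] : exists b, b ∈ B /\ a ∈ b.
  apply: NNPP => n; apply: uB; apply: (Inj_trans (succ a)); last first.
    by apply: ctbl_succ; apply: omega1_countable ao.
  apply: Inj_subset => b bB; rewrite in_succ.
  have [|[|h']] := Ord_total _ _ (Ord_mem _ _ oo (Bo _ bB)) (Ord_mem _ _ oo ao); [tauto|tauto|].
  by case: n; exists b.
apply: (breaker_prevents o q h Ed mk br T S ho hh hE _ pl _ b a (Bo _ bB) ab).
- by move=> c /tq; rewrite in_pow.
- by move=> t; apply: (hf mk br T S t pl fol).
- by rewrite -eA.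
- move=> m; rewrite -eA => mA; have /hEM [t] := hAB _ _ mA bB.
  by rewrite appE => ?; exists t.
Qed.

End BreakerWins.

(** * Playing two strategies against each other *)

Section Versus.
Context {M : structure} {HZ : ZFC M}.
Implicit Types a b c d e f g h k m n p q r u x y z w i j t s : M.

Definition pr1 p : M := Un (sep (Un p) (fun x => exists y, p = opair x y)).
Definition pr2 p : M := Un (sep (Un p) (fun y => exists x, p = opair x y)).

Lemma DT_pr1 (t : (nat -> M) -> M) : DefTerm t -> DefTerm (fun E => pr1 (t E)).
Proof. by move=> dt; rewrite /pr1; dfn. Qed.
Lemma DT_pr2 (t : (nat -> M) -> M) : DefTerm t -> DefTerm (fun E => pr2 (t E)).
Proof. by move=> dt; rewrite /pr2; dfn. Qed.
#[local] Hint Extern 0 (DefTerm (fun _ => pr1 _)) => apply DT_pr1; dfn : dfn.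
#[local] Hint Extern 0 (DefTerm (fun _ => pr2 _)) => apply DT_pr2; dfn : dfn.

Lemma pr1_opair x y : pr1 (opair x y) = x.
Proof.
apply: set_ext => z; rewrite in_Un; split.
  move=> [w []]; rewrite in_sep; first by dfn.
  by move=> [_ [y' /opair_eq [-> _]]].
move=> zx; exists x; rewrite in_sep; first by dfn.
split=> //; split; last by exists y.
by rewrite in_Un; exists (sing x); rewrite in_sing in_upair; split=> //; left.
Qed.

Lemma pr2_opair x y : pr2 (opair x y) = y.
Proof.
apply: set_ext => z; rewrite in_Un; split.
  move=> [w []]; rewrite in_sep; first by dfn.
  by move=> [_ [x' /opair_eq [_ ->]]].
move=> zx; exists y; rewrite in_sep; first by dfn.
split=> //; split; last by exists x.
by rewrite in_Un; exists (upair x y); rewrite !in_upair; split; right.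
Qed.

Context (Ed f g : M) (mf : maker_strategy Ed f) (bg : breaker_strategy Ed g).

(** The history [u] maps each earlier turn to the pair of edges claimed in it. Its domain
    [repl u pr1] is the current turn, and Breaker's strategy sees the history extended by Maker's
    new edge. *)
Let round u : M :=
  let mk := lam (repl u pr1) (fun x => pr1 (ap u x)) in
  let br := lam (repl u pr1) (fun x => pr2 (ap u x)) in
  let e := ap f (opair mk br) in
  opair e (ap g (opair (cup mk (sing (opair (repl u pr1) e))) br)).

(** The recursion continues past the end of the game, where the values are meaningless; legality is
    established separately up to the first ended turn. *)
Lemma rounds c : Ord c -> exists h, forall t, t ∈ c ->
  let mk := lam t (fun x => pr1 (ap h x)) in
  let br := lam t (fun x => pr2 (ap h x)) in
  pr1 (ap h t) = ap f (opair mk br) /\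
  pr2 (ap h t) = ap g (opair (lam (succ t) (fun x => pr1 (ap h x))) br).
Proof.
move=> oc; have [|h [hh hd]] := recursion round _ c oc.
  by rewrite /round /lam; dfn.
have d1 : DefTerm (fun E => pr1 (ap h (E 0))) by dfn.
have d2 : DefTerm (fun E => pr2 (ap h (E 0))) by dfn.
exists h => t tc /=.
have fh : functional h.
  rewrite functionalE => x y y' /hd [v [_ /opair_eq [-> ->]]].
  by move=> /hd [w [_ /opair_eq [-> ->]]].
have sub x : x ∈ t -> x ∈ c by move=> xt; apply: Ord_trans oc xt tc.
have ed : repl (restr h t) pr1 = t.
  apply: set_ext => x; rewrite in_repl; first by dfn.
  split; first by move=> [p [+ ->]]; rewrite in_restr => -[_ [v [w [vt ->]]]]; rewrite pr1_opair.
  move=> xt; exists (opair x (ap h x)); rewrite pr1_opair; split=> //.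
  by rewrite in_restr_opair; split=> //; apply/hd; exists x; split=> //; apply: sub.
have ea x : x ∈ t -> ap (restr h t) x = ap h x.
  move=> xt; apply: ap_eq.
    rewrite functionalE => v y y'; rewrite !in_restr_opair => -[h1 _] [h2 _].
    by rewrite functionalE in fh; apply: fh h1 h2.
  by rewrite in_restr_opair; split=> //; apply/hd; exists x; split=> //; apply: sub.
have eL : lam t (fun x => pr1 (ap (restr h t) x)) = lam t (fun x => pr1 (ap h x)).
  apply: set_ext => p; rewrite !in_lam; try by dfn.
  by split; move=> [x [xt ->]]; exists x; split=> //; rewrite ea.
have eR : lam t (fun x => pr2 (ap (restr h t) x)) = lam t (fun x => pr2 (ap h x)).
  apply: set_ext => p; rewrite !in_lam; try by dfn.
  by split; move=> [x [xt ->]]; exists x; split=> //; rewrite ea.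
have := hh t tc; rewrite /round ed eL eR => er.
have e1 : pr1 (ap h t) =
    ap f (opair (lam t (fun x => pr1 (ap h x))) (lam t (fun x => pr2 (ap h x)))).
  by rewrite er pr1_opair.
split=> //; rewrite er pr2_opair -e1; congr (ap g (opair _ _)).
apply: set_ext => p; rewrite in_cup in_sing !in_lam //; split.
  move=> [[x [xt ->]]|->]; [exists x|exists t]; rewrite in_succ; split=> //; [left|right] => //.
move=> [x []]; rewrite in_succ => -[xt ->|-> ->]; [left|right] => //.
by exists x.
Qed.

End Versus.

(** * The recursive run is a complete play following both strategies *)

Section Versus2.
Context {M : structure} {HZ : ZFC M}.
Implicit Types a b c d e h k m n p q r u x y z w i j t s : M.
Context (Ed f g : M) (mf : maker_strategy Ed f) (bg : breaker_strategy Ed g).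
(** With [c] a Hartogs ordinal of the board, there are too many turns for the game to be still going
    on throughout [c]. *)
Context (c : M) (oc : Ord c) (nc : ~ Inj c Ed).
Context (A B : M -> M) (dA : DefTerm (fun E => A (E 0))) (dB : DefTerm (fun E => B (E 0)))
  (hA : forall t, t ∈ c -> A t = ap f (opair (lam t A) (lam t B)))
  (hB : forall t, t ∈ c -> B t = ap g (opair (lam (succ t) A) (lam t B))).

Lemma DT_lam (t : (nat -> M) -> M) (F : M -> M) : DefTerm (fun E => F (E 0)) -> DefTerm t ->
  DefTerm (fun E => lam (t E) F).
Proof. by move=> dF dt; rewrite /lam; dfn. Qed.
#[local] Hint Extern 0 (DefTerm (fun _ => lam _ _)) => apply DT_lam; dfn : dfn.

Lemma D_unfinished (t s u : (nat -> M) -> M) : DefTerm t -> DefTerm s -> DefTerm u ->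
  Definable (fun E => unfinished (t E) (s E) (u E)).
Proof. by move=> dt ds du; rewrite /unfinished; dfn. Qed.
#[local] Hint Extern 0 (Definable (fun _ => unfinished _ _ _)) => apply D_unfinished; dfn : dfn.

Lemma in_lam_opair t (F : M -> M) x y : DefTerm (fun E => F (E 0)) ->
  opair x y ∈ lam t F <-> x ∈ t /\ y = F x.
Proof.
move=> dF; rewrite in_lam //; split; first by move=> [v [vt /opair_eq [-> ->]]].
by move=> [xt ->]; exists x.
Qed.

Lemma claimed_lam t s e : claimed (lam t A) (lam s B) e <->
  (exists x, x ∈ t /\ e = A x) \/ (exists x, x ∈ s /\ e = B x).
Proof.
by rewrite claimedE; split; (move=> [[x hx]|[x hx]]; [left|right]; exists x; move: hx);
  rewrite in_lam_opair.
Qed.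

Lemma restr_lam t s (F : M -> M) : DefTerm (fun E => F (E 0)) -> subset s t ->
  restr (lam t F) s = lam s F.
Proof.
move=> dF st; apply: set_ext => p; rewrite in_restr !in_lam //; split.
  by move=> [[x [xt ->]] [y [z [ys /opair_eq [e _]]]]]; exists x; rewrite e.
by move=> [x [xs ->]]; split; [exists x; split=> //; apply: st|exists x, (F x)].
Qed.

Lemma lam_injection t (F : M -> M) : DefTerm (fun E => F (E 0)) -> (forall x, x ∈ t -> F x ∈ Ed) ->
  (forall x x', x ∈ t -> x' ∈ t -> F x = F x' -> x = x') -> is_injection (lam t F) t Ed.
Proof.
move=> dF tF jF; split.
  split; [|split].
  - move=> p; rewrite in_lam // => -[x [xt ->]]; exists x, (F x); rewrite is_opairE.
    by split=> //; split=> //; apply: tF.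
  - by move=> x xt; exists (F x); rewrite appE in_lam_opair.
  - by rewrite functionalE => x y y'; rewrite !in_lam_opair // => -[_ ->] [_ ->].
by move=> x x' y; rewrite !appE !in_lam_opair // => -[xt ->] [xt' e]; apply: jF.
Qed.

Definition maker_ok t : Prop := A t ∈ Ed /\ ~ claimed (lam t A) (lam t B) (A t).
Definition breaker_ok t : Prop := B t ∈ Ed /\ ~ claimed (lam (succ t) A) (lam t B) (B t).

Lemma position_lam a b : Ord a -> Ord b -> subset b a -> (forall t, t ∈ a -> maker_ok t) ->
  (forall t, t ∈ b -> breaker_ok t) -> position_of_lengths Ed (lam a A) (lam b B) a b.
Proof.
move=> oa ob ba okA okB; rewrite position_of_lengthsE.
have Aneq x y : x ∈ a -> y ∈ a -> x ∈ y -> A x <> A y.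
  move=> xa ya xy e; case: (okA y ya) => _; apply; apply/claimed_lam; left; by exists x.
have Bneq x y : x ∈ b -> y ∈ b -> x ∈ y -> B x <> B y.
  move=> xa ya xy e; case: (okB y ya) => _; apply; apply/claimed_lam; right; by exists x.
do 2 split=> //; split; [|split].
- apply: lam_injection => //; first by move=> x /okA [].
  move=> x y xa ya e.
  have [h|[//|h]] := Ord_total _ _ (Ord_mem _ _ oa xa) (Ord_mem _ _ oa ya).
    by case: (Aneq x y).
  by case: (Aneq y x).
- apply: lam_injection => //; first by move=> x /okB [].
  move=> x y xa ya e.
  have [h|[//|h]] := Ord_total _ _ (Ord_mem _ _ ob xa) (Ord_mem _ _ ob ya).
    by case: (Bneq x y).
  by case: (Bneq y x).
- move=> e x y; rewrite !in_lam_opair // => -[xa ->] [yb e'].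
  have ya := ba _ yb.
  have [h|[h|h]] := Ord_total _ _ (Ord_mem _ _ oa xa) (Ord_mem _ _ oa ya).
  + case: (okB y yb) => _; apply; apply/claimed_lam; left.
    by exists x; rewrite in_succ; split=> //; left.
  + case: (okB y yb) => _; apply; apply/claimed_lam; left.
    by exists x; rewrite in_succ; split=> //; right.
  + by case: (okA x xa) => _; apply; apply/claimed_lam; right; exists y.
Qed.

Definition ended t : Prop :=
  ~ unfinished Ed (lam t A) (lam t B) \/ ~ unfinished Ed (lam (succ t) A) (lam t B).

Lemma maker_reply t : t ∈ c -> (forall s, s ∈ t -> maker_ok s /\ breaker_ok s) ->
  unfinished Ed (lam t A) (lam t B) ->
  maker_ok t /\ app f (opair (lam t A) (lam t B)) (A t).
Proof.
move=> tc ok un; have [ff /(_ (lam t A) (lam t B) (opair (lam t A) (lam t B)))] := mf.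
have ot := Ord_mem _ _ oc tc; case.
- by split=> //; exists t; apply: position_lam => //; move=> s /ok [].
- by rewrite is_opairE.
move=> e [he [eE ne]].
have et : A t = e by rewrite hA //; apply: ap_eq => //; rewrite -appE.
by rewrite /maker_ok et.
Qed.

Lemma breaker_reply t : t ∈ c -> (forall s, s ∈ t -> maker_ok s /\ breaker_ok s) ->
  maker_ok t -> unfinished Ed (lam (succ t) A) (lam t B) ->
  breaker_ok t /\ app g (opair (lam (succ t) A) (lam t B)) (B t).
Proof.
move=> tc ok okt un.
have [ff /(_ (lam (succ t) A) (lam t B) (opair (lam (succ t) A) (lam t B)))] := bg.
have ot := Ord_mem _ _ oc tc; case.
- split=> //; exists (succ t), t; rewrite is_succE; split=> //.
  apply: position_lam => //; first exact: Ord_succ.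
  + by move=> s; rewrite in_succ; left.
  + by move=> s; rewrite in_succ => -[/ok []|->].
  + by move=> s /ok [].
- by rewrite is_opairE.
move=> e [he [eE ne]].
have et : B t = e by rewrite hB //; apply: ap_eq => //; rewrite -appE.
by rewrite /breaker_ok et.
Qed.

(** By induction on the turn: legal earlier moves form a position, and in an unfinished position a
    strategy returns a legal move. *)
Lemma going_on t : t ∈ c -> (forall s, s ∈ t -> ~ ended s) ->
  forall s, s ∈ t -> maker_ok s /\ breaker_ok s.
Proof.
move=> tc ne s st; have ot := Ord_mem _ _ oc tc; have os := Ord_mem _ _ ot st.
move: (st); move: s os {st}; apply: Ord_ind; first by rewrite /maker_ok /breaker_ok; dfn.
move=> s os IH st; have sc : s ∈ c by apply: Ord_trans oc st tc.
have ok r : r ∈ s -> maker_ok r /\ breaker_ok r.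
  by move=> rs; apply: IH => //; apply: Ord_trans ot rs st.
have [u1 u2] : unfinished Ed (lam s A) (lam s B) /\ unfinished Ed (lam (succ s) A) (lam s B).
  by split; apply: NNPP => n; apply: (ne s st); [left|right].
have [okm _] := maker_reply s sc ok u1.
by have [okb _] := breaker_reply s sc ok okm u2.
Qed.

Lemma follow_both a b : Ord a -> Ord b -> subset a (succ b) -> subset b a -> subset a c ->
  (forall t, t ∈ b -> ~ ended t) -> (forall t, t ∈ a -> unfinished Ed (lam t A) (lam t B)) ->
  maker_follows f (lam a A) (lam b B) /\ breaker_follows g (lam a A) (lam b B).
Proof.
move=> oa ob ab ba ac ne un.
have sub x y : Ord y -> x ∈ y -> subset x y by move=> oy xy z zx; apply: Ord_trans oy zx xy.
have tb t : t ∈ a -> subset t b.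
  move=> /ab; rewrite in_succ => -[h|->] //; exact: sub.
have ok t : t ∈ a -> forall s, s ∈ t -> maker_ok s /\ breaker_ok s.
  move=> ta; apply: going_on; first exact: ac.
  by move=> s st; apply: ne; apply: tb st.
split.
- move=> t e mk' br' p; rewrite appE in_lam_opair // !is_restrictionE is_opairE.
  move=> [ta ->] -> -> ->; rewrite !restr_lam //; [exact: sub|exact: tb|].
  by have [] := maker_reply t (ac _ ta) (ok t ta) (un t ta).
- move=> t t' e mk' br' p; rewrite appE in_lam_opair // !is_restrictionE is_opairE is_succE.
  move=> [hb ->] -> -> -> ->; have ta := ba _ hb.
  rewrite !restr_lam //; [by move=> s; rewrite in_succ => -[/(sub _ _ oa ta)|->]|exact: sub|].
  have [okm _] := maker_reply t (ac _ ta) (ok t ta) (un t ta).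
  have u2 : unfinished Ed (lam (succ t) A) (lam t B).
    by apply: NNPP => n; apply: (ne t hb); right.
  by have [] := breaker_reply t (ac _ ta) (ok t ta) okm u2.
Qed.

(** If no turn in [c] were ended, Maker's legal and hence distinct moves would inject [c] into the
    board. The play is cut at the first ended turn. *)
Lemma versus_play : exists mk br, complete_play Ed mk br /\ maker_follows f mk br /\
  breaker_follows g mk br.
Proof.
have [t [ot [[tc et] min]]] : exists t, Ord t /\ (t ∈ c /\ ended t) /\ forall s, s ∈ t -> ~ ended s.
  have [t0 [tc0 et0]] : exists t, t ∈ c /\ ended t.
    apply: NNPP => n; apply: nc.
    have ok s : s ∈ c -> maker_ok s.
      move=> sc; have ne r : r ∈ c -> ~ ended r by move=> rc er; apply: n; exists r.
      have okr := going_on s sc (fun r rs => ne r (Ord_trans _ _ _ oc rs sc)).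
      have un : unfinished Ed (lam s A) (lam s B).
        by apply: NNPP => nu; apply: (ne s sc); left.
      by case: (maker_reply s sc okr un).
    have Aneq x y : x ∈ c -> y ∈ c -> x ∈ y -> A x <> A y.
      move=> xa ya xy e; case: (ok y ya) => _; apply; apply/claimed_lam; left; by exists x.
    apply: (Inj_fun _ _ A) => //; first by move=> x /ok [].
    move=> x y xa ya e.
    have [h|[//|h]] := Ord_total _ _ (Ord_mem _ _ oc xa) (Ord_mem _ _ oc ya).
      by case: (Aneq x y).
    by case: (Aneq y x).
  have [|t [ot [et [ht min]]]] := least_ordinal ended t0 _ (Ord_mem _ _ oc tc0) et0.
    by rewrite /ended; dfn.
  exists t; do 2 split=> //; split=> //.
  by case: ht => [->|h] //; apply: Ord_trans oc h tc0.
have ok := going_on t tc min.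
have tsub : subset t c by move=> s st; apply: Ord_trans oc st tc.
have un s : s ∈ t -> unfinished Ed (lam s A) (lam s B).
  by move=> /min n; apply: NNPP => nu; apply: n; left.
(* The board is exhausted either by Maker's move in turn [t], when Maker has made one move more, or
   before turn [t] starts. *)
case: (classic (unfinished Ed (lam t A) (lam t B))) => [ut|nt].
- have u2 : ~ unfinished Ed (lam (succ t) A) (lam t B) by case: et.
  have [okt _] := maker_reply t tc ok ut.
  exists (lam (succ t) A), (lam t B); split.
    split=> //; exists (succ t), t; rewrite is_succE; split; first by right.
    apply: position_lam => //; first exact: Ord_succ.
    + by move=> s; rewrite in_succ; left.
    + by move=> s; rewrite in_succ => -[/ok []|->].
    + by move=> s /ok [].
  apply: follow_both => //; first exact: Ord_succ.
  + by move=> s; rewrite in_succ; left.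
  + by move=> s; rewrite in_succ => -[/tsub|->].
  + by move=> s; rewrite in_succ => -[/un|->].
- exists (lam t A), (lam t B); split.
    split=> //; exists t, t; split; first by left.
    by apply: position_lam => // s /ok [].
  by apply: follow_both => // s; rewrite in_succ; left.
Qed.

End Versus2.

Lemma complete_play_exists {M : structure} {HZ : ZFC M} (Ed f g : M) :
  maker_strategy Ed f -> breaker_strategy Ed g ->
  exists mk br, complete_play Ed mk br /\ maker_follows f mk br /\ breaker_follows g mk br.
Proof.
move=> mf bg; have [c [oc nc]] := Hartogs Ed; have [h hh] := rounds f g c oc.
apply: (versus_play Ed f g mf bg c oc nc (fun x => pr1 (ap h x)) (fun x => pr2 (ap h x))).
- by apply: DT_pr1; dfn.
- by apply: DT_pr2; dfn.
- by move=> t /hh [].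
- by move=> t /hh [].
Qed.

(** Omega, omega1 and the complete bipartite graph are unique in a model, so both strategies live on
    the same board and can be confronted. *)
Lemma not_both_win {M : structure} {HZ : ZFC M} :
  maker_wins_MB_K_omega_omega1 M -> ~ breaker_wins_MB_K_omega_omega1 M.
Proof.
move=> [w [o [V [Ed [hw [ho [bip [f [mf wf]]]]]]]]] [w' [o' [V' [Ed' [hw' [ho' [bip' [g [bg wg]]]]]]]]].
move: hw hw'; rewrite !is_omegaE => ew ew'; have eo : o = o' by exact: omega1_unique.
subst w w' o'.
have [eV eE] := bipartite_unique _ _ _ _ _ _ bip bip'; subst V' Ed'.
have [mk [br [cp [fm fb]]]] := complete_play_exists Ed f g mf bg.
exact: wg cp fb (wf _ _ cp fm).
Qed.

Theorem theorem1p1 :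
  (forall M : structure,
     ZFC M -> GCH M -> breaker_wins_MB_K_omega_omega1 M) /\
  (forall M : structure,
     ZFC M -> omega1_lt_p M -> maker_wins_MB_K_omega_omega1 M) /\
  ((consistent ZFC -> consistent (fun M => ZFC M /\ GCH M)) ->
   (consistent ZFC -> consistent (fun M => ZFC M /\ omega1_lt_p M)) ->
   consistent ZFC ->
   independent ZFC breaker_wins_MB_K_omega_omega1).
Proof.
split; [|split].
- exact: @breaker_wins.
- exact: @maker_wins.
move=> cG cp con; split.
- by have [M [HZ gch]] := cG con; exists M; split=> //; apply: breaker_wins.
- have [M [HZ lt]] := cp con; exists M; split=> //; apply: not_both_win.
  exact: maker_wins.
Qed.
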